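(* For the modified De Concini–Kac algebra $\mathscr U^{DK}$, the map $\mathrm{Alt}(G^\vee)\to \mathrm{CoTw}(\mathscr U^{DK})$, sending an alternating bilinear form $B$ on $G^\vee$ to the gauge equivalence class of the cocycle twist obtained by restricting $B$ along the Hopf projection $\mathscr U^{DK}\otimes\mathscr U^{DK}\to\mathbb C[G^\vee]\otimes\mathbb C[G^\vee]$, is a bijection.
   Context: Standing assumptions. $\mathfrak g$ is a finite-dimensional simple Lie algebra over $\mathbb C$ with fixed Cartan subalgebra and set of simple roots $\Gamma$. $(\cdot,\cdot)$ is the scaling of the Killing form with $(\alpha,\alpha)=2$ for short simple roots (all simple roots count as short in the simply laced case), and $\langle\alpha,\beta\rangle=2(\alpha,\beta)/(\alpha,\alpha)$. $q\in\mathbb C$ is a root of unity of odd order $l>1$; $l\ne 3$ in the simply laced case; $l\neq 3,5$ in types $B_n,C_n,F_4$; $l\ne 7$ and $3\nmid l$ in type $G_2$. Put $q_\alpha=q^{(\alpha,\alpha)/2}$; $\left[{n\atop m}\right]_{t}$ is the quantum binomial coefficient built from $[n]_{t}=(t^n-t^{-n})/(t-t^{-1})$. $G\cong (\mathbb Z/l)^{\mathrm{rank}\,\mathfrak g}$ is the abelian group with basis $K_\alpha$ ($\alpha\in\Gamma$) over $\mathbb Z/l\mathbb Z$ and $G^\vee$ is its character group. A root $\alpha$ is viewed as the character $K_\beta\mapsto q^{(\alpha,\beta)}$ of $G$. Modified De Concini–Kac algebra. $\mathscr U^{DK}=U^-_{q^{-1}}\rtimes\mathbb C[G^\vee]$,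 where $U^-_{q^{-1}}$ is the $\mathbb C$-algebra generated by $F_\alpha$ ($\alpha\in\Gamma$) with relations $\sum_{i=0}^{1-\langle\alpha,\beta\rangle}(-1)^i\left[{1-\langle\alpha,\beta\rangle\atop i}\right]_{q_\alpha^{-1}}F_\alpha^{1-\langle\alpha,\beta\rangle-i}F_\beta F_\alpha^i=0$ ($\alpha\ne\beta$), and $\omega F_\alpha\omega^{-1}=\omega(K_\alpha)F_\alpha$ for $\omega\in G^\vee$. It is a Hopf algebra with $G^\vee$ grouplike and $\Delta(F_\alpha)=F_\alpha\otimes\alpha^{-1}+1\otimes F_\alpha$. The Hopf projection $\mathscr U^{DK}\to\mathbb C[G^\vee]$ sends $F_\alpha\mapsto0$, $\omega\mapsto\omega$. Cocycle twists. A cocycle twist of a Hopf algebra $H$ is a convolution invertible $\sigma:H\otimes H\to\mathbb C$ with $\sigma(h_1h_1',h'')\sigma(h_2,h_2')=\sigma(h,h_1'h_1'')\sigma(h_2',h_2'')$ and $\sigma(1,h)=\sigma(h,1)=\epsilon(h)$. Two cocycle twists $\sigma,\sigma'$ are gauge equivalent if there is a convolution invertible $v:H\to\mathbb C$ with $\sigma'(h,h')=v(h_1h_1')\sigma(h_2,h_2')v^{-1}(h_3)v^{-1}(h_3')$. $\mathrm{CoTw}(H)$ is the set of gauge equivalence classes. A bilinear form on $G^\vee$ is a bimultiplicative map $B:G^\vee\times G^\vee\to\mathbb C^\times$, extended linearly to $\mathbb C[G^\vee]\otimes\mathbb C[G^\vee]$; it is alternating if $B(a,b)=B(b,a)^{-1}$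 for all $a,b$. $\mathrm{Alt}(G^\vee)$ is the set of alternating forms. *)

(* Defs.v *)
From HB Require Import structures.
From mathcomp Require Import all_boot all_order all_algebra all_fingroup.
From mathcomp Require Import cyclic generic_quotient sesquilinear.
From mathcomp Require Import boolp classical_sets functions reals.
From mathcomp.real_closed Require Import complex.

Set Implicit Arguments.
Unset Strict Implicit.
Unset Printing Implicit Defensive.

Import Order.TTheory GRing.Theory Num.Theory.
Local Open Scope ring_scope.
Local Open Scope quotient_scope.

Notation bilinear_map b := (bilinear_for *:%R *:%R b).
Notation bilinear_form b := (bilinear_for *%R *%R b).

(* A tensor is a finite list of pairs (a formal sum of pure tensors), modulo
   having the same image under every bilinear map. *)
Section Tensor.
Variables (K : comNzRingType) (U V : lmodType K).

Definition tens_eq (s t : seq (U * V)) : Prop :=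
  forall (W : lmodType K) (b : U -> V -> W), bilinear_map b ->
    \sum_(p <- s) b p.1 p.2 = \sum_(p <- t) b p.1 p.2.

Definition tens_rel : rel (seq (U * V)) := fun s t => `[< tens_eq s t >].

Lemma tens_rel_refl : reflexive tens_rel.
Proof. by move=> s; apply/asboolP. Qed.

Lemma tens_rel_sym : symmetric tens_rel.
Proof.
by move=> s t; apply/asboolP/asboolP => st W b bb; rewrite st.
Qed.

Lemma tens_rel_trans : transitive tens_rel.
Proof.
by move=> t s u /asboolP st /asboolP tu; apply/asboolP => W b bb; rewrite st ?tu.
Qed.

Canonical tens_equiv :=
  EquivRel tens_rel tens_rel_refl tens_rel_sym tens_rel_trans.

Definition tensor := {eq_quot tens_rel}.
HB.instance Definition _ := Choice.on tensor.
HB.instance Definition _ := EqQuotient.on tensor.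

Lemma tensorP s t : reflect (tens_eq s t) (\pi_tensor s == \pi_tensor t).
Proof. by rewrite eqmodE; apply: asboolP. Qed.

(* For bilinear b, tlift b is the linear map induced by b: it sends
   \sum u (x) v to \sum b u v. *)
Definition tlift (W : nmodType) (b : U -> V -> W) (t : tensor) : W :=
  \sum_(p <- repr t) b p.1 p.2.

Lemma tlift_pi (W : lmodType K) (b : U -> V -> W) s :
  bilinear_map b -> tlift b (\pi_tensor s) = \sum_(p <- s) b p.1 p.2.
Proof.
move=> bb; have /tensorP : \pi_tensor (repr (\pi_tensor s)) == \pi_tensor s.
  by rewrite reprK.
exact.
Qed.

Lemma tlift_inj t u :
  (forall (W : lmodType K) (b : U -> V -> W), bilinear_map b ->
     tlift b t = tlift b u) -> t = u.
Proof.
move=> tu; rewrite -[t]reprK -[u]reprK; apply/eqP/tensorP => W b bb.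
exact: tu.
Qed.

Definition pure (u : U) (v : V) : tensor := \pi_tensor [:: (u, v)].

Definition tzero : tensor := \pi_tensor [::].
Definition tadd (t u : tensor) : tensor := \pi_tensor (repr t ++ repr u).
Definition tscale (a : K) (t : tensor) : tensor :=
  \pi_tensor [seq (a *: p.1, p.2) | p <- repr t].
Definition topp (t : tensor) : tensor := tscale (-1) t.

Section Lift.
Variables (W : lmodType K) (b : U -> V -> W).
Hypothesis bb : bilinear_map b.

Lemma tlift0 : tlift b tzero = 0.
Proof. by rewrite tlift_pi // big_nil. Qed.

Lemma tliftD t u : tlift b (tadd t u) = tlift b t + tlift b u.
Proof. by rewrite tlift_pi // big_cat. Qed.

Lemma tliftZ a t : tlift b (tscale a t) = a *: tlift b t.
Proof.
rewrite tlift_pi // big_map scaler_sumr; apply: eq_bigr => p _ /=.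
have /= := bb.1 p.2 a p.1 0.
have -> : b 0 p.2 = 0.
  by have /= := bb.1 p.2 (-1) 0 0; rewrite !scaleN1r oppr0 addr0 addNr.
by rewrite !addr0.
Qed.

Lemma tlift_pure u v : tlift b (pure u v) = b u v.
Proof. by rewrite tlift_pi // big_seq1. Qed.

End Lift.

Lemma taddA : associative tadd.
Proof. by move=> t u v; apply: tlift_inj => W b bb; rewrite !tliftD // addrA. Qed.

Lemma taddC : commutative tadd.
Proof. by move=> t u; apply: tlift_inj => W b bb; rewrite !tliftD // addrC. Qed.

Lemma tadd0 : left_id tzero tadd.
Proof. by move=> t; apply: tlift_inj => W b bb; rewrite tliftD // tlift0 // add0r. Qed.

Lemma taddN : left_inverse tzero topp tadd.
Proof.
move=> t; apply: tlift_inj => W b bb.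
by rewrite tliftD // tliftZ // tlift0 // scaleN1r addNr.
Qed.

HB.instance Definition _ := GRing.isZmodule.Build tensor taddA taddC tadd0 taddN.

Lemma tscaleA a c (t : tensor) : tscale a (tscale c t) = tscale (a * c) t.
Proof. by apply: tlift_inj => W b bb; rewrite !tliftZ // scalerA. Qed.

Lemma tscale1 : left_id 1 tscale.
Proof. by move=> t; apply: tlift_inj => W b bb; rewrite tliftZ // scale1r. Qed.

Lemma tscaleDr : right_distributive tscale +%R.
Proof.
by move=> a t u; apply: tlift_inj => W b bb; rewrite !(tliftZ, tliftD) // scalerDr.
Qed.

Lemma tscaleDl (t : tensor) : {morph tscale^~ t : a c / a + c}.
Proof.
by move=> a c; apply: tlift_inj => W b bb; rewrite !(tliftZ, tliftD) // scalerDl.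
Qed.

HB.instance Definition _ :=
  GRing.Zmodule_isLmodule.Build K tensor tscaleA tscale1 tscaleDr tscaleDl.

End Tensor.

Arguments tlift {K U V W}.
Arguments pure {K U V}.
Notation "u (x) v" := (pure u v) (at level 40, no associativity) : ring_scope.

Definition tmul (K : comNzRingType) (A B : algType K) (t u : tensor A B) :
    tensor A B :=
  tlift (fun a b => tlift (fun a' b' => (a * a') (x) (b * b')) u) t.

Record hopf_structure (K : fieldType) (H : algType K) := HopfStructure {
  comul : {linear H -> tensor H H};
  counit : {linear H -> K^o};
  antipode : {linear H -> H};
  _ : forall h, tlift (fun a b => tlift (fun c d => c (x) (d (x) b)) (comul a))
                  (comul h)
              = tlift (fun a b => a (x) comul b) (comul h);
  _ : forall h, tlift (fun a b => counit a *: b) (comul h) = h;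
  _ : forall h, tlift (fun a b => counit b *: a) (comul h) = h;
  _ : comul 1 = 1 (x) 1;
  _ : forall g h, comul (g * h) = tmul (comul g) (comul h);
  _ : counit 1 = 1;
  _ : forall g h, counit (g * h) = (counit g : K) * counit h;
  _ : forall h, tlift (fun a b => antipode a * b) (comul h) = counit h *: 1;
  _ : forall h, tlift (fun a b => a * antipode b) (comul h) = counit h *: 1
}.

Section Cocycles.
Variables (K : fieldType) (H : algType K) (hs : hopf_structure H).

Local Notation eps := (counit hs).

(* Sweedler sums: sw2 h b is b(h_1, h_2) and sw3 h b is b(h_1, h_2, h_3), for
   (multi)linear b. *)
Definition sw2 (W : nmodType) (h : H) (b : H -> H -> W) : W :=
  tlift b (comul hs h).
Definition sw3 (W : nmodType) (h : H) (b : H -> H -> H -> W) : W :=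
  sw2 h (fun h1 h' => sw2 h' (b h1)).

(* Linear maps H (x) H -> K are represented by bilinear forms on H. *)
Definition conv_inverse2 (s t : H -> H -> K) : Prop :=
  forall h h',
    sw2 h (fun h1 h2 => sw2 h' (fun h1' h2' => s h1 h1' * t h2 h2'))
      = eps h * eps h' /\
    sw2 h (fun h1 h2 => sw2 h' (fun h1' h2' => t h1 h1' * s h2 h2'))
      = eps h * eps h'.

Definition conv_inverse1 (v w : H -> K) : Prop :=
  forall h, sw2 h (fun h1 h2 => v h1 * w h2) = eps h /\
            sw2 h (fun h1 h2 => w h1 * v h2) = eps h.

Definition cocycle_twist : set (H -> H -> K) := [set s |
  [/\ bilinear_form s,
      exists2 t : H -> H -> K, bilinear_form t & conv_inverse2 s t,
      forall h h' h'',
        sw2 h (fun h1 h2 => sw2 h' (fun h1' h2' =>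
          s (h1 * h1') h'' * s h2 h2'))
        = sw2 h' (fun h1' h2' => sw2 h'' (fun h1'' h2'' =>
          s h (h1' * h1'') * s h2' h2''))
    & forall h, s 1 h = eps h /\ s h 1 = eps h]].

Definition gauge_equiv (s s' : H -> H -> K) : Prop :=
  exists v w : H -> K,
    [/\ scalar v, scalar w, conv_inverse1 v w &
        forall h h',
          s' h h' = sw3 h (fun h1 h2 h3 => sw3 h' (fun h1' h2' h3' =>
            v (h1 * h1') * s h2 h2' * w h3 * w h3'))].

Definition gauge_class (s : H -> H -> K) : set (H -> H -> K) :=
  [set s' | cocycle_twist s' /\ gauge_equiv s s'].

Definition CoTw : set (set (H -> H -> K)) :=
  [set gauge_class s | s in cocycle_twist].

End Cocycles.

Section Characters.
Variables (G : finZmodType) (K : closedFieldType).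

Definition is_char (f : {ffun G -> K}) : bool :=
  (f 0 == 1) && [forall x, forall y, f (x + y) == f x * f y].

Record chargrp := CharGrp { char_fun :> {ffun G -> K}; _ : is_char char_fun }.

HB.instance Definition _ := [isSub for char_fun].
HB.instance Definition _ := [Choice of chargrp by <:].

Implicit Types a b c : chargrp.

Lemma char0 a : a 0 = 1.
Proof. by case: a => f /= /andP[/eqP]. Qed.

Lemma charD a x y : a (x + y) = a x * a y.
Proof. by case: a => f /= /andP[_ /forallP/(_ x)/forallP/(_ y)/eqP]. Qed.

Lemma charX a x m : a (x *+ m) = a x ^+ m.
Proof. by elim: m => [|m IH]; rewrite ?char0 // mulrS charD IH exprS. Qed.

Lemma char_unity a x : a x ^+ #|G| = 1.
Proof.
rewrite -charX -[RHS](char0 a); congr (a _).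
by have := @expg_cardG G [set: G]%G x (finset.in_setT x); rewrite cardsT.
Qed.

Definition unity_roots : seq K :=
  sval (closed_field_poly_normal ('X^#|G| - 1 : {poly K})).

Lemma unity_rootsP a x : a x \in unity_roots.
Proof.
rewrite /unity_roots; case: closed_field_poly_normal => r /= Dr.
have G0 : (0 < #|G|)%N by apply/card_gt0P; exists 0.
have : root ('X^#|G| - 1 : {poly K}) (a x).
  by rewrite rootE !hornerE char_unity subrr.
rewrite Dr lead_coefXnsubC // scale1r.
by rewrite root_prod_XsubC.
Qed.

Definition char_code a : {ffun G -> seq_sub unity_roots} :=
  [ffun x => SeqSub (unity_rootsP a x)].
Definition char_decode (f : {ffun G -> seq_sub unity_roots}) : option chargrp :=
  insub [ffun x => ssval (f x)].

Lemma char_codeK : pcancel char_code char_decode.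
Proof.
move=> a; rewrite /char_decode.
have -> : [ffun x => ssval (char_code a x)] = val a.
  by apply/ffunP => x; rewrite !ffunE.
exact: valK.
Qed.

HB.instance Definition _ := Countable.copy chargrp (pcan_type char_codeK).
HB.instance Definition _ : isFinite chargrp := PCanIsFinite char_codeK.

Lemma char1_subproof : is_char [ffun=> 1].
Proof.
by rewrite /is_char ffunE eqxx; apply/forallP => x; apply/forallP => y;
   rewrite !ffunE mul1r.
Qed.
Definition char1 := CharGrp char1_subproof.

Lemma charM_subproof a b : is_char [ffun x => a x * b x].
Proof.
rewrite /is_char ffunE !char0 mul1r eqxx.
by apply/forallP => x; apply/forallP => y; rewrite !ffunE !charD mulrACA.
Qed.
Definition charM a b := CharGrp (charM_subproof a b).

Lemma charV_subproof a : is_char [ffun x => (a x)^-1].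
Proof.
rewrite /is_char ffunE char0 invr1 eqxx.
by apply/forallP => x; apply/forallP => y; rewrite !ffunE charD invfM.
Qed.
Definition charV a := CharGrp (charV_subproof a).

Lemma charMA : associative charM.
Proof. by move=> a b c; apply/val_inj/ffunP => x; rewrite !ffunE mulrA. Qed.

Lemma char1M : left_id char1 charM.
Proof. by move=> a; apply/val_inj/ffunP => x; rewrite !ffunE mul1r. Qed.

Lemma charVM : left_inverse char1 charV charM.
Proof.
move=> a; apply/val_inj/ffunP => x; rewrite !ffunE mulVf //.
apply/eqP => ax0; have /eqP := char_unity a x.
have /card_gt0P/lt0n_neq0/negPf G0 : exists y, y \in G by exists 0.
by rewrite ax0 expr0n G0 eq_sym oner_eq0.
Qed.

HB.instance Definition _ :=
  Finite_isGroup.Build chargrp charMA char1M charVM.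

End Characters.

(* An element of the group algebra is its family of coefficients. *)
Definition grpalg (K : fieldType) (gT : finGroupType) := {ffun gT -> K}.

Section GroupAlgebra.
Variables (K : fieldType) (gT : finGroupType).
Local Notation A := (grpalg K gT).

HB.instance Definition _ := GRing.Zmodule.on A.
HB.instance Definition _ := GRing.Lmodule.copy A {ffun gT -> K^o}.

Implicit Types f g h : A.

Definition gbasis (a : gT) : A := [ffun x => (x == a)%:R].

Definition gmul f g : A := [ffun c => \sum_a f a * g (a^-1 * c)%g].

Lemma gmulA : associative gmul.
Proof.
move=> f g h; apply/ffunP => c; rewrite !ffunE.
under eq_bigr => a _ do rewrite ffunE big_distrr /=.
under [RHS]eq_bigr => b _ do rewrite ffunE big_distrl /=.
rewrite [RHS]exchange_big /=; apply: eq_bigr => a _.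
rewrite [RHS](reindex_inj (mulgI a)) /=; apply: eq_bigr => b _.
by rewrite mulKg invMg !mulgA mulrA.
Qed.

Lemma gmul1 : left_id (gbasis 1%g) gmul.
Proof.
move=> f; apply/ffunP => c; rewrite ffunE (bigD1 1%g) //= big1 => [|a a1].
  by rewrite ffunE eqxx mul1r invg1 mul1g addr0.
by rewrite ffunE (negPf a1) mul0r.
Qed.

Lemma g1mul : right_id (gbasis 1%g) gmul.
Proof.
move=> f; apply/ffunP => c; rewrite ffunE (bigD1 c) //= big1 => [|a ac].
  by rewrite ffunE mulVg eqxx mulr1 addr0.
by rewrite ffunE -eq_mulVg1 (negPf ac) mulr0.
Qed.

Lemma gmulDl : left_distributive gmul +%R.
Proof.
move=> f g h; apply/ffunP => c; rewrite !ffunE -big_split /=.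
by apply: eq_bigr => a _; rewrite ffunE mulrDl.
Qed.

Lemma gmulDr : right_distributive gmul +%R.
Proof.
move=> f g h; apply/ffunP => c; rewrite !ffunE -big_split /=.
by apply: eq_bigr => a _; rewrite ffunE mulrDr.
Qed.

Lemma gbasis1_neq0 : gbasis 1%g != 0.
Proof.
by apply/eqP => /ffunP/(_ 1%g); rewrite !ffunE eqxx => /eqP; rewrite oner_eq0.
Qed.

HB.instance Definition _ :=
  GRing.Zmodule_isNzRing.Build A gmulA gmul1 g1mul gmulDl gmulDr gbasis1_neq0.

Lemma gscaleAl (k : K) f g : k *: (f * g) = (k *: f) * g.
Proof.
apply/ffunP => c; rewrite !ffunE scaler_sumr; apply: eq_bigr => a _.
by rewrite ffunE; apply: mulrA.
Qed.

HB.instance Definition _ := GRing.Lmodule_isLalgebra.Build K A gscaleAl.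

Lemma gscaleAr (k : K) f g : k *: (f * g) = f * (k *: g).
Proof.
apply/ffunP => c; rewrite !ffunE scaler_sumr; apply: eq_bigr => a _.
by rewrite ffunE; apply: mulrCA.
Qed.

HB.instance Definition _ := GRing.Lalgebra_isAlgebra.Build K A gscaleAr.

(* A bilinear form on the group takes its values in the nonzero scalars. *)
Definition bicharacter (B : gT -> gT -> K) : Prop :=
  [/\ forall a b, B a b != 0,
      forall a b c, B (a * b)%g c = B a c * B b c
    & forall a b c, B a (b * c)%g = B a b * B a c].

Definition Alt : set (gT -> gT -> K) :=
  [set B | bicharacter B /\ forall a b, B a b = (B b a)^-1].

Definition bilin_ext (B : gT -> gT -> K) (f g : A) : K :=
  \sum_a \sum_b f a * g b * B a b.

End GroupAlgebra.

Record lie_structure (F : fieldType) (L : vectType F) := LieStructure {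
  bracket :> L -> L -> L;
  _ : bilinear_map bracket;
  _ : forall x, bracket x x = 0;
  _ : forall x y z, bracket x (bracket y z) + bracket y (bracket z x)
                    + bracket z (bracket x y) = 0
}.

Section Lie.
Variables (F : fieldType) (L : vectType F) (br : lie_structure L).

Definition lie_ideal (I : {vspace L}) : Prop :=
  forall x y, y \in I -> br x y \in I.

Definition simple_lie : Prop :=
  (exists x y, br x y != 0) /\
  (forall I : {vspace L}, lie_ideal I -> I = 0%VS \/ I = fullv).

(* Cartan subalgebra: a nilpotent subalgebra equal to its own normalizer.
   Nilpotency says that all brackets [x_1, [x_2, ... [x_k, y]]] in h vanish,
   for some k. *)
Definition cartan_subalgebra (h : {vspace L}) : Prop :=
  [/\ forall x y, x \in h -> y \in h -> br x y \in h,
      exists k : nat, forall (s : k.-tuple L) y,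
        {subset s <= h} -> y \in h -> foldr br y s = 0
    & forall x, (forall y, y \in h -> br x y \in h) -> x \in h].

(* The trace of ad x \o ad y, computed in the basis vbasis fullv. *)
Definition killing (x y : L) : F :=
  \sum_(i < \dim (fullv : {vspace L}))
     coord (vbasis fullv) i (br x (br y (vbasis fullv)`_i)).

Variable h : {vspace L}.
Local Notation hdual := ('Hom(subvs_of h, F^o)).

Definition is_root (a : hdual) : Prop :=
  a != 0 /\ exists2 x : L, x != 0 & forall t : subvs_of h, br (vsval t) x = a t *: x.

Definition simple_roots (n : nat) (alpha : 'I_n -> hdual) : Prop :=
  [/\ forall i, is_root (alpha i),
      free [tuple alpha i | i < n]
    & forall b, is_root b -> exists c : 'I_n -> nat,
        b = \sum_i alpha i *+ c i \/ b = - \sum_i alpha i *+ c i].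

(* ip i j stands for (alpha_i, alpha_j).  The Killing form is transported to
   the dual of h through the elements t_i of h representing the alpha_i; the
   scaling is fixed by (alpha_i, alpha_i) = 2 for the simple roots of minimal
   length. *)
Definition normalized_killing (n : nat) (alpha : 'I_n -> hdual)
    (ip : 'I_n -> 'I_n -> int) : Prop :=
  (exists (k : F) (t : 'I_n -> subvs_of h),
     (forall i x, killing (vsval (t i)) (vsval x) = alpha i x) /\
     (forall i j, (ip i j)%:~R = k * killing (vsval (t i)) (vsval (t j)))) /\
  (forall i, (forall j, ip i i <= ip j j) -> ip i i = 2).

End Lie.

Inductive dynkin := DynA of nat | DynB of nat | DynC of nat | DynD of nat
                  | DynE of nat | DynF4 | DynG2.

Definition dynkin_rank (X : dynkin) : nat :=
  match X with
  | DynA n | DynB n | DynC n | DynD n | DynE n => n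
  | DynF4 => 4
  | DynG2 => 2
  end.

Definition dynkin_valid (X : dynkin) : bool :=
  match X with
  | DynA n => 1 <= n
  | DynB n => 2 <= n
  | DynC n => 3 <= n
  | DynD n => 4 <= n
  | DynE n => 6 <= n <= 8
  | DynF4 | DynG2 => true
  end%N.

(* Edges (i, j) with i < j; the numbering is Bourbaki's, shifted to start
   at 0. *)
Definition dynkin_edge (X : dynkin) (i j : nat) : bool :=
  match X with
  | DynD n => ((j == i.+1) && (j < n.-1)) || ((j == n.-1) && (j == i.+2))
  | DynE _ => ((j == i.+1) && (2 <= i)) || ((i, j) \in [:: (0, 2); (1, 3)])
  | _ => j == i.+1
  end%N.

(* The squared length of the i-th simple root, relative to a short one. *)
Definition dynkin_len (X : dynkin) (i : nat) : nat :=
  match X with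
  | DynA _ | DynD _ | DynE _ => 1
  | DynB n => if i == n.-1 then 1 else 2
  | DynC n => if i == n.-1 then 2 else 1
  | DynF4 => if i < 2 then 2 else 1
  | DynG2 => if i == 0 then 1 else 3
  end%N.

(* <alpha_i, alpha_j> = 2 (alpha_i, alpha_j) / (alpha_i, alpha_i), normalized
   by the first argument, so that two adjacent roots give minus the length of
   the longer one divided by the length of alpha_i. *)
Definition dynkin_cartan (X : dynkin) (i j : nat) : int :=
  if i == j then 2 else
  if dynkin_edge X i j || dynkin_edge X j i then
    - (maxn (dynkin_len X i) (dynkin_len X j) %/ dynkin_len X i)%N%:Z
  else 0.

Definition of_type (X : dynkin)
    (ip : 'I_(dynkin_rank X) -> 'I_(dynkin_rank X) -> int) : Prop :=
  dynkin_valid X /\ forall i j, 2 * ip i j = dynkin_cartan X i j * ip i i.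

Definition admissible_order (X : dynkin) (l : nat) : bool :=
  [&& odd l, 1 < l &
    match X with
    | DynA _ | DynD _ | DynE _ => l != 3
    | DynB _ | DynC _ | DynF4 => (l != 3) && (l != 5)
    | DynG2 => (l != 7) && ~~ (3 %| l)
    end]%N.

Section QuantumIntegers.
Variables (K : fieldType) (t : K).
Definition qint (n : nat) : K := (t ^+ n - t ^- n) / (t - t^-1).
Definition qfact (n : nat) : K := \prod_(1 <= k < n.+1) qint k.
Definition qbinom (n m : nat) : K := qfact n / (qfact m * qfact (n - m)).
End QuantumIntegers.

Section DeConciniKac.
Variables (K : closedFieldType) (n l : nat) (ip : 'I_n -> 'I_n -> int) (q : K).

(* The group G, written additively; it is used for l > 1 only, as 'Z_l is
   Z/2Z for l <= 1. *)
Definition torus : finZmodType := 'rV['Z_l]_n.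
Definition Kgen (i : 'I_n) : torus := delta_mx 0 i.

Local Notation Gv := (chargrp torus K).

Definition pairing (i j : 'I_n) : int := (2 * ip i j %/ ip i i)%Z.
Definition qroot (i : 'I_n) : K := q ^ (ip i i %/ 2)%Z.

Definition serre (A : algType K) (F : 'I_n -> A) (i j : 'I_n) : A :=
  let m := `|1 - pairing i j|%N in
  \sum_(k < m.+1)
     ((-1) ^+ k * qbinom (qroot i)^-1 m k) *: (F i ^+ (m - k) * F j * F i ^+ k).

Definition DK_relations (A : algType K) (F : 'I_n -> A) (w : Gv -> A) : Prop :=
  [/\ forall i j, i != j -> serre F i j = 0,
      w 1%g = 1,
      forall a b, w (a * b)%g = w a * w b
    & forall a i, w a * F i * w (a^-1)%g = a (Kgen i) *: F i].

(* The algebra generated by F and w with the relations above, as a universal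
   property: the semidirect product U^- >< C[G^v] has this presentation. *)
Definition DK_algebra (H : algType K) (F : 'I_n -> H) (w : Gv -> H) : Prop :=
  DK_relations F w /\
  forall (A : algType K) (F' : 'I_n -> A) (w' : Gv -> A), DK_relations F' w' ->
    exists2 f : {lrmorphism H -> A},
      (forall i, f (F i) = F' i) /\ (forall a, f (w a) = w' a)
    & forall g : {lrmorphism H -> A},
      (forall i, g (F i) = F' i) -> (forall a, g (w a) = w' a) -> g =1 f.

Definition root_character (a : 'I_n -> Gv) : Prop :=
  forall i j, a i (Kgen j) = q ^ ip i j.

(* The counit and the antipode are determined by the comultiplication, and the
   latter by its values on the generators. *)
Definition DK_hopf (a : 'I_n -> Gv) (H : algType K) (F : 'I_n -> H)
    (w : Gv -> H) (hs : hopf_structure H) : Prop :=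
  (forall b, comul hs (w b) = w b (x) w b) /\
  (forall i, comul hs (F i) = F i (x) w ((a i)^-1)%g + 1 (x) F i).

Definition DK_projection (H : algType K) (F : 'I_n -> H) (w : Gv -> H)
    (p : {lrmorphism H -> grpalg K Gv}) : Prop :=
  (forall i, p (F i) = 0) /\ (forall a, p (w a) = gbasis K a).

End DeConciniKac.

Definition restrict_form (K : fieldType) (gT : finGroupType) (H : algType K)
    (p : H -> grpalg K gT) (B : gT -> gT -> K) : H -> H -> K :=
  fun h h' => bilin_ext B (p h) (p h').

(* Main.v *)
Require Import Defs.
From HB Require Import structures.
From mathcomp Require Import all_boot all_order all_algebra all_fingroup.
From mathcomp Require Import boolp classical_sets functions reals.
From mathcomp Require Import generic_quotient sesquilinear spectral.
From mathcomp.real_closed Require Import complex.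
From mathcomp Require Import ring zify.

(* A cocycle twist s of U defines a twisted product g.h = g1 h1 s(g2, h2) on U,
   for which U is a left comodule algebra via its coproduct.  On the group-likes
   Gv, s is a 2-cocycle of an abelian group of odd exponent, hence cohomologous
   to an alternating form B with B^2 = the alternation of s.  To compare s with
   the restriction of B, let E be the twist of U tensored with the group algebra
   of Gv twisted by B^-1.  The grouplikes w x (x) x, suitably rescaled, multiply
   in E without cocycle, and F_i + lambda_i, for a suitable scalar lambda_i
   (it exists since q^(alpha_i, alpha_i) <> 1), is an eigenvector for them.  The
   quantum Serre elements being primitive, those of the F_i + lambda_i are
   coinvariant in E, i.e. scalars in degree g^-1, where g is the character
   m alpha_i + alpha_j with m = 1 - <alpha_i, alpha_j>.  Such a scalar commutes
   with the image of g, which also acts on it by q^(|m alpha_i + alpha_j|^2);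
   that number is not 1 for admissible orders, so the scalar vanishes.  Hence
   there is an algebra map f : U -> E, and v = (counit (x) sum of coefficients) o f
   is a gauge transformation between the two cocycles; its convolution inverse is
   built from f o antipode.  Injectivity is seen on the group-likes, where a
   gauge transformation changes a cocycle by a symmetric factor. *)

Set Implicit Arguments.
Unset Strict Implicit.
Unset Printing Implicit Defensive.

Import Order.TTheory GRing.Theory Num.Theory.
Local Open Scope ring_scope.

(** * Sweedler calculus *)

(** [U] is accessible only through its universal property: with no basis of monomials at hand, a
    functional on [U] cannot be prescribed by its values. An algebra map can be given on generators,
    and two of them compared there; hence the detour through E, and the encoding of coactions and
    gradings as algebra maps. The functional v drawn from f satisfies the gauge relation because f
    respects two structures of E, the left coaction of [U] and the grading by Gv. They force f = J *
    V * P for convolution, with J the inclusion of [U] in degree 1, V = v.1 and P the projection to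
    the group algebra: in f(hk) = f(h) f(k) the factors J give s, the factors P give B^-1, and V
    gives the coboundary. The inclusion J is not known to be convolution invertible at that point,
    so f^-1 * J inverts V * P on one side only; on the other side J is cancelled by applying the
    counit to coefficients. Coinvariance does not by itself make the lifted Serre elements vanish,
    since a scalar may survive in a nontrivial degree; this is where the order of q matters. *)

Section LinearFunctions.
Variables (K : comNzRingType).
Implicit Types U V W : lmodType K.

Lemma lin_id U : linear (fun x : U => x). Proof. by []. Qed.

Lemma lin_fun U V W (g : {linear V -> W}) (f : U -> V) :
  linear f -> linear (fun x => g (f x)).
Proof. by move=> lf k x y; rewrite lf linearP. Qed.

Lemma lin_comp U V W (g : V -> W) (f : U -> V) :
  linear g -> linear f -> linear (fun x => g (f x)).
Proof. by move=> lg lf k x y; rewrite lf lg. Qed.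

Lemma lin_add U W (f g : U -> W) :
  linear f -> linear g -> linear (fun x => f x + g x).
Proof. by move=> lf lg k x y; rewrite lf lg scalerDr addrACA. Qed.

Lemma lin_sum U W I (r : seq I) (f : I -> U -> W) :
  (forall i, linear (f i)) -> linear (fun x => \sum_(i <- r) f i x).
Proof.
move=> lf k x y; rewrite scaler_sumr -big_split /=.
by apply: eq_bigr => i _; rewrite lf.
Qed.

Lemma lin_mull U (A : algType K) (a : A) (f : U -> A) :
  linear f -> linear (fun x => a * f x).
Proof. by move=> lf k x y; rewrite lf mulrDr scalerAr. Qed.

Lemma lin_mulr U (A : algType K) (a : A) (f : U -> A) :
  linear f -> linear (fun x => f x * a).
Proof. by move=> lf k x y; rewrite lf mulrDl scalerAl. Qed.

Lemma lin_scaler U W (a : K) (f : U -> W) :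
  linear f -> linear (fun x => a *: f x).
Proof. by move=> lf k x y; rewrite lf scalerDr !scalerA mulrC. Qed.

Lemma lin_scalel U W (v : W) (f : U -> K) :
  linear (f : U -> K^o) -> linear (fun x => f x *: v).
Proof. by move=> lf k x y; rewrite lf scalerDl scalerA. Qed.

Lemma lin_kmull U (a : K) (f : U -> K) :
  linear (f : U -> K^o) -> linear (fun x => a * f x : K^o).
Proof. by move=> lf k x y; rewrite lf mulrDr; congr (_ + _); apply: mulrCA. Qed.

Lemma lin_kmulr U (a : K) (f : U -> K) :
  linear (f : U -> K^o) -> linear (fun x => f x * a : K^o).
Proof. by move=> lf k x y; rewrite lf mulrDl; congr (_ + _); apply/esym/mulrA. Qed.

Lemma lin0 U W (f : U -> W) : linear f -> f 0 = 0.
Proof. by move=> lf; have := lf (-1) 0 0; rewrite !scaleN1r !addr0 oppr0 addNr. Qed.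

Lemma linD U W (f : U -> W) x y : linear f -> f (x + y) = f x + f y.
Proof. by move=> lf; have := lf 1 x y; rewrite !scale1r. Qed.

Lemma linZ U W (f : U -> W) k x : linear f -> f (k *: x) = k *: f x.
Proof. by move=> lf; have := lf k x 0; rewrite (lin0 lf) !addr0. Qed.

Lemma lin_big U W (f : U -> W) I (r : seq I) (P : pred I) (F : I -> U) :
  linear f -> f (\sum_(i <- r | P i) F i) = \sum_(i <- r | P i) f (F i).
Proof.
move=> lf; elim/big_rec2: _ => [|i y x _ <-]; first exact: lin0.
exact: linD.
Qed.

Lemma bilinP U V W (b : U -> V -> W) :
  (forall v, linear (b^~ v)) -> (forall u, linear (b u)) -> bilinear_map b.
Proof. by move=> bl br; split. Qed.

End LinearFunctions.

Section TensorTheory.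
Variables (K : comNzRingType) (U V : lmodType K).
Implicit Types (W : lmodType K) (t : tensor U V).

Lemma tlift_linear W (b : U -> V -> W) : bilinear_map b -> linear (tlift b).
Proof. by move=> bb k s t; rewrite [LHS]tliftD // tliftZ. Qed.

Lemma tliftE W (b : U -> V -> W) u v :
  bilinear_map b -> tlift b (u (x) v) = b u v.
Proof. by move=> bb; apply: tlift_pure. Qed.

Lemma pure_bilin : bilinear_map (@pure K U V).
Proof.
by split=> w k x y /=; apply: tlift_inj => W b bb;
  rewrite !(tliftE, tlift_linear) //; case: bb => bl br;
  [apply: bl | apply: br].
Qed.

Lemma lin_pl W (f : W -> U) (v : V) : linear f -> linear (fun x => f x (x) v).
Proof. by move=> lf k x y; rewrite lf; apply: (pure_bilin.1 v). Qed.

Lemma lin_pr W (f : W -> V) (u : U) : linear f -> linear (fun x => u (x) f x).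
Proof. by move=> lf k x y; rewrite lf; apply: (pure_bilin.2 u). Qed.

Lemma tensorE t : t = \sum_(p <- repr t) p.1 (x) p.2.
Proof.
apply: tlift_inj => W b bb; rewrite (lin_big _ _ _ (tlift_linear bb)).
by apply: eq_bigr => p _; rewrite tliftE.
Qed.

Lemma tensor_ind (P : tensor U V -> Prop) :
  P 0 -> (forall u v t, P t -> P (u (x) v + t)) -> forall t, P t.
Proof.
move=> P0 PD t; rewrite [t]tensorE; elim: (repr t) => [|p s IH].
  by rewrite big_nil.
by rewrite big_cons; apply: PD.
Qed.

End TensorTheory.

Section SweedlerSums.
Variables (K : fieldType) (H : algType K) (hs : hopf_structure H).
Implicit Types (W : lmodType K) (g h k : H).
Local Notation eps := (counit hs).
Local Notation sw := (sw2 hs).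

Lemma eq_sw2 (W : nmodType) h (b c : H -> H -> W) :
  (forall x y, b x y = c x y) -> sw h b = sw h c.
Proof. by move=> bc; apply: eq_bigr => p _. Qed.

Lemma sw2_exch (W : nmodType) g h (T : H -> H -> H -> H -> W) :
  sw g (fun a b => sw h (fun c d => T a b c d))
  = sw h (fun c d => sw g (fun a b => T a b c d)).
Proof. exact: exchange_big. Qed.

Lemma sw2_exch_sum (W : nmodType) g I (r : seq I) (P : pred I)
    (T : I -> H -> H -> W) :
  sw g (fun a b => \sum_(i <- r | P i) T i a b)
  = \sum_(i <- r | P i) sw g (T i).
Proof. exact: exchange_big. Qed.

Lemma sw2_fun W W' (f : W -> W') h (b : H -> H -> W) :
  linear f -> f (sw h b) = sw h (fun x y => f (b x y)).
Proof. by move=> lf; apply: lin_big. Qed.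

Lemma sw2_mull (A : algType K) (a : A) h (b : H -> H -> A) :
  a * sw h b = sw h (fun x y => a * b x y).
Proof. exact: mulr_sumr. Qed.

Lemma sw2_mulr (A : algType K) (a : A) h (b : H -> H -> A) :
  sw h b * a = sw h (fun x y => b x y * a).
Proof. exact: mulr_suml. Qed.

Lemma sw2_kmull (a : K) h (b : H -> H -> K) :
  a * sw h b = sw h (fun x y => a * b x y).
Proof. exact: mulr_sumr. Qed.

Lemma sw2_kmulr (a : K) h (b : H -> H -> K) :
  sw h b * a = sw h (fun x y => b x y * a).
Proof. exact: mulr_suml. Qed.

Lemma sw2_scaler W (a : K) h (b : H -> H -> W) :
  a *: sw h b = sw h (fun x y => a *: b x y).
Proof. exact: scaler_sumr. Qed.

Lemma sw2_scalel W (v : W) h (b : H -> H -> K) :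
  sw h b *: v = sw h (fun x y => b x y *: v).
Proof. exact: scaler_suml. Qed.

Lemma lin_sw2 W W' h (b : W -> H -> H -> W') :
  (forall x y, linear (fun w => b w x y)) -> linear (fun w => sw h (b w)).
Proof. by move=> lb; apply: lin_sum => p; apply: lb. Qed.

Lemma lin_sw2_arg W W' (f : W -> H) (b : H -> H -> W') :
  linear f -> (forall y, linear (b^~ y)) -> (forall x, linear (b x)) ->
  linear (fun w => sw (f w) b).
Proof.
move=> lf bl br; apply: (lin_comp (g := fun h => sw h b)) => //.
by move=> k x y; rewrite /sw2 linearP tlift_linear.
Qed.

Lemma sw2_pure h x y W (b : H -> H -> W) : comul hs h = x (x) y ->
  (forall y, linear (b^~ y)) -> (forall x, linear (b x)) -> sw h b = b x y.
Proof. by move=> E bl br; rewrite /sw2 E tliftE. Qed.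

Lemma sw2_pure2 h x y x' y' W (b : H -> H -> W) :
  comul hs h = x (x) y + x' (x) y' ->
  (forall y, linear (b^~ y)) -> (forall x, linear (b x)) ->
  sw h b = b x y + b x' y'.
Proof.
move=> E bl br; rewrite /sw2 E (linD _ _ (tlift_linear (bilinP bl br))).
by rewrite !tliftE.
Qed.

Lemma sw2_comul h : sw h (@pure _ _ _) = comul hs h.
Proof. by rewrite [RHS]tensorE. Qed.

Lemma comul_coassoc h :
  sw h (fun a c => sw a (fun a b => a (x) (b (x) c)))
  = sw h (fun a b => a (x) comul hs b).
Proof. by rewrite /sw2; case: hs. Qed.

(** The coassociativity axiom is an equality in a triple tensor product; the linear map induced
    there by the trilinear [t] transports it to [W]. *)
Lemma sw2_coassoc W h (t : H -> H -> H -> W) :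
  (forall b c, linear (fun a => t a b c)) ->
  (forall a c, linear (fun b => t a b c)) ->
  (forall a b, linear (fun c => t a b c)) ->
  sw h (fun a c => sw a (fun a b => t a b c))
  = sw h (fun a b => sw b (fun b c => t a b c)).
Proof.
move=> t1 t2 t3.
have tb a : bilinear_map (t a) by split.
have bt : bilinear_map (fun a => tlift (t a)).
  by split=> x; [apply: lin_sum => p; apply: t1 | apply: tlift_linear].
have /(congr1 (tlift (fun a => tlift (t a)))) := comul_coassoc h.
rewrite !(sw2_fun _ _ (tlift_linear bt)).
under eq_sw2 => a c do rewrite (sw2_fun _ _ (tlift_linear bt)).
move=> E; transitivity
  (sw h (fun a c => sw a (fun a b => tlift (fun a => tlift (t a)) (a (x) (b (x) c))))).
  by do 2!apply: eq_sw2 => ? ?; rewrite !tliftE.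
by rewrite E; apply: eq_sw2 => ? ?; rewrite tliftE.
Qed.

Lemma sw2_counitl W h (f : H -> W) : linear f ->
  sw h (fun a b => eps a *: f b) = f h.
Proof.
move=> lf; have E : sw h (fun a b => eps a *: b) = h by rewrite /sw2; case: hs.
by rewrite -[in RHS]E (sw2_fun _ _ lf); apply: eq_sw2 => a b; rewrite linZ.
Qed.

Lemma sw2_counitr W h (f : H -> W) : linear f ->
  sw h (fun a b => eps b *: f a) = f h.
Proof.
move=> lf; have E : sw h (fun a b => eps b *: a) = h by rewrite /sw2; case: hs.
by rewrite -[in RHS]E (sw2_fun _ _ lf); apply: eq_sw2 => a b; rewrite linZ.
Qed.

Lemma comul1 : comul hs 1 = 1 (x) 1. Proof. by case: hs. Qed.

Lemma counit1 : eps 1 = 1. Proof. by case: hs. Qed.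

Lemma counitM g h : eps (g * h) = (eps g : K) * eps h.
Proof. by case: hs. Qed.

Lemma antipodel h : sw h (fun a b => antipode hs a * b) = eps h *: 1.
Proof. by rewrite /sw2; case: hs. Qed.

Lemma antipoder h : sw h (fun a b => a * antipode hs b) = eps h *: 1.
Proof. by rewrite /sw2; case: hs. Qed.

Lemma comulM g h : comul hs (g * h)
  = sw g (fun a b => sw h (fun c d => (a * c) (x) (b * d))).
Proof. by have -> : comul hs (g * h) = tmul (comul hs g) (comul hs h) by case: hs. Qed.

Lemma sw2M W g h (b : H -> H -> W) :
  (forall y, linear (b^~ y)) -> (forall x, linear (b x)) ->
  sw (g * h) b = sw g (fun x y => sw h (fun x' y' => b (x * x') (y * y'))).
Proof.
move=> bl br; have lb := tlift_linear (bilinP bl br).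
rewrite {1}/sw2 comulM (sw2_fun _ _ lb); apply: eq_sw2 => x y.
by rewrite (sw2_fun _ _ lb); apply: eq_sw2 => x' y'; rewrite tliftE.
Qed.
End SweedlerSums.

(** Linearity in one variable of nested Sweedler sums, proved by descending through the term. The
    generic composition rules come last so that the specific ones are tried before them. *)
Ltac lin_step := first
  [ assumption
  | exact: lin_id
  | exact: linearP
  | apply: lin_sw2 => ? ?
  | apply: lin_sum => ?
  | apply: lin_kmull | apply: lin_kmulr
  | apply: lin_mull | apply: lin_mulr
  | apply: lin_scaler | apply: lin_scalel
  | apply: lin_pl | apply: lin_pr
  | apply: lin_add
  | apply: lin_sw2_arg => [|?|?]
  | apply: lin_fun ].
Ltac lin := intros; cbv beta; repeat (lin_step; cbv beta).

(** * Convolution of linear maps and of bilinear forms *)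

Section Convolution.
Variables (K : fieldType) (H : algType K) (hs : hopf_structure H).
Local Notation eps := (counit hs).
Local Notation sw := (sw2 hs).

Definition conv (A : algType K) (f g : H -> A) : H -> A :=
  fun h => sw h (fun a b => f a * g b).

Definition conv_unit (A : algType K) : H -> A := fun h => eps h *: 1.

Section Algebra.
Variable A : algType K.
Implicit Types f g k : {linear H -> A}.

Lemma conv_linear f g : linear (conv f g).
Proof. by rewrite /conv; lin. Qed.
HB.instance Definition _ f g :=
  GRing.isLinear.Build K H A *:%R (conv f g) (conv_linear f g).

Lemma conv_unit_linear : linear (conv_unit A).
Proof. by rewrite /conv_unit; lin. Qed.
HB.instance Definition _ :=
  GRing.isLinear.Build K H A *:%R (conv_unit A) conv_unit_linear.

Lemma convA f g k : conv (conv f g) k = conv f (conv g k).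
Proof.
apply/funext => h; rewrite /conv.
under eq_sw2 => a b do rewrite sw2_mulr.
under [RHS]eq_sw2 => a b do rewrite sw2_mull.
rewrite sw2_coassoc; try by lin.
by do 2!apply: eq_sw2 => ? ?; rewrite mulrA.
Qed.

Lemma conv1f f : conv (conv_unit A) f = f.
Proof.
apply/funext => h; rewrite /conv /conv_unit -[RHS](sw2_counitl hs); last exact: linearP.
by apply: eq_sw2 => a b; rewrite -scalerAl mul1r.
Qed.

Lemma convf1 f : conv f (conv_unit A) = f.
Proof.
apply/funext => h; rewrite /conv /conv_unit -[RHS](sw2_counitr hs); last exact: linearP.
by apply: eq_sw2 => a b; rewrite -scalerAr mulr1.
Qed.

Lemma conv_morph (B : algType K) (phi : {lrmorphism A -> B}) f g :
  phi \o conv f g = conv (phi \o f) (phi \o g).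
Proof.
apply/funext => h; rewrite /conv /= (sw2_fun hs _ _ (linearP phi)).
by apply: eq_sw2 => a b; rewrite rmorphM.
Qed.

Lemma conv_unit_morph (B : algType K) (phi : {lrmorphism A -> B}) :
  phi \o conv_unit A = conv_unit B.
Proof. by apply/funext => h; rewrite /conv_unit /= linearZ rmorph1. Qed.

Lemma conv_antipodel (f : {lrmorphism H -> A}) :
  conv (f \o antipode hs) f = conv_unit A.
Proof.
apply/funext => h; rewrite /conv /conv_unit -(rmorph1 f) -linearZ /= -antipodel.
by rewrite (sw2_fun hs _ _ (linearP f)); apply: eq_sw2 => a b; rewrite /= rmorphM.
Qed.

Lemma conv_antipoder (f : {lrmorphism H -> A}) :
  conv f (f \o antipode hs) = conv_unit A.
Proof.
apply/funext => h; rewrite /conv /conv_unit -(rmorph1 f) -linearZ /= -antipoder.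
by rewrite (sw2_fun hs _ _ (linearP f)); apply: eq_sw2 => a b; rewrite /= rmorphM.
Qed.

End Algebra.

Implicit Types (s t r : H -> H -> K) (v w : H -> K).

Definition biform s : Prop :=
  (forall y, linear (s^~ y : H -> K^o)) /\ (forall x, linear (s x : H -> K^o)).

Definition conv2 s t : H -> H -> K := fun h h' =>
  sw h (fun a b => sw h' (fun a' b' => s a a' * t b b')).

Definition counit2 : H -> H -> K := fun h h' => eps h * eps h'.

Definition tens2 v w : H -> H -> K := fun h h' => v h * w h'.

Definition mul_form v : H -> H -> K := fun h h' => v (h * h').

Lemma counit_lin : linear (eps : H -> K^o). Proof. exact: linearP. Qed.

Lemma biform_conv2 s t : biform s -> biform t -> biform (conv2 s t).
Proof.
case=> s1 s2 [t1 t2]; split=> x; rewrite /conv2.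
  by apply: lin_sw2_arg => [|y|y]; lin; try apply: (s1 _); apply: (t1 _).
apply: lin_sw2 => a b; apply: lin_sw2_arg => [|y|y]; lin; first exact: s2.
exact: t2.
Qed.

Lemma biform_tens2 v w : linear (v : H -> K^o) -> linear (w : H -> K^o) ->
  biform (tens2 v w).
Proof. by move=> lv lw; split=> x; rewrite /tens2; lin. Qed.

Lemma biform_mul_form v : linear (v : H -> K^o) -> biform (mul_form v).
Proof.
by move=> lv; split=> x k y z; rewrite /mul_form ?mulrDl ?mulrDr -?scalerAl -?scalerAr lv.
Qed.

Lemma conv2A s t r : biform s -> biform t -> biform r ->
  conv2 (conv2 s t) r = conv2 s (conv2 t r).
Proof.
move=> [s1 s2] [t1 t2] [r1 r2]; apply/funext => h; apply/funext => h'.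
rewrite /conv2.
transitivity (sw h (fun a c => sw a (fun a b => sw h' (fun a' c' =>
    sw a' (fun a' b' => s a a' * t b b' * r c c'))))).
  apply: eq_sw2 => a c; rewrite sw2_exch; apply: eq_sw2 => a' c'.
  by rewrite sw2_kmulr; apply: eq_sw2 => x y; rewrite sw2_kmulr.
rewrite (@sw2_coassoc _ _ _ K^o); first last.
- by move=> a b; lin; exact: r1.
- by move=> a b; lin; exact: t1.
- by move=> a b; lin; exact: s1.
apply: eq_sw2 => a b.
transitivity (sw b (fun b c => sw h' (fun a' b' => sw b' (fun b' c' =>
    s a a' * t b b' * r c c')))).
  apply: eq_sw2 => x y; rewrite (@sw2_coassoc _ _ _ K^o) //.
  - by move=> *; lin; exact: s2.
  - by move=> *; lin; exact: t2.
  - by move=> *; lin; exact: r2.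
rewrite sw2_exch; apply: eq_sw2 => a' b'; rewrite sw2_kmull.
by apply: eq_sw2 => x y; rewrite sw2_kmull; apply: eq_sw2 => *; rewrite mulrA.
Qed.

Lemma conv2_1l s : biform s -> conv2 counit2 s = s.
Proof.
move=> [s1 s2]; apply/funext => h; apply/funext => h'.
rewrite -[RHS](sw2_counitl hs (f := s^~ h' : H -> K^o) h); last exact: s1.
apply: eq_sw2 => a b; rewrite /= -(sw2_counitl hs (f := s b : H -> K^o) h'); last exact: s2.
transitivity ((eps a : K) * sw h' (fun x y => (eps x : K) * s b y)); last by [].
rewrite sw2_kmull.
by apply: eq_sw2 => x y; rewrite mulrA.
Qed.

Lemma conv2_1r s : biform s -> conv2 s counit2 = s.
Proof.
move=> [s1 s2]; apply/funext => h; apply/funext => h'.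
rewrite -[RHS](sw2_counitr hs (f := s^~ h' : H -> K^o) h); last exact: s1.
apply: eq_sw2 => a b; rewrite /= -(sw2_counitr hs (f := s a : H -> K^o) h'); last exact: s2.
transitivity ((eps b : K) * sw h' (fun x y => (eps y : K) * s a x)); last by [].
rewrite sw2_kmull.
by apply: eq_sw2 => x y; rewrite mulrC mulrA.
Qed.

Lemma conv_tens2 v v' w w' :
  conv2 (tens2 v w) (tens2 v' w')
  = tens2 (conv (v : H -> K^o) v') (conv (w : H -> K^o) w').
Proof.
apply/funext => h; apply/funext => h'; rewrite /conv2 /tens2 /conv.
rewrite [RHS]sw2_kmulr; apply: eq_sw2 => a b; rewrite sw2_kmull.
by apply: eq_sw2 => a' b'; rewrite mulrACA.
Qed.

Lemma conv_mul_form v v' : linear (v : H -> K^o) -> linear (v' : H -> K^o) ->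
  conv2 (mul_form v) (mul_form v') = mul_form (conv (v : H -> K^o) v').
Proof.
move=> lv lv'; apply/funext => h; apply/funext => h'.
rewrite /conv2 /mul_form /conv sw2M //; try by lin.
Qed.

Lemma conv2_inverse s t : conv_inverse2 hs s t ->
  conv2 s t = counit2 /\ conv2 t s = counit2.
Proof.
by move=> st; split; apply/funext => h; apply/funext => h'; have [] := st h h'.
Qed.

Lemma conv_inverseE v w : conv_inverse1 hs v w ->
  conv (v : H -> K^o) w = eps /\ conv (w : H -> K^o) v = eps.
Proof. by move=> vw; split; apply/funext => h; have [] := vw h. Qed.

Lemma tens2_counit : tens2 eps eps = counit2. Proof. by []. Qed.

Lemma mul_form_counit : mul_form eps = counit2.
Proof. by apply/funext => h; apply/funext => h'; apply: counitM. Qed.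

(** Gauge equivalence becomes an equation in the convolution algebra of forms. There [mul_form] and
    [tens2] are multiplicative, so symmetry and transitivity reduce to cancelling and regrouping
    factors. *)
Lemma gauge_equivE s s' : biform s -> 
  gauge_equiv hs s s' <-> exists v w, [/\ linear (v : H -> K^o), linear (w : H -> K^o),
    conv_inverse1 hs v w & s' = conv2 (mul_form v) (conv2 s (tens2 w w))].
Proof.
move=> [s1 s2].
have E v w h h' : conv2 (mul_form v) (conv2 s (tens2 w w)) h h' =
   sw3 hs h (fun h1 h2 h3 => sw3 hs h' (fun h1' h2' h3' =>
            v (h1 * h1') * s h2 h2' * w h3 * w h3')).
  rewrite /sw3 /conv2; apply: eq_sw2 => a b; rewrite [RHS]sw2_exch.
  apply: eq_sw2 => a' b'; rewrite sw2_kmull; apply: eq_sw2 => *; rewrite sw2_kmull.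
  by apply: eq_sw2 => *; rewrite /mul_form /tens2 !mulrA.
split=> -[v [w [lv lw vw e]]]; exists v, w; split=> //.
  by apply/funext => h; apply/funext => h'; rewrite E.
by move=> h h'; rewrite e E.
Qed.

Lemma gauge_equiv_refl s : biform s -> gauge_equiv hs s s.
Proof.
move=> bs; apply/gauge_equivE => //; exists eps, eps; split; try exact: linearP.
  by move=> h; split; apply: (sw2_counitl hs (f := eps : H -> K^o) h); apply: linearP.
by rewrite mul_form_counit tens2_counit conv2_1r // conv2_1l.
Qed.

Lemma gauge_equiv_sym s s' : biform s -> gauge_equiv hs s s' ->
  gauge_equiv hs s' s.
Proof.
move=> bs /(gauge_equivE _ bs)[v [w [lv lw vw E]]].
have [vw1 wv1] := conv_inverseE vw.
have bm x : linear (x : H -> K^o) -> biform (mul_form x) by apply: biform_mul_form.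
have bw : biform (tens2 w w) by apply: biform_tens2.
have bv : biform (tens2 v v) by apply: biform_tens2.
have bsw : biform (conv2 s (tens2 w w)) by apply: biform_conv2.
have bs' : biform s' by rewrite E; apply: biform_conv2 => //; apply: bm.
apply/gauge_equivE => //; exists w, v; split=> //.
  by move=> h; have [? ?] := vw h; split.
have bswv : biform (conv2 (conv2 s (tens2 w w)) (tens2 v v)) by apply: biform_conv2.
rewrite E (conv2A (bm _ lv) bsw bv) -(conv2A (bm _ lw) (bm _ lv) bswv).
rewrite conv_mul_form // wv1 mul_form_counit.
by rewrite conv2_1l // conv2A // conv_tens2 wv1 tens2_counit conv2_1r.
Qed.

Lemma gauge_equiv_trans s s' s'' : biform s ->
  gauge_equiv hs s s' -> gauge_equiv hs s' s'' -> gauge_equiv hs s s''.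
Proof.
move=> bs /(gauge_equivE _ bs)[v [w [lv lw vw E]]].
have bm x : linear (x : H -> K^o) -> biform (mul_form x) by apply: biform_mul_form.
have bt x : linear (x : H -> K^o) -> biform (tens2 x x) by move=> lx; apply: biform_tens2.
have bsw : biform (conv2 s (tens2 w w)) by apply: biform_conv2 => //; apply: bt.
have bs' : biform s' by rewrite E; apply: biform_conv2 => //; apply: bm.
move=> /(gauge_equivE _ bs')[v' [w' [lv' lw' vw' E']]].
have lc x y : linear (x : H -> K^o) -> linear (y : H -> K^o) ->
    linear (conv (x : H -> K^o) y : H -> K^o).
  by move=> lx ly; rewrite /conv; lin.
have lcA x y z : linear (x : H -> K^o) -> linear (y : H -> K^o) ->
    linear (z : H -> K^o) ->
    conv (conv (x : H -> K^o) y) z = conv (x : H -> K^o) (conv (y : H -> K^o) z).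
  move=> lx ly lz.
  pose X := GRing.isLinear.Build K H K^o *:%R x lx.
  pose Y := GRing.isLinear.Build K H K^o *:%R y ly.
  pose Z := GRing.isLinear.Build K H K^o *:%R z lz.
  pose x' : {linear H -> K^o} := HB.pack x X.
  pose y' : {linear H -> K^o} := HB.pack y Y.
  pose z' : {linear H -> K^o} := HB.pack z Z.
  exact: (convA x' y' z').
have [vw1 wv1] := conv_inverseE vw.
have [vw2 wv2] := conv_inverseE vw'.
apply/gauge_equivE => //.
exists (conv (v' : H -> K^o) v), (conv (w : H -> K^o) w').
split; try exact: lc.
- move=> h; split.
    rewrite -[LHS]/(conv (conv (v' : H -> K^o) v) (conv (w : H -> K^o) w') h).
    rewrite lcA //; last exact: lc.
    rewrite -[conv (v : H -> K^o) _]lcA // vw1.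
    pose Z : {linear H -> K^o} := HB.pack w' (GRing.isLinear.Build K H K^o *:%R w' lw').
    have -> : conv (eps : H -> K^o) w' = w'.
      rewrite -[RHS](conv1f Z); apply/funext => x.
      by apply: eq_sw2 => a b; rewrite /conv_unit -scalerAl mul1r.
    by rewrite vw2.
  rewrite -[LHS]/(conv (conv (w : H -> K^o) w') (conv (v' : H -> K^o) v) h).
  rewrite lcA //; last exact: lc.
  rewrite -[conv (w' : H -> K^o) _]lcA // wv2.
  pose Z : {linear H -> K^o} := HB.pack v (GRing.isLinear.Build K H K^o *:%R v lv).
  have -> : conv (eps : H -> K^o) v = v.
    rewrite -[RHS](conv1f Z); apply/funext => x.
    by apply: eq_sw2 => a b; rewrite /conv_unit -scalerAl mul1r.
  by rewrite wv1.
have bss : biform (conv2 (conv2 s (tens2 w w)) (tens2 w' w')).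
  by apply: biform_conv2 => //; apply: bt.
rewrite E' E (conv2A (bm _ lv) bsw (bt _ lw')) -(conv2A (bm _ lv') (bm _ lv) bss).
rewrite conv_mul_form // (conv2A bs) ?conv_tens2 //; exact: bt.
Qed.

End Convolution.

(** * Twisted algebras *)

Section TensorAlgebra.
Variables (K : fieldType) (A B : algType K).
Implicit Types t u v : tensor A B.

Lemma tmul_bilin : bilinear_map (@tmul K A B).
Proof.
have bi (a : A) (b : B) : bilinear_map (fun a' b' => (a * a') (x) (b * b')).
  by apply: bilinP; lin.
have bl (u : tensor A B) : bilinear_map
    (fun a b => tlift (fun a' b' => (a * a') (x) (b * b')) u).
  by apply: bilinP => ?; rewrite /tlift; lin.
split=> w; first exact: tlift_linear.
rewrite /tmul {1}/tlift; apply: lin_sum => p; exact: tlift_linear.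
Qed.

Lemma tmul_pure (a a' : A) (b b' : B) :
  tmul (a (x) b) (a' (x) b') = (a * a') (x) (b * b').
Proof.
rewrite /tmul tliftE; last by apply: bilinP => ?; rewrite /tlift; lin.
by rewrite tliftE //; apply: bilinP; lin.
Qed.

Lemma tmulDl : left_distributive (@tmul K A B) +%R.
Proof. by move=> t u v; apply: (linD _ _ (tmul_bilin.1 v)). Qed.

Lemma tmulDr : right_distributive (@tmul K A B) +%R.
Proof. by move=> t u v; apply: (linD _ _ (tmul_bilin.2 t)). Qed.

Lemma tmulA : associative (@tmul K A B).
Proof.
have t0 t : tmul t 0 = 0 by apply: (lin0 (tmul_bilin.2 t)).
have l0 t : tmul 0 t = 0 by apply: (lin0 (tmul_bilin.1 t)).
elim/tensor_ind => [u v|a b t IHt]; first by rewrite !l0.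
move=> u v; rewrite !tmulDl IHt; congr (_ + _); move: u v {t IHt}.
elim/tensor_ind => [v|a' b' u IHu v]; first by rewrite !(t0, l0).
rewrite !(tmulDr, tmulDl) IHu; congr (_ + _); move: v {u IHu}.
elim/tensor_ind => [|a'' b'' v IHv]; first by rewrite !t0.
by rewrite !tmulDr IHv !tmul_pure !mulrA.
Qed.

Lemma tmul1 : left_id (1 (x) 1) (@tmul K A B).
Proof.
elim/tensor_ind => [|a b t IH]; first exact: (lin0 (tmul_bilin.2 _)).
by rewrite tmulDr IH tmul_pure !mul1r.
Qed.

Lemma t1mul : right_id (1 (x) 1) (@tmul K A B).
Proof.
elim/tensor_ind => [|a b t IH]; first exact: (lin0 (tmul_bilin.1 _)).
by rewrite tmulDl IH tmul_pure !mulr1.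
Qed.

End TensorAlgebra.

(* The counit of H is what makes 1 (x) 1 nonzero. *)
Definition htens (K : fieldType) (H : algType K) (hs : hopf_structure H)
  (B : algType K) := tensor H B.

Section HopfTensorAlgebra.
Variables (K : fieldType) (H : algType K) (hs : hopf_structure H).
Variable (B : algType K).
Local Notation T := (htens hs B).

HB.instance Definition _ := GRing.Lmodule.on T.

Lemma htens1_neq0 : (1 (x) 1 : T) != 0.
Proof.
have bb : bilinear_map (fun (x : H) (b : B) => (counit hs x : K) *: b).
  by apply: bilinP; lin; exact: linearP.
apply/eqP => /(congr1 (tlift (fun (x : H) (b : B) => (counit hs x : K) *: b))).
rewrite tliftE // (lin0 (tlift_linear bb)) counit1 scale1r => /eqP.
by rewrite oner_eq0.
Qed.

HB.instance Definition _ := GRing.Zmodule_isNzRing.Build T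
  (@tmulA K H B) (@tmul1 K H B) (@t1mul K H B) (@tmulDl K H B) (@tmulDr K H B)
  htens1_neq0.

Lemma htens_scaleAl (k : K) (t u : T) : k *: (t * u) = (k *: t) * u.
Proof. exact/esym/(linZ k t ((tmul_bilin _ _).1 u)). Qed.
HB.instance Definition _ := GRing.Lmodule_isLalgebra.Build K T htens_scaleAl.

Lemma htens_scaleAr (k : K) (t u : T) : k *: (t * u) = t * (k *: u).
Proof. exact/esym/(linZ k u ((tmul_bilin _ _).2 t)). Qed.
HB.instance Definition _ := GRing.Lalgebra_isAlgebra.Build K T htens_scaleAr.

Lemma htensM (a a' : H) (b b' : B) :
  (a (x) b : T) * (a' (x) b' : T) = (a * a') (x) (b * b').
Proof. exact: tmul_pure. Qed.

End HopfTensorAlgebra.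

Section TwistedAlgebra.
Variables (K : fieldType) (H : algType K) (hs : hopf_structure H).
Variable (s : H -> H -> K).
Hypothesis cs : cocycle_twist hs s.
Local Notation eps := (counit hs).
Local Notation sw := (sw2 hs).

Lemma cocycle_biform : biform s. Proof. by case: cs => -[]. Qed.
Let s1 := cocycle_biform.1.
Let s2 := cocycle_biform.2.

Definition twmul (g h : H) : H :=
  sw g (fun a b => sw h (fun c d => s b d *: (a * c))).

Lemma twmul_linl h : linear (twmul^~ h).
Proof. by rewrite /twmul; lin; exact: s1. Qed.

Lemma twmul_linr g : linear (twmul g).
Proof. by rewrite /twmul; lin; exact: s2. Qed.

(** Coassociativity brings both products to sums of [a * c * m] over the first legs, weighted by the
    two sides of the cocycle identity in the second legs. *)
Lemma twmulA : associative twmul.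
Proof.
move=> g h k.
transitivity (sw g (fun a b => sw h (fun c d => sw k (fun m n =>
   sw d (fun d1 d2 => sw n (fun n1 n2 => s b (d1 * n1) * s d2 n2)) *: (a * c * m))))).
  rewrite {2}/twmul (sw2_fun _ _ _ (twmul_linr g)).
  transitivity (sw h (fun c d => sw g (fun a b => sw k (fun m n => sw c (fun c1 c2 =>
     sw m (fun m1 m2 => (s b (c2 * m2) * s d n) *: (a * c1 * m1))))))).
    apply: eq_sw2 => c d; rewrite (sw2_fun _ _ _ (twmul_linr g)) sw2_exch.
    apply: eq_sw2 => m n; rewrite (linZ _ _ (twmul_linr g)) /twmul sw2_scaler.
    apply: eq_sw2 => a b; rewrite sw2M; first last.
    - by move=> x; lin; exact: s2.
    - by move=> x; lin.
    rewrite sw2_scaler; apply: eq_sw2 => c1 c2; rewrite sw2_scaler.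
    by apply: eq_sw2 => m1 m2; rewrite scalerA mulrC mulrA.
  rewrite sw2_exch; apply: eq_sw2 => a b.
  transitivity (sw h (fun c d => sw c (fun c1 c2 => sw k (fun m n => sw m (fun m1 m2 =>
     (s b (c2 * m2) * s d n) *: (a * c1 * m1)))))).
    by apply: eq_sw2 => c d; rewrite sw2_exch.
  rewrite sw2_coassoc; first last.
  - by move=> *; lin; exact: s1.
  - by move=> *; lin; apply: lin_comp; [exact: s2 | lin].
  - by move=> *; lin.
  apply: eq_sw2 => c d.
  transitivity (sw d (fun d1 d2 => sw k (fun m n => sw n (fun n1 n2 =>
     (s b (d1 * n1) * s d2 n2) *: (a * c * m))))).
    apply: eq_sw2 => d1 d2; rewrite sw2_coassoc //.
    - by move=> *; lin.
    - by move=> *; lin; apply: lin_comp; [exact: s2 | lin].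
    - by move=> *; lin; exact: s2.
  rewrite sw2_exch; apply: eq_sw2 => m n; rewrite sw2_scalel.
  by apply: eq_sw2 => d1 d2; rewrite sw2_scalel.
symmetry; transitivity (sw g (fun a b => sw h (fun c d => sw k (fun m n =>
   sw b (fun b1 b2 => sw d (fun d1 d2 => s (b1 * d1) n * s b2 d2)) *: (a * c * m))))).
  rewrite {2}/twmul (sw2_fun _ _ _ (twmul_linl k)).
  transitivity (sw g (fun a b => sw h (fun c d => sw a (fun a1 a2 => sw c (fun c1 c2 =>
     sw k (fun m n => (s (a2 * c2) n * s b d) *: (a1 * c1 * m))))))).
    apply: eq_sw2 => a b; rewrite (sw2_fun _ _ _ (twmul_linl k)).
    apply: eq_sw2 => c d; rewrite (linZ _ _ (twmul_linl k)) /twmul.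
    rewrite sw2M; first last.
    - by move=> x; lin; exact: s1.
    - by move=> x; lin.
    rewrite sw2_scaler; apply: eq_sw2 => a1 a2; rewrite sw2_scaler.
    apply: eq_sw2 => c1 c2; rewrite sw2_scaler.
    by apply: eq_sw2 => m n; rewrite scalerA mulrC.
  transitivity (sw g (fun a b => sw a (fun a1 a2 => sw h (fun c d => sw c (fun c1 c2 =>
     sw k (fun m n => (s (a2 * c2) n * s b d) *: (a1 * c1 * m))))))).
    by apply: eq_sw2 => a b; rewrite sw2_exch.
  rewrite sw2_coassoc; first last.
  - by move=> *; lin; exact: s1.
  - by move=> *; lin; apply: (lin_comp (g := s^~ _ : H -> K^o)); [exact: s1 | lin].
  - by move=> *; lin.
  apply: eq_sw2 => a b.
  transitivity (sw b (fun b1 b2 => sw h (fun c d => sw d (fun d1 d2 => sw k (fun m n =>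
     (s (b1 * d1) n * s b2 d2) *: (a * c * m)))))).
    apply: eq_sw2 => b1 b2; rewrite sw2_coassoc //.
    - by move=> *; lin.
    - by move=> *; lin; apply: (lin_comp (g := s^~ _ : H -> K^o)); [exact: s1 | lin].
    - by move=> *; lin; exact: s2.
  rewrite sw2_exch; apply: eq_sw2 => c d.
  transitivity (sw k (fun m n => sw b (fun b1 b2 => sw d (fun d1 d2 =>
     (s (b1 * d1) n * s b2 d2) *: (a * c * m))))).
    by rewrite [RHS]sw2_exch; apply: eq_sw2 => b1 b2; rewrite sw2_exch.
  apply: eq_sw2 => m n; rewrite sw2_scalel.
  by apply: eq_sw2 => d1 d2; rewrite sw2_scalel.
do 3!apply: eq_sw2 => ? ?; congr (_ *: _).
by case: cs => _ _ -> _.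
Qed.

Lemma twmul1 : left_id 1 twmul.
Proof.
move=> h; rewrite /twmul (sw2_pure (comul1 hs)); first last.
- by move=> *; lin; exact: s1.
- by move=> *; lin.
transitivity (sw h (fun c d => eps d *: c)); last exact: (sw2_counitr hs (f := id) h (@lin_id _ _)).
by apply: eq_sw2 => c d; rewrite mul1r; case: cs => _ _ _ /(_ d) [-> _].
Qed.

Lemma tw1mul : right_id 1 twmul.
Proof.
move=> h; rewrite /twmul.
transitivity (sw h (fun c d => eps d *: c)); last exact: (sw2_counitr hs (f := id) h (@lin_id _ _)).
apply: eq_sw2 => c d; rewrite (sw2_pure (comul1 hs)); first last.
- by move=> *; lin; exact: s2.
- by move=> *; lin.
by rewrite mulr1; case: cs => _ _ _ /(_ d) [_ ->].
Qed.

End TwistedAlgebra.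

Definition twalg (K : fieldType) (H : algType K) (hs : hopf_structure H)
  (s : H -> H -> K) (cs : cocycle_twist hs s) : Type := H.

Section TwistedAlgebraInstance.
Variables (K : fieldType) (H : algType K) (hs : hopf_structure H).
Variable (s : H -> H -> K).
Hypothesis cs : cocycle_twist hs s.
Local Notation T := (twalg cs).

HB.instance Definition _ := GRing.Lmodule.on T.

Lemma twmulDl : left_distributive (twmul hs s) +%R.
Proof. by move=> x y z; apply: (linD _ _ (twmul_linl cs z)). Qed.

Lemma twmulDr : right_distributive (twmul hs s) +%R.
Proof. by move=> x y z; apply: (linD _ _ (twmul_linr cs x)). Qed.

HB.instance Definition _ := GRing.Zmodule_isNzRing.Build T
  (twmulA cs) (twmul1 cs) (tw1mul cs) twmulDl twmulDr (oner_neq0 H).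

Lemma tw_scaleAl (k : K) (x y : T) : k *: (x * y) = (k *: x : T) * y.
Proof. have /= E := linZ k (x : H) (twmul_linl cs y). apply: esym E. Qed.
HB.instance Definition _ := GRing.Lmodule_isLalgebra.Build K T tw_scaleAl.

Lemma tw_scaleAr (k : K) (x y : T) : k *: (x * y) = x * (k *: y : T).
Proof. have /= E := linZ k (y : H) (twmul_linr cs x). apply: esym E. Qed.
HB.instance Definition _ := GRing.Lalgebra_isAlgebra.Build K T tw_scaleAr.

(** The counit, which need not be multiplicative on the twist, is what recovers [s] from the twisted
    product. *)
Lemma counit_twmul (x y : T) : counit hs (x * y : T) = s x y.
Proof.
have [s1 s2] := cocycle_biform cs.
rewrite [x * y]/(twmul hs s x y) /twmul (sw2_fun _ _ _ (counit_lin hs)).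
rewrite -[RHS](sw2_counitl hs (f := s^~ y : H -> K^o) x); last exact: s1.
apply: eq_sw2 => a b; rewrite (sw2_fun _ _ _ (counit_lin hs)).
rewrite -[s b y](sw2_counitl hs (f := s b : H -> K^o) y); last exact: s2.
transitivity ((counit hs a : K) * sw2 hs y (fun c d => (counit hs c : K) * s b d));
  last by [].
rewrite sw2_kmull; apply: eq_sw2 => c d; rewrite linearZ /= counitM.
by rewrite [RHS]mulrA; apply: mulrC.
Qed.

(* The coproduct of H, as the left coaction of H on its twist. *)
Definition tw_coact (x : T) : htens hs T := comul hs x.

Lemma tw_coact_linear : linear tw_coact.
Proof. exact: linearP. Qed.
HB.instance Definition _ :=
  GRing.isLinear.Build K T (htens hs T) *:%R tw_coact tw_coact_linear.

(** The values of [s] sit in the last Sweedler legs, so splitting off the first legs leaves the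
    plain product of [H] there and the twisted product in the second factor. *)
Lemma tw_coact_monoid : monoid_morphism tw_coact.
Proof.
split=> [|x y]; first exact: comul1.
have [s1 s2] := cocycle_biform cs.
transitivity (sw2 hs x (fun a b => sw2 hs y (fun c d => sw2 hs b (fun b1 b2 => sw2 hs d
  (fun d1 d2 => s b2 d2 *: ((a * c) (x) (b1 * d1) : tensor H H)))))).
  rewrite /tw_coact [x * y]/(twmul hs s x y) /twmul (sw2_fun _ _ _ (linearP (comul hs))).
  transitivity (sw2 hs x (fun a b => sw2 hs a (fun a1 a2 => sw2 hs y (fun c d => sw2 hs c
  (fun c1 c2 => s b d *: ((a1 * c1) (x) (a2 * c2) : tensor H H)))))).
    apply: eq_sw2 => a b; rewrite (sw2_fun _ _ _ (linearP (comul hs))) sw2_exch.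
    apply: eq_sw2 => c d; rewrite linearZ /= comulM sw2_scaler.
    by apply: eq_sw2 => a1 a2; rewrite sw2_scaler.
  rewrite sw2_coassoc; first last.
  - by move=> *; lin; exact: s1.
  - by move=> *; lin.
  - by move=> *; lin.
  apply: eq_sw2 => a b.
  rewrite [RHS]sw2_exch; apply: eq_sw2 => b1 b2; rewrite sw2_coassoc //.
  - by move=> *; lin.
  - by move=> *; lin.
  - by move=> *; lin; exact: s2.
rewrite /tw_coact -!(sw2_comul hs) sw2_mulr; apply: eq_sw2 => a b.
rewrite sw2_mull; apply: eq_sw2 => c d; rewrite htensM.
rewrite [(b : T) * d]/(twmul hs s b d) /twmul.
rewrite (sw2_fun _ _ _ ((pure_bilin _ _).2 _)); apply: eq_sw2 => b1 b2.
rewrite (sw2_fun _ _ _ ((pure_bilin _ _).2 _)); apply: eq_sw2 => d1 d2.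
by rewrite (linZ _ _ ((pure_bilin _ _).2 _)).
Qed.
HB.instance Definition _ :=
  GRing.isMonoidMorphism.Build T (htens hs T) tw_coact tw_coact_monoid.

End TwistedAlgebraInstance.
Arguments tw_coact {K H hs s} cs x.

(** [A] tensored with the group algebra twisted by [B], stored as a family of coefficients in [A].
    The proof [hB] is an argument of the type because the ring structure depends on it. *)
Definition tga (K : fieldType) (gT : finGroupType) (A : algType K)
  (B : gT -> gT -> K) (hB : bicharacter B) : Type := {ffun gT -> A}.

Section TwistedGroupAlgebra.
Variables (K : fieldType) (gT : finGroupType) (A : algType K).
Variables (B : gT -> gT -> K) (hB : bicharacter B).
Local Notation E := (tga A hB).

Lemma bichar1l a : B 1%g a = 1.
Proof.
have [n0 Bl _] := hB; apply: (mulfI (n0 1%g a)).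
by rewrite -Bl mulg1 mulr1.
Qed.

Lemma bichar1r a : B a 1%g = 1.
Proof.
have [n0 _ Br] := hB; apply: (mulfI (n0 a 1%g)).
by rewrite -Br mulg1 mulr1.
Qed.

Lemma bicharVr a b : B a b^-1%g = (B a b)^-1.
Proof.
have [n0 _ Br] := hB; apply: (mulIf (n0 a b)).
by rewrite -Br mulVg bichar1r mulVf.
Qed.

HB.instance Definition _ := GRing.Lmodule.on E.

Definition em (a : gT) (x : A) : E := [ffun c => if c == a then x else 0].

Lemma em_linear a : linear (em a).
Proof.
move=> k x y; apply/ffunP => c; rewrite !ffunE; case: eqP => // _.
by rewrite scaler0 addr0.
Qed.

Definition tgmul (e f : E) : E :=
  [ffun c => \sum_a B a (a^-1 * c)%g *: (e a * f (a^-1 * c)%g)].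

Lemma tgmulA : associative tgmul.
Proof.
have [n0 Bl Br] := hB.
move=> f g h; apply/ffunP => c; rewrite !ffunE.
under eq_bigr => a _ do rewrite ffunE mulr_sumr scaler_sumr.
under [RHS]eq_bigr => b _ do rewrite ffunE mulr_suml scaler_sumr.
rewrite [RHS]exchange_big /=; apply: eq_bigr => a _.
rewrite [RHS](reindex_inj (mulgI a)) /=; apply: eq_bigr => b _.
rewrite mulKg invMg mulgA -scalerAr -scalerAl !scalerA mulrA; congr (_ *: _).
rewrite -!mulgA Bl -[in B a (a^-1 * c)%g](mulKVg b (a^-1 * c)%g) Br.
by rewrite -mulrA mulrC.
Qed.

Lemma tgmulDl : left_distributive tgmul +%R.
Proof.
move=> f g h; apply/ffunP => c; rewrite !ffunE -big_split /=.
by apply: eq_bigr => a _; rewrite ffunE mulrDl scalerDr.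
Qed.

Lemma tgmulDr : right_distributive tgmul +%R.
Proof.
move=> f g h; apply/ffunP => c; rewrite !ffunE -big_split /=.
by apply: eq_bigr => a _; rewrite ffunE mulrDr scalerDr.
Qed.

Lemma tgmulZl (k : K) (f g : E) : k *: tgmul f g = tgmul (k *: f) g.
Proof.
apply/ffunP => c; rewrite !ffunE scaler_sumr; apply: eq_bigr => a _.
by rewrite ffunE -scalerAl scalerA mulrC -scalerA.
Qed.

Lemma tgmulZr (k : K) (f g : E) : k *: tgmul f g = tgmul f (k *: g).
Proof.
apply/ffunP => c; rewrite !ffunE scaler_sumr; apply: eq_bigr => a _.
by rewrite ffunE -scalerAr scalerA mulrC -scalerA.
Qed.

Lemma tgmul1 : left_id (em 1%g 1) tgmul.
Proof.
move=> f; apply/ffunP => c; rewrite ffunE (bigD1 1%g) //= big1 => [|a a1].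
  by rewrite ffunE eqxx mul1r invg1 mul1g addr0 bichar1l scale1r.
by rewrite ffunE (negPf a1) mul0r scaler0.
Qed.

Lemma tg1mul : right_id (em 1%g 1) tgmul.
Proof.
move=> f; apply/ffunP => c; rewrite ffunE (bigD1 c) //= big1 => [|a ac].
  by rewrite ffunE mulVg eqxx mulr1 addr0 bichar1r scale1r.
by rewrite ffunE -eq_mulVg1 (negPf ac) mulr0 scaler0.
Qed.

Lemma em1_neq0 : em 1%g 1 != 0.
Proof.
by apply/eqP => /ffunP/(_ 1%g); rewrite !ffunE eqxx => /eqP; rewrite oner_eq0.
Qed.

HB.instance Definition _ :=
  GRing.Zmodule_isNzRing.Build E tgmulA tgmul1 tg1mul tgmulDl tgmulDr em1_neq0.

Lemma tg_scaleAl (k : K) (f g : E) : k *: (f * g) = (k *: f : E) * g.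
Proof. exact: tgmulZl. Qed.
HB.instance Definition _ := GRing.Lmodule_isLalgebra.Build K E tg_scaleAl.

Lemma tg_scaleAr (k : K) (f g : E) : k *: (f * g) = f * (k *: g : E).
Proof. exact: tgmulZr. Qed.
HB.instance Definition _ := GRing.Lalgebra_isAlgebra.Build K E tg_scaleAr.

Lemma tgME (e f : E) c :
  (e * f) c = \sum_a B a (a^-1 * c)%g *: (e a * f (a^-1 * c)%g).
Proof. by rewrite [e * f]/(tgmul e f) ffunE. Qed.

Lemma tgaE (e : E) : e = \sum_a em a (e a).
Proof.
apply/ffunP => c; rewrite sum_ffunE (bigD1 c) //= big1 => [|a /negPf ac].
  by rewrite ffunE eqxx addr0.
by rewrite ffunE eq_sym ac.
Qed.

Lemma emM a b x y : em a x * em b y = em (a * b)%g (B a b *: (x * y)).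
Proof.
apply/ffunP => c; rewrite tgME ffunE (bigD1 a) //= big1 => [|d /negPf da].
  rewrite !ffunE eqxx addr0 (canF_eq (mulKVg a)) .
  by case: eqP => [->|_]; rewrite ?mulKg // mulr0 scaler0.
by rewrite ffunE da mul0r scaler0.
Qed.

Lemma emZ k a x : em a (k *: x) = k *: em a x.
Proof. exact: (linZ _ _ (em_linear a)). Qed.

End TwistedGroupAlgebra.

Section TwistedGroupAlgebraMorphisms.
Variables (K : fieldType) (gT : finGroupType).
Variables (B : gT -> gT -> K) (hB : bicharacter B).

Section Map.
Variables (A A' : algType K).

Definition tga_map (phi : A -> A') (e : tga A hB) : tga A' hB :=
  [ffun c => phi (e c)].

Variable phi : {lrmorphism A -> A'}.

Lemma tga_map_linear : linear (tga_map phi).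
Proof. by move=> k x y; apply/ffunP => c; rewrite !ffunE linearP. Qed.
HB.instance Definition _ := GRing.isLinear.Build K _ _ *:%R (tga_map phi) tga_map_linear.

Lemma tga_map_monoid : monoid_morphism (tga_map phi).
Proof.
split=> [|x y]; apply/ffunP => c.
  by rewrite !ffunE; case: eqP => _; rewrite ?rmorph1 ?rmorph0.
rewrite ffunE !tgME (lin_big _ _ _ (linearP phi)); apply: eq_bigr => a _.
by rewrite linearZ rmorphM !ffunE.
Qed.
HB.instance Definition _ := GRing.isMonoidMorphism.Build _ _ (tga_map phi) tga_map_monoid.

Lemma tga_map_em a x : tga_map phi (em hB a x) = em hB a (phi x).
Proof. by apply/ffunP => c; rewrite !ffunE; case: eqP => _; rewrite ?rmorph0. Qed.

End Map.

Lemma bichar_triv : bicharacter (fun _ _ : gT => 1 : K).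
Proof. by split=> *; rewrite ?oner_neq0 ?mulr1. Qed.

Section Unit.
Variable A : algType K.

Definition em1 (x : A) : tga A hB := em hB 1%g x.

Lemma em1_linear : linear em1. Proof. exact: em_linear. Qed.
HB.instance Definition _ := GRing.isLinear.Build K _ _ *:%R em1 em1_linear.

Lemma em1_monoid : monoid_morphism em1.
Proof.
by split=> // x y; rewrite /em1 emM (bichar1l hB) scale1r mulg1.
Qed.
HB.instance Definition _ := GRing.isMonoidMorphism.Build _ _ em1 em1_monoid.

(** The grading, as a coaction of the plain group algebra (the twist by the trivial bicharacter). In
    this form it is an algebra map, hence determined by its composite with generators. *)
Definition tga_coact (e : tga A hB) : tga (tga A hB) bichar_triv :=
  [ffun c => em hB c (e c)].

Lemma tga_coact_linear : linear tga_coact.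
Proof. by move=> k x y; apply/ffunP => c; rewrite !ffunE em_linear. Qed.
HB.instance Definition _ :=
  GRing.isLinear.Build K _ _ *:%R tga_coact tga_coact_linear.

Lemma tga_coact_monoid : monoid_morphism tga_coact.
Proof.
split=> [|x y]; apply/ffunP => c.
  rewrite !ffunE; case: eqP => [->//|_]; exact: (lin0 (em_linear hB c)).
rewrite ffunE !tgME (lin_big _ _ _ (em_linear hB c)); apply: eq_bigr => a _.
by rewrite !ffunE emM mulKVg scale1r.
Qed.
HB.instance Definition _ :=
  GRing.isMonoidMorphism.Build _ _ tga_coact tga_coact_monoid.

End Unit.
End TwistedGroupAlgebraMorphisms.

Section HopfMorphisms.
Variables (K : fieldType) (gT : finGroupType).
Variables (B : gT -> gT -> K) (hB : bicharacter B).
Variables (H : algType K) (hs : hopf_structure H).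
Local Notation sw := (sw2 hs).

Section LeftMix.
Variables (A : algType K) (f : {lrmorphism H -> tga A hB}).

(** Colinearity of [f] is the equality of the coaction after [f] with [lmix], compatibility with
    degrees the analogous one with [rmix]. Both mixes are algebra maps, so these equalities can be
    tested on generators. *)
Definition lmix (h : H) : tga (htens hs A) hB :=
  [ffun c => sw h (fun a b => a (x) f b c)].

Lemma lin_ffun (U : lmodType K) (g : U -> tga A hB) c :
  linear g -> linear (fun x => g x c).
Proof. by move=> lg k x y; rewrite lg !ffunE. Qed.

Lemma lmix_linear : linear lmix.
Proof.
have lf c : linear (fun x => f x c) by apply: lin_ffun; exact: linearP.
have lc c : linear (fun h => sw h (fun a b => a (x) f b c)) by lin.
by move=> k x y; apply/ffunP => c; rewrite !ffunE lc.
Qed.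
HB.instance Definition _ := GRing.isLinear.Build K _ _ *:%R lmix lmix_linear.

Lemma lmix_monoid : monoid_morphism lmix.
Proof.
have lf c : linear (fun x => f x c) by apply: lin_ffun; exact: linearP.
split=> [|x y]; apply/ffunP => c; rewrite ffunE.
  rewrite (sw2_pure (comul1 hs)); try by lin.
  by rewrite rmorph1 !ffunE; case: eqP => // _; apply: (lin0 ((pure_bilin _ _).2 _)).
rewrite sw2M; try by lin.
rewrite tgME.
transitivity (sw x (fun a b => sw y (fun a' b' => \sum_d B d (d^-1 * c)%g *:
   ((a (x) f b d : htens hs A) * (a' (x) f b' (d^-1 * c)%g))))).
  do 2!apply: eq_sw2 => ? ?; rewrite rmorphM tgME.
  rewrite (lin_big _ _ _ ((pure_bilin _ _).2 _)); apply: eq_bigr => d _.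
  by rewrite (linZ _ _ ((pure_bilin _ _).2 _)) htensM.
under eq_sw2 => a b do rewrite sw2_exch_sum.
rewrite sw2_exch_sum; apply: eq_bigr => d _; rewrite !ffunE.
rewrite sw2_mulr sw2_scaler; apply: eq_sw2 => a b.
by rewrite sw2_mull sw2_scaler.
Qed.
HB.instance Definition _ := GRing.isMonoidMorphism.Build _ _ lmix lmix_monoid.

End LeftMix.

Section RightMix.
Variables (A : algType K) (f : {lrmorphism H -> A}).
Variable (p : {lrmorphism H -> grpalg K gT}).

Definition rmix (h : H) : tga A (bichar_triv K gT) :=
  [ffun c => sw h (fun a b => p b c *: f a)].

Lemma proj_coef_lin c : linear (fun x => p x c : K^o).
Proof. by move=> k x y; rewrite linearP !ffunE. Qed.

Lemma rmix_linear : linear rmix.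
Proof.
have lp c : linear (fun x => p x c : K^o) by apply: proj_coef_lin.
have lc c : linear (fun h => sw h (fun a b => p b c *: f a)) by lin.
by move=> k x y; apply/ffunP => c; rewrite !ffunE lc.
Qed.
HB.instance Definition _ := GRing.isLinear.Build K _ _ *:%R rmix rmix_linear.

Lemma rmix_monoid : monoid_morphism rmix.
Proof.
have lp c : linear (fun x => p x c : K^o) by apply: proj_coef_lin.
split=> [|x y]; apply/ffunP => c; rewrite ffunE.
  rewrite (sw2_pure (comul1 hs)); try by lin.
  by rewrite !rmorph1 !ffunE; case: eqP => // _; rewrite ?scale1r ?scale0r.
rewrite sw2M; try by lin.
rewrite tgME.
transitivity (sw x (fun a b => sw y (fun a' b' => \sum_d
   ((p b d *: f a) * (p b' (d^-1 * c)%g *: f a'))))).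
  do 2!apply: eq_sw2 => ? ?; rewrite !rmorphM ffunE scaler_suml.
  by apply: eq_bigr => d _; rewrite -scalerAl -scalerAr scalerA.
under eq_sw2 => a b do rewrite sw2_exch_sum.
rewrite sw2_exch_sum; apply: eq_bigr => d _; rewrite !ffunE scale1r.
rewrite sw2_mulr; apply: eq_sw2 => a b.
by rewrite sw2_mull.
Qed.
HB.instance Definition _ := GRing.isMonoidMorphism.Build _ _ rmix rmix_monoid.

End RightMix.
End HopfMorphisms.
Arguments em1 {K gT B} hB {A} x.

(** * Forms restricted along a projection to a group algebra *)

Section HopfProjection.
Variables (K : fieldType) (gT : finGroupType).
Variables (H : algType K) (hs : hopf_structure H).
Variable p : {lrmorphism H -> grpalg K gT}.
Local Notation sw := (sw2 hs).
Local Notation eps := (counit hs).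

(** Group elements being group-like, compatibility of [p] with coproduct and counit says that its
    coefficient functionals are orthogonal idempotents for convolution, with sum the counit. *)
Definition coalgebra_map : Prop :=
  (forall h a b, sw h (fun x y => p x a * p y b) = p h a *+ (a == b)) /\
  (forall h, \sum_a p h a = eps h).

Hypothesis pco : coalgebra_map.
Local Notation rf := (restrict_form p).
Implicit Types B : gT -> gT -> K.

Lemma rfE B h h' : rf B h h' = \sum_a \sum_b p h a * p h' b * B a b.
Proof. by []. Qed.

Lemma rf_biform B : biform (rf B).
Proof.
split=> x; rewrite /restrict_form /bilin_ext; lin; exact: proj_coef_lin.
Qed.

Lemma rf_conv B B' :
  conv2 hs (rf B) (rf B') = rf (fun a b => B a b * B' a b).
Proof.
apply/funext => h; apply/funext => h'; rewrite /conv2 rfE.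
transitivity (sw h (fun x y => sw h' (fun x' y' => \sum_a \sum_b \sum_c \sum_d
   (p x a * p y c) * (p x' b * p y' d) * (B a b * B' c d)))).
  do 2!apply: eq_sw2 => ? ?; rewrite !rfE mulr_suml; apply: eq_bigr => a _.
  rewrite mulr_suml; apply: eq_bigr => b _; rewrite mulr_sumr.
  apply: eq_bigr => c _; rewrite mulr_sumr; apply: eq_bigr => d _.
  by rewrite mulrACA; congr (_ * _); apply: mulrACA.
under eq_sw2 => x y do rewrite sw2_exch_sum.
rewrite sw2_exch_sum; apply: eq_bigr => a _.
under eq_sw2 => x y do rewrite sw2_exch_sum.
rewrite sw2_exch_sum; apply: eq_bigr => b _.
under eq_sw2 => x y do rewrite sw2_exch_sum.
rewrite sw2_exch_sum.
transitivity (\sum_c \sum_d (p h a *+ (a == c)) * (p h' b *+ (b == d)) * (B a b * B' c d)).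
  apply: eq_bigr => c _.
  under eq_sw2 => x y do rewrite sw2_exch_sum.
  rewrite sw2_exch_sum; apply: eq_bigr => d _.
  rewrite -!pco.1 !sw2_kmulr; apply: eq_sw2 => x y.
  rewrite sw2_kmull sw2_kmulr //.
rewrite (bigD1 a) //= [X in _ + X]big1 => [|c /negPf ca]; last first.
  by apply: big1 => d _; rewrite eq_sym ca mulr0n !mul0r.
rewrite (bigD1 b) //= [X in _ + X + _]big1 => [|d /negPf db]; last first.
  by rewrite [b == d]eq_sym db mulr0n mulr0 mul0r.
by rewrite !eqxx !addr0.
Qed.

Lemma rf1 : rf (fun _ _ => 1) = counit2 hs.
Proof.
apply/funext => h; apply/funext => h'; rewrite rfE /counit2 -!pco.2.
by rewrite big_distrlr /=; do 2!apply: eq_bigr => ? _; rewrite mulr1.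
Qed.

Lemma p_mulE x y c : p (x * y) c = \sum_a p x a * p y (a^-1 * c)%g.
Proof. by rewrite rmorphM ffunE. Qed.

Lemma rf_mull B x y z :
  rf B (x * y) z = \sum_a \sum_b \sum_c p x a * p y b * p z c * B (a * b)%g c.
Proof.
rewrite rfE.
transitivity (\sum_d \sum_a \sum_c p x a * p y (a^-1 * d)%g * p z c * B d c).
  apply: eq_bigr => d _; rewrite [RHS]exchange_big; apply: eq_bigr => c _ /=.
  by rewrite p_mulE !mulr_suml.
rewrite exchange_big; apply: eq_bigr => a _ /=.
rewrite (reindex_inj (mulgI a)) /=; apply: eq_bigr => b _.
by rewrite mulKg.
Qed.

Lemma rf_mulr B x y z :
  rf B x (y * z) = \sum_a \sum_b \sum_c p x a * p y b * p z c * B a (b * c)%g.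
Proof.
rewrite rfE; apply: eq_bigr => a _.
transitivity (\sum_d \sum_b p x a * p y b * p z (b^-1 * d)%g * B a d).
  apply: eq_bigr => d _.
  by rewrite p_mulE mulr_sumr mulr_suml; apply: eq_bigr => b _; rewrite !mulrA.
rewrite exchange_big; apply: eq_bigr => b _ /=.
rewrite (reindex_inj (mulgI b)) /=; apply: eq_bigr => c _.
by rewrite mulKg.
Qed.

(** On group elements both sides of the cocycle identity are [B a b * B a c * B b c]; orthogonality
    of the coefficients of [p] collapses the five-fold sums to this case. *)
Lemma rf_cocycle B : bicharacter B -> cocycle_twist hs (rf B).
Proof.
move=> hB; have [n0 Bl Br] := hB; split.
- by have [r1 r2] := rf_biform B; split.
- exists (rf (fun a b => (B a b)^-1)); first by have [r1 r2] := rf_biform (fun a b => (B a b)^-1); split.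
  move=> h h'; rewrite -[counit hs h * _]/(counit2 hs h h') -rf1.
  rewrite -[sw _ _]/(conv2 hs (rf B) (rf (fun a b => (B a b)^-1)) h h').
  rewrite -[X in _ /\ X = _]/(conv2 hs (rf (fun a b => (B a b)^-1)) (rf B) h h').
  rewrite !rf_conv; split; congr (rf _ h h'); apply/funext => a; apply/funext => b.
    by rewrite mulfV.
  by rewrite mulVf.
- move=> x y z.
  transitivity (\sum_a \sum_b \sum_c p x a * p y b * p z c * (B (a * b)%g c * B a b)).
    transitivity (sw x (fun x1 x2 => sw y (fun y1 y2 => \sum_a \sum_b \sum_c
       \sum_d \sum_e (p x1 a * p x2 d) * (p y1 b * p y2 e) * (p z c * (B (a * b)%g c * B d e))))).
      do 2!apply: eq_sw2 => ? ?; rewrite rf_mull rfE mulr_suml; apply: eq_bigr => a _.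
      rewrite mulr_suml; apply: eq_bigr => b _; rewrite mulr_suml.
      apply: eq_bigr => c _; rewrite mulr_sumr; apply: eq_bigr => d _.
      by rewrite mulr_sumr; apply: eq_bigr => e _; ring.
    under eq_sw2 => ? ? do rewrite sw2_exch_sum.
    rewrite sw2_exch_sum; apply: eq_bigr => a _.
    under eq_sw2 => ? ? do rewrite sw2_exch_sum.
    rewrite sw2_exch_sum; apply: eq_bigr => b _.
    under eq_sw2 => ? ? do rewrite sw2_exch_sum.
    rewrite sw2_exch_sum; apply: eq_bigr => c _.
    under eq_sw2 => ? ? do rewrite sw2_exch_sum.
    rewrite sw2_exch_sum.
    transitivity (\sum_d \sum_e (p x a *+ (a == d)) * (p y b *+ (b == e)) * (p z c * (B (a * b)%g c * B d e))).
      apply: eq_bigr => d _.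
      under eq_sw2 => ? ? do rewrite sw2_exch_sum.
      rewrite sw2_exch_sum; apply: eq_bigr => e _.
      by rewrite -!pco.1 !sw2_kmulr; apply: eq_sw2 => ? ?; rewrite sw2_kmull sw2_kmulr.
    rewrite (bigD1 a) //= [X in _ + X]big1 => [|d /negPf da]; last first.
      by apply: big1 => e _; rewrite [a == d]eq_sym da mulr0n !mul0r.
    rewrite (bigD1 b) //= [X in _ + X + _]big1 => [|e /negPf eb]; last first.
      by rewrite [b == e]eq_sym eb mulr0n mulr0 mul0r.
    by rewrite !eqxx !addr0 mulrA.
  symmetry.
  transitivity (\sum_a \sum_b \sum_c p x a * p y b * p z c * (B a (b * c)%g * B b c)).
    transitivity (sw y (fun y1 y2 => sw z (fun z1 z2 => \sum_a \sum_b \sum_c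
       \sum_d \sum_e (p y1 b * p y2 d) * (p z1 c * p z2 e) * (p x a * (B a (b * c)%g * B d e))))).
      do 2!apply: eq_sw2 => ? ?; rewrite rf_mulr rfE mulr_suml; apply: eq_bigr => a _.
      rewrite mulr_suml; apply: eq_bigr => b _; rewrite mulr_suml.
      apply: eq_bigr => c _; rewrite mulr_sumr; apply: eq_bigr => d _.
      by rewrite mulr_sumr; apply: eq_bigr => e _; ring.
    under eq_sw2 => ? ? do rewrite sw2_exch_sum.
    rewrite sw2_exch_sum; apply: eq_bigr => a _.
    under eq_sw2 => ? ? do rewrite sw2_exch_sum.
    rewrite sw2_exch_sum; apply: eq_bigr => b _.
    under eq_sw2 => ? ? do rewrite sw2_exch_sum.
    rewrite sw2_exch_sum; apply: eq_bigr => c _.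
    under eq_sw2 => ? ? do rewrite sw2_exch_sum.
    rewrite sw2_exch_sum.
    transitivity (\sum_d \sum_e (p y b *+ (b == d)) * (p z c *+ (c == e)) * (p x a * (B a (b * c)%g * B d e))).
      apply: eq_bigr => d _.
      under eq_sw2 => ? ? do rewrite sw2_exch_sum.
      rewrite sw2_exch_sum; apply: eq_bigr => e _.
      by rewrite -!pco.1 !sw2_kmulr; apply: eq_sw2 => ? ?; rewrite sw2_kmull sw2_kmulr.
    rewrite (bigD1 b) //= [X in _ + X]big1 => [|d /negPf db]; last first.
      by apply: big1 => e _; rewrite [b == d]eq_sym db mulr0n !mul0r.
    rewrite (bigD1 c) //= [X in _ + X + _]big1 => [|e /negPf ec]; last first.
      by rewrite [c == e]eq_sym ec mulr0n mulr0 mul0r.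
    by rewrite !eqxx !addr0 !mulr1n; ring.
  do 3!apply: eq_bigr => ? _; congr (_ * _); rewrite Br Bl; ring.
- move=> h; rewrite !rfE rmorph1 -pco.2; split.
    rewrite (bigD1 1%g) //= [X in _ + X]big1 => [|a /negPf a1]; last first.
      by apply: big1 => b _; rewrite ffunE a1 !mul0r.
    by rewrite addr0; apply: eq_bigr => b _; rewrite ffunE eqxx mul1r (bichar1l hB) mulr1.
  apply: eq_bigr => a _.
  rewrite (bigD1 1%g) //= [X in _ + X]big1 => [|b /negPf b1]; last first.
    by rewrite ffunE b1 mulr0 mul0r.
  by rewrite addr0 ffunE eqxx (bichar1r hB) !mulr1.
Qed.

End HopfProjection.

Section TensorInclusion.
Variables (K : fieldType) (H : algType K) (hs : hopf_structure H) (A : algType K).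

Definition tens_in2 (x : A) : htens hs A := 1 (x) x.

Lemma tens_in2_linear : linear tens_in2.
Proof. by rewrite /tens_in2; lin. Qed.
HB.instance Definition _ := GRing.isLinear.Build K _ _ *:%R tens_in2 tens_in2_linear.

Lemma tens_in2_monoid : monoid_morphism tens_in2.
Proof. by split=> // x y; rewrite /tens_in2 htensM mulr1. Qed.
HB.instance Definition _ := GRing.isMonoidMorphism.Build _ _ tens_in2 tens_in2_monoid.

Definition tens_in1 (x : H) : htens hs A := x (x) 1.

Lemma tens_in1_linear : linear tens_in1.
Proof. by rewrite /tens_in1; lin. Qed.
HB.instance Definition _ := GRing.isLinear.Build K _ _ *:%R tens_in1 tens_in1_linear.

Lemma tens_in1_monoid : monoid_morphism tens_in1.
Proof. by split=> // x y; rewrite /tens_in1 htensM mulr1. Qed.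
HB.instance Definition _ := GRing.isMonoidMorphism.Build _ _ tens_in1 tens_in1_monoid.

End TensorInclusion.
Arguments tens_in1 {K H} hs A x.
Arguments tens_in2 {K H} hs {A} x.

Lemma em1M (K : fieldType) (gT : finGroupType) (A : algType K)
    (B : gT -> gT -> K) (hB : bicharacter B) x (e : tga A hB) c :
  (em hB 1%g x * e) c = x * e c.
Proof.
rewrite tgME (bigD1 1%g) //= big1 => [|a /negPf a1].
  by rewrite ffunE eqxx addr0 invg1 mul1g (bichar1l hB) scale1r.
by rewrite ffunE a1 mul0r scaler0.
Qed.

(** * From a colinear graded algebra map to a gauge equivalence *)

Section Lift.
Variables (K : fieldType) (gT : finGroupType).
Variables (H : algType K) (hs : hopf_structure H).
Variable p : {lrmorphism H -> grpalg K gT}.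
Hypothesis pco : coalgebra_map hs p.
Variables (s : H -> H -> K) (cs : cocycle_twist hs s).
Variables (B : gT -> gT -> K) (hB : bicharacter B).
Variable f : {lrmorphism H -> tga (twalg cs) hB}.
Local Notation T := (twalg cs).
Local Notation E := (tga (twalg cs) hB).
Local Notation D := (tga (htens hs (twalg cs)) hB).
Local Notation sw := (sw2 hs).
Local Notation eps := (counit hs).

Hypothesis col : forall h, tga_map (tw_coact cs) (f h) = lmix hs f h.
Hypothesis deg : forall h, tga_coact (f h) = rmix hs f p h.

Definition tgsum (e : E) : T := \sum_c e c.

Lemma tgsum_linear : linear tgsum.
Proof. by apply: lin_sum => c k x y; rewrite !ffunE. Qed.
HB.instance Definition _ := GRing.isLinear.Build K E T *:%R tgsum tgsum_linear.

Lemma tgsum_em c x : tgsum (em hB c x) = x.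
Proof.
rewrite /tgsum (bigD1 c) //= big1 ?addr0 => [|d /negPf dc]; first by rewrite ffunE eqxx.
by rewrite ffunE dc.
Qed.

Definition tgcounit (e : E) : K := eps (tgsum e).

Lemma tgcounit_linear : linear (tgcounit : E -> K^o).
Proof. by move=> k x y; rewrite /tgcounit tgsum_linear linearP. Qed.

Definition lift_form (h : H) : K := tgcounit (f h).

Lemma lift_form_linear : linear (lift_form : H -> K^o).
Proof. by move=> k x y; rewrite /lift_form linearP tgcounit_linear. Qed.

(** The factors of [f] in the convolution algebra of maps [H -> E]: [J] is the inclusion in degree
    1, [V] takes central scalar values, [P] is the projection to the group algebra, and [P'] is its
    inverse through [c -> c^-1]. *)
Let J (h : H) : E := em hB 1%g (h : T).
Let V (h : H) : E := lift_form h *: 1.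
Let P (h : H) : E := [ffun c => p h c *: 1].
Let P' (h : H) : E := [ffun c => p h c^-1%g *: 1].

Let lJ : linear J. Proof. exact: (@em_linear _ _ T _ hB 1%g). Qed.
HB.instance Definition _ := GRing.isLinear.Build K H E *:%R J lJ.
Let lV : linear V.
Proof. exact: (lin_scalel (1 : E) lift_form_linear). Qed.
HB.instance Definition _ := GRing.isLinear.Build K H E *:%R V lV.
Let lP : linear P.
Proof.
by move=> k x y; apply/ffunP => c; rewrite !ffunE linearP !ffunE scalerDl scalerA.
Qed.
HB.instance Definition _ := GRing.isLinear.Build K H E *:%R P lP.
Let lP' : linear P'.
Proof.
by move=> k x y; apply/ffunP => c; rewrite !ffunE linearP !ffunE scalerDl scalerA.
Qed.
HB.instance Definition _ := GRing.isLinear.Build K H E *:%R P' lP'.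

Local Notation "f ** g" := (conv hs f g) (at level 40, left associativity).
Local Notation eta := (conv_unit hs E).

Lemma lift_coef h c : f h c = sw h (fun a b => eps (f b c) *: (a : T)).
Proof.
have bb : bilinear_map (fun (a b : H) => (eps b : K) *: a).
  by apply: bilinP; lin; exact: linearP.
have := col h => /ffunP/(_ c); rewrite !ffunE => /(congr1 (tlift (fun (a b : H) => (eps b : K) *: a))).
rewrite (sw2_fun _ _ _ (tlift_linear bb)).
have -> : tlift (fun (a b : H) => (eps b : K) *: a) (tw_coact cs (f h c)) = f h c.
  exact: (sw2_counitr hs (f := id) _ (@lin_id _ _)).
by move=> ->; apply: eq_sw2 => a b; rewrite tliftE.
Qed.

(** The grading splits off [P]: the coefficient of [f h] in degree [c] is the sum of
    [p y c *: tgsum (f x)] over the legs [x], [y] of [h]. Colinearity, in the form [lift_coef], then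
    splits [tgsum (f x)] into [J] and [V]. *)
Lemma lift_factor : (f : H -> E) = J ** (V ** P).
Proof.
rewrite -convA; apply/funext => h; rewrite {1}[f h]tgaE.
have E1 c : em hB c (f h c) = sw h (fun x y => em hB c (p y c *: tgsum (f x))).
  have := deg h => /ffunP/(_ c); rewrite !ffunE => /(congr1 tgsum).
  rewrite tgsum_em => ->; rewrite (sw2_fun _ _ _ tgsum_linear).
  rewrite (sw2_fun _ _ _ (em_linear hB c)); apply: eq_sw2 => x y.
  by rewrite linearZ.
under eq_bigr => c _ do rewrite E1.
rewrite -sw2_exch_sum; apply: eq_sw2 => x y.
have -> : (J ** V) x = em hB 1%g (tgsum (f x)).
  have -> : tgsum (f x) = sw x (fun a b => lift_form b *: (a : T)).
    rewrite /tgsum; under eq_bigr => c _ do rewrite lift_coef.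
    rewrite -sw2_exch_sum; apply: eq_sw2 => a b.
    by rewrite -scaler_suml /lift_form /tgcounit /tgsum linear_sum.
  rewrite (sw2_fun _ _ _ (em_linear hB _)); apply: eq_sw2 => a b.
  by rewrite /V -scalerAr mulr1 emZ.
apply/ffunP => d; rewrite sum_ffunE em1M ffunE (bigD1 d) //= big1 => [|c /negPf cd].
  by rewrite ffunE eqxx addr0 -scalerAr mulr1.
by rewrite ffunE eq_sym cd.
Qed.

(** Colinearity as a factorization for convolution; [J] satisfies the same one, so the common left
    factor cancels in [f^-1 ** J]. *)
Lemma rho_lift : tga_map (tw_coact cs) \o f
  = conv hs (em1 hB \o tens_in1 hs T) (tga_map (tens_in2 hs) \o f).
Proof.
apply/funext => h; rewrite [LHS]col; apply/ffunP => c; rewrite ffunE /conv.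
rewrite -[RHS]/((fun x : D => x c) _).
have lc : linear (fun x : D => x c) by move=> k x y; rewrite !ffunE.
rewrite (sw2_fun _ _ _ lc); apply: eq_sw2 => a b /=.
by rewrite /em1 em1M ffunE htensM mul1r mulr1.
Qed.

Lemma rho_incl : tga_map (tw_coact cs) \o J
  = conv hs (em1 hB \o tens_in1 hs T) (tga_map (tens_in2 hs) \o J).
Proof.
apply/funext => h; rewrite /= tga_map_em /tw_coact -(sw2_comul hs).
rewrite (sw2_fun _ _ _ (em_linear hB _)); apply: eq_sw2 => a b /=.
by rewrite tga_map_em -rmorphM htensM mul1r mulr1.
Qed.

Let pi (e : E) : E := [ffun c => (eps (e c) : K) *: 1].
Let lpi : linear pi.
Proof.
by move=> k x y; apply/ffunP => c; rewrite !ffunE linearP scalerDl scalerA.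
Qed.
HB.instance Definition _ := GRing.isLinear.Build K E E *:%R pi lpi.

(** In general [pi] is not multiplicative, but it is linear over its image, the elements with scalar
    coefficients. *)
Let piM (x y : E) : pi (x * pi y) = pi x * pi y.
Proof.
apply/ffunP => c; rewrite ffunE !tgME (lin_big _ _ _ (counit_lin hs)) scaler_suml.
apply: eq_bigr => a _; rewrite !ffunE -!scalerAr !mulr1 !(linZ _ _ (counit_lin hs)).
by rewrite !scalerA.
Qed.

Let picM (x y : {linear H -> E}) : pi \o (x ** (pi \o y)) = (pi \o x) ** (pi \o y).
Proof.
apply/funext => h; rewrite /= (sw2_fun _ _ _ lpi); apply: eq_sw2 => a b.
exact: piM.
Qed.

Let fS := f \o antipode hs.
Let g := fS ** J.
Let M := V ** P.

(* With f = J ** M, the map g = f^-1 ** J is the candidate inverse of M; being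
   coinvariant, it takes its values in the twisted group algebra. *)
Lemma lift_coinvariant : g = pi \o g.
Proof.
have JE : (J : H -> E) = f ** g.
  by rewrite /g -convA conv_antipoder conv1f.
have fI : fS ** f = eta by rewrite conv_antipodel.
have : tga_map (tw_coact cs) \o g = tga_map (tens_in2 hs) \o g.
  rewrite {1}/g conv_morph rho_incl [in LHS]JE conv_morph.
  rewrite -[conv hs (em1 _ \o _) _]convA -rho_lift -convA -conv_morph fI.
  by rewrite conv_unit_morph conv1f.
move=> rg; apply/funext => h; apply/ffunP => c.
have /(congr1 (fun F => F h)) /= := rg => /ffunP/(_ c); rewrite !ffunE /=.
have bb : bilinear_map (fun (a b : H) => (eps b : K) *: a).
  by apply: bilinP; lin; exact: linearP.
move=> /(congr1 (tlift (fun (a b : H) => (eps b : K) *: a))).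
rewrite tliftE // => <-; symmetry.
exact: (sw2_counitr hs (f := id) _ (@lin_id _ _)).
Qed.

Lemma PPinv : (forall a, B a a^-1%g = 1) -> P ** P' = eta.
Proof.
move=> Ba; apply/funext => h.
transitivity (sw h (fun x y => \sum_a \sum_b (p x a * p y b^-1%g) *: (em hB a (1 : T) * em hB b (1 : T)))).
  apply: eq_sw2 => x y; rewrite [P x]tgaE [P' y]tgaE mulr_suml.
  apply: eq_bigr => a _; rewrite mulr_sumr; apply: eq_bigr => b _.
  by rewrite !ffunE !emZ -scalerAl -scalerAr scalerA.
rewrite sw2_exch_sum /conv_unit -pco.2 scaler_suml; apply: eq_bigr => a _.
rewrite sw2_exch_sum.
transitivity (\sum_b (p h a *+ (a == b^-1%g)) *: (em hB a (1 : T) * em hB b (1 : T))).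
  by apply: eq_bigr => b _; rewrite -pco.1 sw2_scalel.
rewrite (bigD1 a^-1%g) //= big1 => [|b ba].
  by rewrite invgK eqxx addr0 emM mulgV Ba mulr1 scale1r.
have /negPf -> : a != b^-1%g by apply: contraNneq ba => ->; rewrite invgK.
by rewrite mulr0n scale0r.
Qed.

Lemma lift_form_inv : (forall a, B a a^-1%g = 1) ->
  exists2 u : H -> K, linear (u : H -> K^o) & conv_inverse1 hs lift_form u.
Proof.
move=> Ba; have PP := PPinv Ba.
have fI : fS ** f = eta by rewrite conv_antipodel.
have If : f ** fS = eta by rewrite conv_antipoder.
have gM : g ** M = eta by rewrite /g convA -lift_factor.
have piM' : pi \o M = M.
  apply/funext => h; rewrite /M /= (sw2_fun _ _ _ lpi); apply: eq_sw2 => x y.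
  rewrite /V -scalerAl mul1r linearZ; congr (_ *: _).
  by apply/ffunP => c; rewrite !ffunE linearZ /= counit1 [X in X *: _]mulr1.
(* Invertibility of [f] gives only [J ** (M ** g) = J]. Applying [pi], which sends [J] to the unit
   and fixes [M ** g], cancels [J]. *)
have Mg : M ** g = eta.
  have piN : pi \o (M ** g) = M ** g.
    by rewrite lift_coinvariant picM piM'.
  have JN : J ** (M ** g) = J by rewrite -convA -lift_factor /g -convA If conv1f.
  have piJ : pi \o J = eta.
    apply/funext => h; apply/ffunP => c; rewrite !ffunE /=.
    case: eqP => _; first by [].
    by rewrite linear0 scale0r; apply/esym/scaler0.
  have e1 : eta ** (M ** g) = M ** g by rewrite conv1f.
  by rewrite -e1 -{1}piJ -piN -picM piN JN.
have VX : V ** (P ** g) = eta by rewrite -convA.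
(* Inserting [P ** P'] on the right makes [g ** (V ** P)], that is [g ** M], appear in the
   middle. *)
have XV : P ** g ** V = eta.
  have e1 : P ** g ** V ** eta = P ** g ** V by rewrite convf1.
  rewrite -e1 -{1}PP -convA [_ ** V ** P]convA [_ ** g ** _]convA.
  by rewrite gM convf1.
exists (fun h => tgcounit ((P ** g) h)).
  by move=> k x y; rewrite linearP tgcounit_linear.
have t1 h : tgcounit (eta h) = eps h.
  rewrite /conv_unit (linZ _ _ tgcounit_linear) /tgcounit tgsum_em counit1.
  exact: mulr1.
move=> h; split.
  rewrite -t1 -VX /conv (sw2_fun _ _ _ tgcounit_linear); apply: eq_sw2 => a b.
  by rewrite /V -scalerAl mul1r (linZ _ _ tgcounit_linear).
rewrite -t1 -XV /conv (sw2_fun _ _ _ tgcounit_linear); apply: eq_sw2 => a b.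
by rewrite /V -scalerAr mulr1 (linZ _ _ tgcounit_linear); apply: mulrC.
Qed.

(** Apply [tgcounit] to [f (h * k) = f h * f k] and factor both values of [f]. The scalars of [V]
    come out, while a product [J a * P x * (J b * P y)] contributes [s a b] by [counit_twmul] and
    [B] on the degrees. *)
Lemma lift_form_mul : mul_form lift_form
  = conv2 hs s (conv2 hs (tens2 lift_form lift_form) (restrict_form p B)).
Proof.
apply/funext => h; apply/funext => k; rewrite /mul_form.
have -> : lift_form (h * k) = tgcounit (f h * f k) by rewrite /lift_form rmorphM.
have fE x : f x = sw x (fun a z => sw z (fun c d => lift_form c *: (J a * P d))).
  rewrite [in LHS]lift_factor; apply: eq_sw2 => a z; rewrite sw2_mull.
  by apply: eq_sw2 => c d; rewrite /V -scalerAl mul1r scalerAr.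
have tE a b x y : tgcounit (J a * P x * (J b * P y)) = s a b * restrict_form p B x y.
  have JP u v : J u * P v = \sum_c p v c *: em hB c (u : T).
    rewrite [P v]tgaE mulr_sumr; apply: eq_bigr => c _.
    by rewrite ffunE emM emZ -scalerAr mulr1 (bichar1l hB) scale1r mul1g emZ.
  rewrite !JP mulr_suml (lin_big _ _ _ tgcounit_linear) rfE mulr_sumr.
  apply: eq_bigr => c _; rewrite [X in tgcounit X]mulr_sumr [LHS](lin_big _ _ _ tgcounit_linear) [RHS]mulr_sumr.
  apply: eq_bigr => d _; rewrite -scalerAl -scalerAr emM emZ.
  rewrite !(linZ _ _ tgcounit_linear) /tgcounit tgsum_em counit_twmul.
  rewrite -[LHS]/(p x c * (p y d * (B c d * s a b))); ring.
rewrite !fE sw2_mulr (sw2_fun _ _ _ tgcounit_linear); apply: eq_sw2 => a z.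
rewrite sw2_mull (sw2_fun _ _ _ tgcounit_linear); apply: eq_sw2 => b z'.
rewrite sw2_mulr (sw2_fun _ _ _ tgcounit_linear) /conv2 sw2_kmull.
apply: eq_sw2 => c d; rewrite sw2_mull (sw2_fun _ _ _ tgcounit_linear) sw2_kmull.
apply: eq_sw2 => c' d'; rewrite -scalerAl -scalerAr !(linZ _ _ tgcounit_linear) tE.
rewrite -[LHS]/(lift_form c * (lift_form c' * (s a b * restrict_form p B d d'))).
by rewrite /tens2; ring.
Qed.

End Lift.

Lemma lift_gauge (K : fieldType) (gT : finGroupType) (H : algType K)
    (hs : hopf_structure H) (p : {lrmorphism H -> grpalg K gT})
    (s : H -> H -> K) (cs : cocycle_twist hs s) (B B' : gT -> gT -> K)
    (hB : bicharacter B) (f : {lrmorphism H -> tga (twalg cs) hB}) :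
  coalgebra_map hs p ->
  (forall h, tga_map (tw_coact cs) (f h) = lmix hs f h) ->
  (forall h, tga_coact (f h) = rmix hs f p h) ->
  (forall a, B a a^-1%g = 1) -> (forall a b, B' a b = (B a b)^-1) ->
  gauge_equiv hs (restrict_form p B') s.
Proof.
move=> pco col deg Ba BB'; set v := lift_form f.
have lv : linear (v : H -> K^o) by apply: lift_form_linear.
have [u lu uv] := lift_form_inv pco col deg Ba.
have [n0 _ _] := hB; have bs := cocycle_biform cs.
have br C : biform (restrict_form p C) by apply: rf_biform.
have bvv : biform (tens2 v v) by apply: biform_tens2.
have buu : biform (tens2 u u) by apply: biform_tens2.
have [vu uv'] := conv_inverseE uv.
apply/gauge_equivE => //; exists v, u; split=> //.
rewrite (lift_form_mul col deg) conv2A //; try by apply: biform_conv2.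
rewrite conv2A //; last by apply: biform_conv2.
rewrite -(conv2A hs (br B) (br B') buu) rf_conv //.
have -> : (fun a b => B a b * B' a b) = (fun _ _ => 1).
  by apply/funext => a; apply/funext => b; rewrite BB' mulfV.
by rewrite (rf1 pco) conv2_1l // conv_tens2 vu tens2_counit conv2_1r.
Qed.

(** * Quantum Serre elements *)

Section QuantumSerre.
Variables (K : fieldType) (A : algType K) (c T : K).
Implicit Types x y a b : A.

(** The iterated braided commutator of [x] with [y]. For [c] = q^(alpha_i, alpha_j) and [T] =
    q^(alpha_i, alpha_i) it is the quantum Serre element at the step 1 - <alpha_i, alpha_j>; the
    recursion allows inductive expansion of sums. *)
Fixpoint qad x y (s : nat) : A :=
  if s is s'.+1 then x * qad x y s' - (c * T ^+ s') *: (qad x y s' * x) else y.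

Fixpoint qad_coef (s k : nat) : K :=
  if s is s'.+1 then
    qad_coef s' k - (if k is k'.+1 then c * T ^+ s' * qad_coef s' k' else 0)
  else (k == 0%N)%:R.

Lemma qad_coef_gt s k : (s < k)%N -> qad_coef s k = 0.
Proof.
elim: s k => [|s IH] [|k] //= sk; rewrite !IH ?mulr0 ?subr0 //.
exact: ltnW.
Qed.

Lemma qadE x y s :
  qad x y s = \sum_(k < s.+1) qad_coef s k *: (x ^+ (s - k) * y * x ^+ k).
Proof.
elim: s => [|s IH]; first by rewrite big_ord1 /= scale1r mul1r mulr1.
rewrite /= {}IH mulr_sumr mulr_suml scaler_sumr.
transitivity (\sum_(k < s.+2) (qad_coef s k *: (x ^+ (s.+1 - k) * y * x ^+ k))
  - \sum_(k < s.+2) ((if k : nat is k'.+1 then c * T ^+ s * qad_coef s k' else 0)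
       *: (x ^+ (s.+1 - k) * y * x ^+ k))); last first.
  by rewrite -sumrB; apply: eq_bigr => k _; rewrite -scalerBl.
congr (_ - _).
  rewrite [RHS]big_ord_recr /= (qad_coef_gt (ltnSn s)) scale0r addr0.
  apply: eq_bigr => k _; rewrite -scalerAr !mulrA -exprS subSn //.
  by rewrite -ltnS.
rewrite [RHS]big_ord_recl scale0r add0r; apply: eq_bigr => k _.
by rewrite /= -scalerAl scalerA subSS -!mulrA -exprSr.
Qed.

(** Coefficients of the mixed terms in [qadD]: in the recursion the first summand comes from the
    commutator with [a], the second from the one with [b], which raises [k]. *)
Fixpoint qad_cross (s k : nat) : K :=
  if s is s'.+1 then
    (1 - c ^+ 2 * T ^+ (s' + k)) * qad_cross s' k
    + (if k is k'.+1 then T ^+ (s' - k') * qad_cross s' k' else 0)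
  else (k == 0%N)%:R.

Lemma qad_cross_gt s k : (s < k)%N -> qad_cross s k = 0.
Proof.
elim: s k => [|s IH] [|k] //= sk; rewrite !IH ?mulr0 ?addr0 //.
exact: ltnW.
Qed.

Section Add.
Variables a b a' b' : A.
Hypotheses (ba : b * a = T *: (a * b)) (ba' : b * a' = c *: (a' * b))
  (b'a : b' * a = c *: (a * b')).

Lemma qad_comml k : b * qad a a' k = (c * T ^+ k) *: (qad a a' k * b).
Proof.
elim: k => [|k]; first by rewrite mulr1.
rewrite /= exprSr mulrA; set z := qad a a' k; set e := c * T ^+ k => bz.
have -> : b * (a * z - e *: (z * a)) = (b * a) * z - e *: (b * z * a).
  by rewrite mulrBr -scalerAr !mulrA.
rewrite ba bz -!scalerAl -[a * b * z]mulrA bz -[z * b * a]mulrA ba.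
rewrite mulrBl scalerBr -!scalerAr -!scalerAl !scalerA !mulrA.
by congr (_ *: _ - _ *: _); rewrite /e; ring.
Qed.

Lemma qad_commr k : qad b b' k * a = (c * T ^+ k) *: (a * qad b b' k).
Proof.
elim: k => [|k]; first by rewrite mulr1.
rewrite /= exprSr mulrA; set z := qad b b' k; set e := c * T ^+ k => za.
have -> : (b * z - e *: (z * b)) * a = b * (z * a) - e *: (z * (b * a)).
  by rewrite mulrBl -scalerAl !mulrA.
rewrite ba za -!scalerAr !mulrA ba za -!scalerAl.
rewrite mulrBr scalerBr -!scalerAr !scalerA !mulrA.
by congr (_ *: _ - _ *: _); rewrite /e; ring.
Qed.

Lemma comm_exp r : b * a ^+ r = T ^+ r *: (a ^+ r * b).
Proof.
elim: r => [|r IH]; first by rewrite mulr1 mul1r scale1r.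
rewrite !exprS [LHS]mulrA ba -scalerAl -[a * b * _]mulrA IH -scalerAr scalerA.
by rewrite !mulrA.
Qed.

Lemma qadD s : qad (a + b) (a' + b') s
  = qad a a' s + \sum_(k < s.+1) qad_cross s k *: (a ^+ (s - k) * qad b b' k).
Proof.
elim: s => [|s IH]; first by rewrite big_ord1 /= scale1r mul1r.
rewrite /= IH mulrDr !mulrDl scalerDr opprD addrACA.
(* The commutator of [b] with the part built from [a] and [a'] alone vanishes, by [qad_comml]. *)
have -> : a * qad a a' s + b * qad a a' s
    - (c * T ^+ s) *: (qad a a' s * (a + b))
  = a * qad a a' s - (c * T ^+ s) *: (qad a a' s * a).
  by rewrite qad_comml mulrDr scalerDr opprD addrACA subrr addr0.
congr (_ + _).
have E (k : 'I_s.+1) : (a + b) * (a ^+ (s - k) * qad b b' k)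
    - (c * T ^+ s) *: (a ^+ (s - k) * qad b b' k * (a + b))
  = (1 - c ^+ 2 * T ^+ (s + k)) *: (a ^+ (s.+1 - k) * qad b b' k)
    + T ^+ (s - k) *: (a ^+ (s.+1 - k.+1) * qad b b' k.+1).
  have ks : (k <= s)%N by rewrite -ltnS.
  rewrite mulrDl mulrDr scalerDr opprD addrACA subSS; congr (_ + _).
    rewrite -[a ^+ (s - k) * qad b b' k * a]mulrA qad_commr -scalerAr !mulrA -exprS.
    rewrite -exprSr scalerA -subSn // scalerBl scale1r; congr (_ - _ *: _).
    by rewrite exprD; ring.
  rewrite mulrA comm_exp -scalerAl -[a ^+ (s - k) * b * _]mulrA.
  rewrite -[a ^+ (s - k) * qad b b' k * b]mulrA /= mulrBr scalerBr -scalerAr.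
  rewrite scalerA; congr (_ - _ *: _).
  by rewrite mulrCA -exprD subnK.
rewrite -mulrDl mulr_sumr mulr_suml scaler_sumr -sumrB.
transitivity (\sum_(k < s.+1) (((1 - c ^+ 2 * T ^+ (s + k)) * qad_cross s k)
      *: (a ^+ (s.+1 - k) * qad b b' k)
    + (T ^+ (s - k) * qad_cross s k) *: (a ^+ (s.+1 - k.+1) * qad b b' k.+1))).
  apply: eq_bigr => k _; set X := a ^+ _ * _; set q := qad_cross s k.
  transitivity (q *: ((a + b) * X - (c * T ^+ s) *: (X * (a + b)))).
    by rewrite scalerBr -scalerAr -scalerAl !scalerA [q * _]mulrC.
  by rewrite E scalerDr !scalerA ![q * _]mulrC.
rewrite big_split /=.
transitivity (\sum_(k < s.+2) (((1 - c ^+ 2 * T ^+ (s + k)) * qad_cross s k)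
      *: (a ^+ (s.+1 - k) * qad b b' k))
  + \sum_(k < s.+2) ((if k : nat is k'.+1 then T ^+ (s - k') * qad_cross s k' else 0)
      *: (a ^+ (s.+1 - k) * qad b b' k))); last first.
  by rewrite -big_split /=; apply: eq_bigr => k _; rewrite -scalerDl.
congr (_ + _).
  by rewrite [RHS]big_ord_recr /= (qad_cross_gt (ltnSn s)) mulr0 scale0r addr0.
by rewrite [RHS]big_ord_recl scale0r add0r; apply: eq_bigr.
Qed.

End Add.
End QuantumSerre.

Section QuantumSerreScalars.
Variables (K : fieldType) (u : K).
Hypothesis u0 : u != 0.

(* The factor 1 - c^2 T^(m-1), which vanishes, divides all the coefficients of
   the mixed terms of qadD. *)
Lemma qad_cross_serre m k : (0 < m <= 4)%N -> (k <= m)%N ->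
  qad_cross (u ^+ m.-1) (u ^- 2) m k = (k == m)%:R.
Proof.
case: m => [|[|[|[|[|]]]]] // _; case: k => [|[|[|[|[|]]]]] //= _;
  rewrite ?eqxx; by field.
Qed.

Lemma qint_nz n : u ^+ n.*2 != 1 -> qint u n != 0.
Proof.
case: n => [|n un]; first by rewrite eqxx.
have un0 : u ^+ n.+1 != 0 by rewrite expf_neq0.
rewrite /qint mulf_neq0 ?invr_eq0 //.
  apply: contraNneq un => /(congr1 (fun x => x * u ^+ n.+1)).
  rewrite mulrBl mulVf // mul0r -exprD addnn => /eqP.
  by rewrite subr_eq0.
(* The inverse of 0 is 0, so a vanishing denominator would also make [qint] vanish; but it forces
   [u ^+ 2 = 1], which is excluded too. *)
apply: contraNneq un => /(congr1 (fun x => x * u)).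
rewrite mulrBl mulVf // mul0r => /eqP; rewrite subr_eq0 => /eqP uu.
by rewrite -mul2n exprM expr2 uu expr1n.
Qed.

Lemma qfactS n : qfact u n.+1 = qfact u n * qint u n.+1.
Proof. by rewrite /qfact big_nat_recr. Qed.

(** An instance of the q-binomial theorem. Cartan integers are at least -3, so [m <= 4] suffices and
    each coefficient is checked; [qbinom] divides by quantum integers, whence the condition on
    [u]. *)
Lemma qad_coef_serre m k : (0 < m <= 4)%N -> (k <= m)%N ->
  (forall n, (0 < n <= m)%N -> u ^+ n.*2 != 1) ->
  qad_coef (u ^+ m.-1) (u ^- 2) m k = (-1) ^+ k * qbinom u m k.
Proof.
move=> m4 km un.
have m0 : (0 < m)%N by case/andP: m4.
have nz n : (0 < n <= m)%N -> qint u n != 0 by move=> ?; apply: qint_nz; apply: un.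
have u21 : u ^+ 2 - 1 != 0 by rewrite subr_eq0; apply: (un 1%N).
have f0 : qfact u 0 = 1 by rewrite /qfact big_geq.
have f1 : qfact u 1 = 1.
  rewrite qfactS f0 mul1r /qint expr1 divff //.
  have := nz 1%N m0; rewrite /qint expr1; apply: contraNneq => ->.
  by rewrite mul0r.
(* [x2], [x3] and [y4] stand for [2], [3] and [4]/[2]. Kept opaque, they let the factorials cancel
   before being expanded in [u]. *)
have [x2 [q2 D2]] : exists x2, qint u 2 = x2 /\ x2 = u + u^-1.
  by eexists; split; [reflexivity | rewrite /qint; field; rewrite u0 /=].
have [x3 [q3 D3]] : exists x3, qint u 3 = x3 /\ x3 = u ^+ 2 + 1 + u ^- 2.
  by eexists; split; [reflexivity | rewrite /qint; field; rewrite u0 /=].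
have [y4 [q4 D4]] : exists y4, qint u 4 = x2 * y4 /\ y4 = u ^+ 2 + u ^- 2.
  eexists; split; last reflexivity.
  by rewrite D2 /qint; field; rewrite u0 /=.
have f2 : qfact u 2 = x2 by rewrite qfactS f1 mul1r q2.
have f3 : qfact u 3 = x2 * x3 by rewrite qfactS f2 q3.
have f4 : qfact u 4 = x2 * x3 * (x2 * y4) by rewrite qfactS f3 q4.
have n2 : (1 < m)%N -> x2 != 0 by move=> h; rewrite -q2; apply: nz.
have n3 : (2 < m)%N -> x3 != 0 by move=> h; rewrite -q3; apply: nz.
have n4 : (3 < m)%N -> y4 != 0.
  move=> h; have : qint u 4 != 0 by apply: nz.
  by rewrite q4 mulf_eq0 negb_or => /andP[].
have b1 i : (i <= 1)%N -> qbinom u 1 i = 1.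
  by case: i => [|[|]] // _; rewrite /qbinom ?subnn ?subn0 f0 f1 mulr1 divr1.
have b2 i : (1 < m)%N -> (i <= 2)%N -> qbinom u 2 i = if i == 1%N then x2 else 1.
  move=> m2; have h2 := n2 m2; case: i => [|[|[|]]] // _;
    rewrite /qbinom ?subnn ?subn0 ?[(2 - 1)%N]/(1%N) ?f0 ?f1 ?f2 /=;
    field; rewrite ?h2 ?oner_neq0 //.
have b3 i : (2 < m)%N -> (i <= 3)%N ->
    qbinom u 3 i = if i \in [:: 1; 2]%N then x3 else 1.
  move=> m3; have h2 := n2 (ltnW m3); have h3 := n3 m3.
  case: i => [|[|[|[|]]]] // _; rewrite /qbinom ?subnn ?subn0 ?[(3 - 1)%N]/(2%N)
    ?[(3 - 2)%N]/(1%N) ?f0 ?f1 ?f2 ?f3 /=; field; rewrite ?h2 ?h3 ?oner_neq0 //.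
have b4 i : (3 < m)%N -> (i <= 4)%N ->
    qbinom u 4 i = if i \in [:: 1; 3]%N then x2 * y4 else if i == 2%N then x3 * y4 else 1.
  move=> m3; have h2 := n2 (ltnW (ltnW m3)); have h3 := n3 (ltnW m3); have h4 := n4 m3.
  case: i => [|[|[|[|[|]]]]] // _; rewrite /qbinom ?subnn ?subn0 ?[(4 - 1)%N]/(3%N)
    ?[(4 - 2)%N]/(2%N) ?[(4 - 3)%N]/(1%N) ?f0 ?f1 ?f2 ?f3 ?f4 /=; field;
    rewrite ?h2 ?h3 ?h4 ?oner_neq0 //.
clear f1 f2 f3 f4 q2 q3 q4 n2 n3 n4 nz un u21 f0.
move: m4 km b2 b3 b4 {m0}.
case: m => [|[|[|[|[|]]]]] // _; case: k => [|[|[|[|[|]]]]] //= _ b2 b3 b4;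
 rewrite ?b1 ?b2 ?b3 ?b4 //= ?D2 ?D3 ?D4; by field.
Qed.
End QuantumSerreScalars.

Lemma qad_serre (K : fieldType) (A : algType K) (u : K) (x y : A) m :
  u != 0 -> (0 < m <= 4)%N -> (forall n, (0 < n <= m)%N -> u ^+ n.*2 != 1) ->
  qad (u ^+ m.-1) (u ^- 2) x y m
  = \sum_(k < m.+1) ((-1) ^+ k * qbinom u m k) *: (x ^+ (m - k) * y * x ^+ k).
Proof.
move=> u0 m4 un; rewrite qadE; apply: eq_bigr => k _.
by rewrite qad_coef_serre // -ltnS.
Qed.

(** The mixed terms of [qadD] disappear by [qad_cross_serre]. Applied to the two summands of a
    coaction, which commute up to these powers of [u], this is the primitivity of quantum Serre
    elements. *)
Lemma qad_primitive (K : fieldType) (A : algType K) (u : K) (a b a' b' : A) m :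
  u != 0 -> (0 < m <= 4)%N ->
  b * a = u ^- 2 *: (a * b) -> b * a' = u ^+ m.-1 *: (a' * b) ->
  b' * a = u ^+ m.-1 *: (a * b') ->
  qad (u ^+ m.-1) (u ^- 2) (a + b) (a' + b') m
  = qad (u ^+ m.-1) (u ^- 2) a a' m + qad (u ^+ m.-1) (u ^- 2) b b' m.
Proof.
move=> u0 m4 ba ba' b'a; rewrite qadD //; congr (_ + _).
rewrite big_ord_recr /= big1 ?add0r => [|k _].
  by rewrite qad_cross_serre // eqxx scale1r subnn mul1r.
by rewrite qad_cross_serre // ?ltn_eqF ?scale0r // ltnW.
Qed.

(** * Dynkin diagrams and orders *)

Lemma killing_sym (F : fieldType) (L : vectType F) (br : lie_structure L) x y :
  killing br x y = killing br y x.
Proof.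
have bb : bilinear_map br by case: br.
set b := vbasis (fullv : {vspace L}).
have E u v : killing br u v = \sum_(i < \dim (fullv : {vspace L}))
    \sum_(j < \dim (fullv : {vspace L}))
      coord b j (br v b`_i) * coord b i (br u b`_j).
  apply: eq_bigr => i _; rewrite -/b.
  rewrite {1}(coord_vbasis (memvf (br v b`_i))) -/b.
  rewrite (lin_big _ _ _ (bb.2 u)) linear_sum; apply: eq_bigr => j _ /=.
  by rewrite (linZ _ _ (bb.2 u)) linearZ.
rewrite !E exchange_big; apply: eq_bigr => i _; apply: eq_bigr => j _.
exact: mulrC.
Qed.

Lemma normalized_killing_sym (F : numFieldType) (L : vectType F)
    (br : lie_structure L) (h : {vspace L}) n
    (alpha : 'I_n -> 'Hom(subvs_of h, F^o)) ip :
  normalized_killing br alpha ip -> forall i j, ip i j = ip j i.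
Proof.
case=> -[k [t [_ E]]] _ i j; apply: (@intr_inj F).
by rewrite !E killing_sym.
Qed.

Section Dynkin.
Variable X : dynkin.
Local Notation n := (dynkin_rank X).
Local Notation len := (dynkin_len X).
Local Notation adj i j := (dynkin_edge X i j || dynkin_edge X j i).

Definition dynkin_mult (i j : nat) : nat :=
  if adj i j then (maxn (len i) (len j) %/ len i)%N else 0%N.

Lemma dynkin_lenP i : len i \in
  match X with DynB _ | DynC _ | DynF4 => [:: 1; 2] | DynG2 => [:: 1; 3] | _ => [:: 1] end%N.
Proof. by case: X => [k|k|k|k|k||] //=; case: ifP. Qed.

Lemma dynkin_len_gt0 i : (0 < len i)%N.
Proof. by have := dynkin_lenP i; case: (len i) => //; case: X. Qed.

Lemma dynkin_mult_len i j :
  (dynkin_mult i j * len i)%N = if adj i j then maxn (len i) (len j) else 0%N.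
Proof.
rewrite /dynkin_mult; case: ifP => // _.
have := dynkin_lenP i; have := dynkin_lenP j.
by case: X => [k|k|k|k|k||]; rewrite !inE;
  do 2?[move/eqP=> -> | move/orP=> [] /eqP ->].
Qed.

Lemma dynkin_cartanE i j : i != j -> dynkin_cartan X i j = - (dynkin_mult i j)%:Z.
Proof. by rewrite /dynkin_cartan /dynkin_mult => /negPf ->; case: ifP. Qed.

Lemma dynkin_mult_le i j : (dynkin_mult i j <= 3)%N.
Proof.
rewrite /dynkin_mult; case: ifP => // _.
have := dynkin_lenP i; have := dynkin_lenP j.
by case: X => [k|k|k|k|k||]; rewrite !inE;
  do 2?[move/eqP=> -> | move/orP=> [] /eqP ->].
Qed.

Lemma dynkin_rank_gt0 : dynkin_valid X -> (0 < n)%N.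
Proof. by case: X => //= k; lia. Qed.

Lemma dynkin_short : dynkin_valid X -> exists2 i, (i < n)%N & len i = 1%N.
Proof.
case: X => [k|k|k|k|k||] /= v; try by [exists 0%N | exists 2 | exists 0%N => //; lia].
- by exists k.-1; [lia | rewrite eqxx].
- by exists 0%N; [lia | case: eqP => //; lia].
Qed.

(* Every node but the root is adjacent to one already reached; in type E the
   node 1 hangs below the node 3. *)
Lemma dynkin_connected (P : nat -> Prop) : dynkin_valid X ->
  P 0%N -> (forall i j, (i < n)%N -> (j < n)%N -> i != j -> adj i j -> P j -> P i) ->
  forall i, (i < n)%N -> P i.
Proof.
move=> v P0 Pstep.
have line : (forall i, (i.+1 < n)%N -> adj i.+1 i) -> forall i, (i < n)%N -> P i.
  move=> E; elim=> // i IH ii; apply: (Pstep _ i) => //; last first.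
    by apply: IH; apply: ltnW.
  - exact: E.
  - by rewrite gtn_eqF.
  - exact: ltnW.
move: v P0 Pstep line; rewrite /=; case: X => [k|k|k|k|k||] /= v P0 Pstep line;
  try by apply: line => i _; rewrite eqxx orbT.
- have Q i : (i < k.-1)%N -> P i.
    elim: i => // i IH ii; apply: (Pstep _ i); try lia.
    by apply: IH; lia.
  move=> i ik; case: (ltnP i k.-1) => [/Q //|ii]; have -> : i = k.-1 by lia.
  apply: (Pstep _ (k - 3)%N); [lia | lia | lia | lia | by apply: Q; lia].
- have P2 : P 2%N by apply: (Pstep _ 0%N) => //; lia.
  have P3 : P 3%N by apply: (Pstep _ 2%N) => //; lia.
  have P1 : P 1%N by apply: (Pstep _ 3%N) => //; lia.
  case=> [|[|]] //; elim=> // i IH ii; apply: (Pstep _ i.+2) => //; try lia.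
  by apply: IH; lia.
Qed.

Variable ip : 'I_n -> 'I_n -> int.
Hypothesis hX : of_type ip.
Hypothesis ipC : forall i j, ip i j = ip j i.
Hypothesis ip2 : forall i, (forall j, ip i i <= ip j j) -> ip i i = 2.

(** For adjacent nodes, the two Cartan integers and the symmetry of [ip] determine the ratio of the
    norms; connectedness of the diagram carries the comparison to node 0, in cross-multiplied
    form. *)
Lemma ip_ratio (i j : 'I_n) : ip i i * len j = ip j j * len i.
Proof.
have [v hC] := hX; have n0 := dynkin_rank_gt0 v.
pose o := Ordinal n0.
have len0 k : (len k)%:Z != 0 by rewrite eqz_nat -lt0n dynkin_len_gt0.
suff H k : (k < n)%N -> forall i : 'I_n, i = k :> nat -> ip i i * len 0 = ip o o * len i.
  apply: (mulIf (len0 0%N)); rewrite mulrAC (H i) // [RHS]mulrAC (H j) //.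
  by rewrite mulrAC.
move: k; apply: dynkin_connected => // [i0 E|k k' kn k'n kk' a IH i0 E].
  by rewrite (_ : i0 = o) //; apply: val_inj.
have := IH (Ordinal k'n) erefl; set j0 := Ordinal k'n => Ej.
have ij : (i0 : nat) != j0 by rewrite E.
have := hC i0 j0; have := hC j0 i0; rewrite [ip j0 i0]ipC => -> {hC}.
rewrite !dynkin_cartanE // 1?eq_sym // => Eij.
have a1 : adj i0 j0 by rewrite E.
have m1 := dynkin_mult_len i0 j0; have m2 := dynkin_mult_len j0 i0.
rewrite a1 in m1; rewrite orbC a1 maxnC in m2.
have mx : (maxn (len i0) (len j0))%:Z != 0.
  by rewrite eqz_nat -lt0n leq_max dynkin_len_gt0.
apply: (mulIf (len0 j0)); apply: (mulIf mx).
have e1 : (dynkin_mult i0 j0)%:Z * (len i0)%:Z = (maxn (len i0) (len j0))%:Z.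
  by rewrite -PoszM m1.
have e2 : (dynkin_mult j0 i0)%:Z * (len j0)%:Z = (maxn (len i0) (len j0))%:Z.
  by rewrite -PoszM m2.
have e3 : (dynkin_mult j0 i0)%:Z * ip j0 j0 = (dynkin_mult i0 j0)%:Z * ip i0 i0.
  by apply: oppr_inj; rewrite -!mulNr.
rewrite -{1}e1 -e2.
transitivity ((dynkin_mult i0 j0)%:Z * ip i0 i0 * (len i0)%:Z * (len j0)%:Z * (len 0)%:Z);
  first by ring.
rewrite -e3.
transitivity (ip j0 j0 * (len 0)%:Z * ((dynkin_mult j0 i0)%:Z * (len i0)%:Z * (len j0)%:Z));
  first by ring.
by rewrite Ej; ring.
Qed.

Lemma ip_diag (i : 'I_n) : ip i i = (2 * len i)%N.
Proof.
have [v hC] := hX; have [k kn k1] := dynkin_short v.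
pose s := Ordinal kn.
have E (j : 'I_n) : ip j j = ip s s * len j by rewrite -ip_ratio /= k1 mulr1.
suff Es : ip s s = 2 by rewrite E Es PoszM.
case: (leP 0 (ip s s)) => [s0|s0].
  apply: ip2 => j; rewrite [ip j j]E ler_peMr //.
  by rewrite (_ : 1 = 1%:Z) // lez_nat dynkin_len_gt0.
(* The sign of the form is not known beforehand. Were it negative on a short root, a longest root
   would have the least norm, and the normalization would give it the norm 2. *)
pose t := [arg max_(t > s) len t].
have tmax (j : 'I_n) : (len j <= len t)%N.
  by rewrite /t; case: arg_maxnP => // t0 _; apply.
have : ip t t = 2.
  apply: ip2 => j; rewrite [ip t t]E [ip j j]E.
  by apply: ler_wnM2l; [apply: ltW | rewrite lez_nat].
rewrite E => E2; have : ip s s * len t <= 0 by rewrite mulr_le0_ge0 // ltW.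
by rewrite E2.
Qed.

Lemma ip_offdiag (i j : 'I_n) : i != j ->
  ip i j = - (dynkin_mult i j * len i)%N%:Z.
Proof.
have [v hC] := hX => ij; have := hC i j.
rewrite ip_diag dynkin_cartanE // => E.
apply: (@mulfI _ 2) => //; rewrite E !PoszM; ring.
Qed.

Lemma pairingE (i j : 'I_n) : i != j -> pairing ip i j = - (dynkin_mult i j)%:Z.
Proof.
have [v hC] := hX => ij; rewrite /pairing hC mulzK ?dynkin_cartanE //.
by rewrite ip_diag eqz_nat muln_eq0 /= -lt0n dynkin_len_gt0.
Qed.

Variable l : nat.
Hypothesis hl : admissible_order X l.

(** A divisor [l] of a positive [N] is at most [N]. The numbers to which this is applied are at most
    18, reached in type G, so nineteen case distinctions on [l] exhaust the possibilities. *)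
Ltac small_order ol l1 lx :=
  lazymatch goal with |- is_true (negb (dvdn ?l ?N)) =>
    let b := fresh in have b := @dvdn_leq l N isT;
    apply/negP => /[dup] /b {b}; move: ol l1 lx; clear; move: l end;
  do 19?[case=> //].

Lemma order_ndvd_qint (i j : nat) k :
  (0 < k <= (dynkin_mult i j).+1)%N -> ~~ (l %| k.*2 * len i)%N.
Proof.
have := dynkin_lenP i; have := dynkin_lenP j; move: hl; rewrite /admissible_order.
rewrite /dynkin_mult; clear.
case: X => [r|r|r|r|r||] /and3P[ol l1 lx]; rewrite !inE;
  do 2?[move/eqP=> -> | move/orP=> [] /eqP ->];
  case: ifP => _; case: k => [|[|[|[|[|k]]]]] //= _;
  try (move=> _); small_order ol l1 lx.
Qed.

(* The exponent is the norm of (1 - <alpha_i, alpha_j>) alpha_i + alpha_j. *)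
Lemma order_ndvd_serre (i j : nat) :
  ~~ (l %| (dynkin_mult i j).+1 * (2 * len i) + 2 * len j)%N.
Proof.
(* For adjacent nodes the number becomes twice the sum of [len i], [len j] and their maximum: 6 for
   short roots of equal length, 10 across a double bond, 14 across a triple one. Hence the exclusion
   of 3, 5 and 7. *)
rewrite mulSn mulnCA dynkin_mult_len.
have := dynkin_lenP i; have := dynkin_lenP j; move: hl; rewrite /admissible_order; clear.
case: X => [r|r|r|r|r||] /and3P[ol l1 lx]; rewrite !inE;
  do 2?[move/eqP=> -> | move/orP=> [] /eqP ->];
  case: ifP => _ /=; try (move=> _); small_order ol l1 lx.
Qed.
End Dynkin.

(** * Cocycles of abelian groups of odd exponent *)

Section AbelianCocycles.
Variables (K : numClosedFieldType) (gT : finGroupType).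
Hypothesis abelG : forall a b : gT, (a * b)%g = (b * a)%g.

Section SymmetricCocycle.
Variable s : gT -> gT -> K.
Hypotheses (s0 : forall a b, s a b != 0) (s1 : forall a, s a 1%g = 1)
  (sC : forall a b c, s (a * b)%g c * s a b = s a (b * c)%g * s b c).

(* The twisted group algebra of a symmetric cocycle is commutative; a common
   eigenvector of its regular representation gives a character, whose values
   trivialize s. *)
Lemma symmetric_coboundary : (forall a b, s a b = s b a) ->
  exists c : gT -> K, [/\ forall a, c a != 0, c 1%g = 1
    & forall a b, s a b * c a * c b = c (a * b)%g].
Proof.
move=> sS; pose N := #|gT|.
pose M a : 'M[K]_N := \matrix_(i, j)
  (s (enum_val i) a *+ (enum_val j == (enum_val i * a)%g)).
have MM a b : M a *m M b = s a b *: M (a * b)%g.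
  apply/matrixP => i j; rewrite !mxE.
  rewrite (bigD1 (enum_rank (enum_val i * a)%g)) //= big1 => [|k ki].
    rewrite !mxE enum_rankK eqxx addr0 mulgA mulrnAr mulrnAr; congr (_ *+ _).
    by rewrite mulr1n mulrC [RHS]mulrC sC mulrC.
  rewrite !mxE; case: eqP => [E|_]; last by rewrite mul0r.
  by rewrite -E enum_valK eqxx in ki.
have N0 : (0 < N)%N by apply/card_gt0P; exists 1%g.
have [|v v0 /allP vS] := @common_eigenvector K N [seq M a | a <- enum gT] N0.
  move=> _ _ /mapP[a _ ->] /mapP[b _ ->]; rewrite /comm_mx.
  by rewrite !MM abelG sS.
have E a : exists e, v *m M a = e *: v.
  by apply/sub_rVP; apply: vS; apply: map_f; rewrite mem_enum.
pose e a := sval (cid (E a)); have eE a : v *m M a = e a *: v by rewrite /e; case: cid.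
have vI (k k' : K) : k *: v = k' *: v -> k = k'.
  move/eqP; rewrite -subr_eq0 -scalerBl scaler_eq0 (negPf v0) orbF subr_eq0.
  by move/eqP.
have ee a b : e a * e b = s a b * e (a * b)%g.
  apply: vI; rewrite -[RHS]scalerA -eE scalemxAr -MM mulmxA eE -scalemxAl eE.
  by rewrite scalerA.
have e1 : e 1%g = 1.
  apply: vI; rewrite -eE scale1r; have -> : M 1%g = 1%:M.
    apply/matrixP => i j; rewrite !mxE mulg1 s1 (inj_eq enum_val_inj).
    by rewrite eq_sym.
  by rewrite mulmx1.
have e0 a : e a != 0.
  apply/eqP => ea; have := ee a a^-1%g; rewrite ea mul0r mulgV e1 mulr1 => /eqP.
  by rewrite eq_sym (negPf (s0 _ _)).
exists (fun a => (e a)^-1); split=> [a||a b]; rewrite ?invr_eq0 ?e1 ?invr1 //.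
have := ee a b => /(congr1 (fun x => x / (e a * e b * e (a * b)%g))).
have := e0 a; have := e0 b; have := e0 (a * b)%g => x y z eab.
have -> : s a b / e a / e b = s a b * e (a * b)%g / (e a * e b * e (a * b)%g).
  by field; rewrite x y z.
by rewrite -eab; field; rewrite x y z.
Qed.

End SymmetricCocycle.

Variable l : nat.
Hypotheses (expG : forall a : gT, (a ^+ l)%g = 1%g) (lodd : odd l).
Variable s : gT -> gT -> K.
Hypotheses (s0 : forall a b, s a b != 0) (s1 : forall a, s a 1%g = 1)
  (sC : forall a b c, s (a * b)%g c * s a b = s a (b * c)%g * s b c).

Let alt a b := s a b / s b a.

(** Commutativity lets the cocycle identities at [(a, b, c)], [(c, a, b)] and [(a, c, b)] be
    combined; all values of [s] on products other than [a * b] with [c] cancel. *)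
Let altMl a b c : alt (a * b)%g c = alt a c * alt b c.
Proof.
have h1 := sC a b c; have h2 := sC c a b; have h3 := sC a c b.
rewrite [(c * a)%g]abelG in h2; rewrite [(c * b)%g]abelG in h3.
rewrite /alt; apply: (mulfI (s0 a b)).
apply: (mulIf (s0 c (a * b)%g)); apply: (mulIf (s0 (a * c)%g b)).
apply: (mulIf (s0 c a)); apply: (mulIf (s0 c b)).
transitivity ((s (a * b)%g c * s a b) * (s (a * c)%g b * s c a) * s c b).
  by field; rewrite !s0.
rewrite h1.
transitivity ((s (a * c)%g b * s a c) * s b c * (s c (a * b)%g * s a b)); last first.
  by field; rewrite !s0.
by rewrite -h2 h3; ring.
Qed.

Let altV a b : alt b a = (alt a b)^-1.
Proof. by rewrite /alt invf_div. Qed.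

Let altX a b k : alt (a ^+ k)%g b = alt a b ^+ k.
Proof.
have a1 : alt 1%g b = 1.
  have := altMl 1%g 1%g b; rewrite mul1g => E.
  have n0 : alt 1%g b != 0 by rewrite mulf_neq0 ?invr_eq0.
  by apply: (mulfI n0); rewrite -E mulr1.
by elim: k => [|k IH]; rewrite ?a1 // expgS altMl IH exprS.
Qed.

(* B is the square root alt^((l + 1) / 2) of the alternation of s; then s / B is
   symmetric. *)
Lemma abelian_cocycle : exists (B : gT -> gT -> K) (c : gT -> K),
  [/\ Alt B, forall a, c a != 0, c 1%g = 1
    & forall a b, s a b * c a * c b = B a b * c (a * b)%g].
Proof.
pose k := l.+1./2; pose B a b := alt a b ^+ k.
have B2 a b : B a b ^+ 2 = alt a b.
  have kE : (k * 2)%N = l.+1.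
    by have := odd_double_half l.+1; rewrite /k /= lodd; lia.
  rewrite /B -exprM kE exprS -altX expG; have := altX a b 0.
  by rewrite expg0 expr0 => ->; rewrite mulr1.
have BV a b : B a b = (B b a)^-1 by rewrite /B altV exprVn.
have B0 a b : B a b != 0 by rewrite expf_neq0 // mulf_neq0 ?invr_eq0.
have Bl a b c : B (a * b)%g c = B a c * B b c by rewrite /B altMl exprMn.
have Br a b c : B a (b * c)%g = B a b * B a c.
  by rewrite BV Bl invfM -!BV.
suff [c [c0 c1 cE]] : exists c : gT -> K, [/\ forall a, c a != 0, c 1%g = 1
    & forall a b, (s a b / B a b) * c a * c b = c (a * b)%g].
  exists B, c; split=> // a b.
  by rewrite -cE; field; apply: B0.
have hB : bicharacter B by split.
apply: (@symmetric_coboundary (fun a b => s a b / B a b)) => [a b|a|a b c|a b].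
- by rewrite mulf_neq0 ?invr_eq0.
- by rewrite s1 (bichar1r hB) divr1.
- have := sC a b c => /(congr1 (fun x => x / (B a b * B a c * B b c))) E.
  rewrite Bl Br; transitivity (s (a * b)%g c * s a b / (B a b * B a c * B b c)).
    by field; rewrite !B0.
  by rewrite E; field; rewrite !B0.
- have E : B a b ^+ 2 * s b a = s a b by rewrite B2 /alt divfK.
  rewrite -E [B b a]BV invrK; field; exact: B0.
Qed.
End AbelianCocycles.

(** * The De Concini-Kac algebra *)

Section CharacterGroup.
Variables (K : closedFieldType) (G : finZmodType).
Implicit Types a b : chargrp G K.

Lemma chargrpM a b x : (a * b)%g x = a x * b x.
Proof. by rewrite [(a * b)%g]/(Defs.charM a b) /= ffunE. Qed.

Lemma chargrp1 x : (1%g : chargrp G K) x = 1.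
Proof. by rewrite [1%g]/(Defs.char1 G K) /= ffunE. Qed.

Lemma chargrp_mulC a b : (a * b)%g = (b * a)%g.
Proof. by apply/val_inj/ffunP => x; rewrite !chargrpM mulrC. Qed.

Lemma chargrp_neq0 a x : a x != 0.
Proof.
by apply/eqP => ax; have := chargrpM a a^-1%g x; rewrite mulgV chargrp1 ax mul0r
  => /eqP; rewrite oner_eq0.
Qed.

Lemma chargrpV a x : (a^-1)%g x = (a x)^-1.
Proof.
apply: (mulfI (chargrp_neq0 a x)); rewrite -chargrpM mulgV chargrp1 mulfV //.
exact: chargrp_neq0.
Qed.

Lemma chargrpX a k x : (a ^+ k)%g x = a x ^+ k.
Proof. by elim: k => [|k IH]; rewrite ?chargrp1 // expgS chargrpM IH exprS. Qed.

End CharacterGroup.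

Lemma chargrp_torus_exp (K : closedFieldType) n l (a : chargrp (torus n l) K) :
  (1 < l)%N -> (a ^+ l)%g = 1%g.
Proof.
move=> l1; apply/val_inj/ffunP => x; rewrite chargrpX chargrp1 -Defs.charX.
suff -> : x *+ l = 0 by rewrite Defs.char0.
apply/rowP => i; rewrite mulmxnE mxE -mulr_natr.
by rewrite (_ : l%:R = 0) ?mulr0 //; exact: (@pchar_Zp l l1).
Qed.

Section DKAlgebra.
Variables (K : closedFieldType) (n l : nat) (ip : 'I_n -> 'I_n -> int) (q : K).
Local Notation Gv := (chargrp (torus n l) K).
Variables (U : algType K) (F : 'I_n -> U) (w : Gv -> U).
Hypothesis hU : DK_algebra ip q F w.

Lemma DK_relations_morph (A : algType K) (g : {lrmorphism U -> A}) :
  DK_relations ip q (g \o F) (g \o w).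
Proof.
have [[sr w1 wM wF] _] := hU; split=> [i j ij||a b|a i] /=.
- rewrite -(raddf0 g) -(sr i j ij) /serre /= linear_sum.
  by apply: eq_bigr => k _; rewrite linearZ /= !rmorphM !rmorphXn.
- by rewrite w1 rmorph1.
- by rewrite wM rmorphM.
- by have /(congr1 g) := wF a i; rewrite !rmorphM linearZ.
Qed.

Lemma DK_ext (A : algType K) (g g' : {lrmorphism U -> A}) :
  (forall i, g (F i) = g' (F i)) -> (forall a, g (w a) = g' (w a)) -> g =1 g'.
Proof.
move=> gF gw x; have [_ /(_ _ _ _ (DK_relations_morph g'))[f _ fu]] := hU.
by rewrite (fu g) // (fu g').
Qed.

Variables (hs : hopf_structure U) (a : 'I_n -> Gv).
Hypothesis hhs : DK_hopf a F w hs.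

Lemma wM x y : w (x * y)%g = w x * w y.
Proof. by have [[_ _ + _] _] := hU; apply. Qed.

Lemma w1 : w 1%g = 1. Proof. by have [[_ + _ _] _] := hU. Qed.

Lemma wF x i : w x * F i = x (Kgen l i) *: (F i * w x).
Proof.
have [[_ _ _ /(_ x i) E] _] := hU.
by rewrite scalerAl -E -[RHS]mulrA -wM mulVg w1 mulr1.
Qed.

Lemma comul_w x : comul hs (w x) = w x (x) w x. Proof. exact: hhs.1. Qed.

Lemma comul_F i : comul hs (F i) = F i (x) w (a i)^-1%g + 1 (x) F i.
Proof. exact: hhs.2. Qed.

Lemma w_neq0 x : w x != 0.
Proof.
apply/eqP => wx; have := wM x x^-1%g; rewrite mulgV w1 wx mul0r => /eqP.
by rewrite oner_eq0.
Qed.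

Lemma sw2_w x (W : lmodType K) (b : U -> U -> W) :
  (forall y, linear (b^~ y)) -> (forall x, linear (b x)) ->
  sw2 hs (w x) b = b (w x) (w x).
Proof. exact: sw2_pure (comul_w x). Qed.

Lemma sw2_F i (W : lmodType K) (b : U -> U -> W) :
  (forall y, linear (b^~ y)) -> (forall x, linear (b x)) ->
  sw2 hs (F i) b = b (F i) (w (a i)^-1%g) + b 1 (F i).
Proof. exact: sw2_pure2 (comul_F i). Qed.

(** [DK_hopf] prescribes the coproduct only; the counit axiom at [w x] reads
    [counit hs (w x) *: w x = w x], and [w x] is not zero. The value at [F i] is found in the same
    way. *)
Lemma counit_w x : counit hs (w x) = 1.
Proof.
have := sw2_counitl hs (f := @id U) (w x) (@lin_id _ _).
rewrite sw2_w; [|by lin; exact: linearP|by lin].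
move=> E; apply/eqP; rewrite -subr_eq0.
have : ((counit hs (w x) : K) - 1) *: w x = 0 by rewrite scalerBl scale1r E subrr.
by move/eqP; rewrite scaler_eq0 (negPf (w_neq0 x)) orbF.
Qed.

Lemma counit_F i : counit hs (F i) = 0.
Proof.
have := sw2_counitl hs (f := @id U) (F i) (@lin_id _ _).
rewrite sw2_F; [|by lin; exact: linearP|by lin].
rewrite counit1 scale1r -[RHS]add0r => /addIr /eqP.
by rewrite scaler_eq0 (negPf (w_neq0 _)) orbF => /eqP.
Qed.

Variable p : {lrmorphism U -> grpalg K Gv}.
Hypothesis hp : DK_projection F w p.

(** The coproduct of the group algebra as an algebra map, so that its compatibility with [p] can be
    checked on the generators of [U]. *)
Let dg (x : grpalg K Gv) : tga (grpalg K Gv) (bichar_triv K Gv) :=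
  [ffun c => x c *: gbasis K c].

Let dg_linear : linear dg.
Proof.
by move=> k x y; apply/ffunP => c; rewrite !ffunE scalerDl scalerA.
Qed.
HB.instance Definition _ := GRing.isLinear.Build K _ _ *:%R dg dg_linear.

Lemma gbasisM (x y : Gv) : gbasis K x * gbasis K y = gbasis K (x * y)%g.
Proof.
apply/ffunP => c; rewrite ffunE (bigD1 x) //= big1 => [|d /negPf dx].
  rewrite !ffunE eqxx mul1r addr0; congr (_%:R).
  by rewrite (canF_eq (mulKVg x)).
by rewrite !ffunE dx mul0r.
Qed.

Let dg_monoid : monoid_morphism dg.
Proof.
split=> [|x y]; apply/ffunP => c.
  by rewrite !ffunE; case: eqP => [->|_]; rewrite ?scale1r ?scale0r.
rewrite ffunE tgME ffunE scaler_suml; apply: eq_bigr => d _.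
by rewrite !ffunE -scalerAl -scalerAr gbasisM mulKVg scale1r scalerA.
Qed.
HB.instance Definition _ := GRing.isMonoidMorphism.Build _ _ dg dg_monoid.

Let aug (x : grpalg K Gv) : K^o := \sum_c x c.

Let aug_linear : linear aug.
Proof. by apply: lin_sum => c k x y; rewrite !ffunE. Qed.
HB.instance Definition _ := GRing.isLinear.Build K _ _ *:%R aug aug_linear.

Let aug_monoid : monoid_morphism aug.
Proof.
split=> [|x y]; rewrite /aug.
  rewrite (bigD1 1%g) //= big1 ?addr0 => [|d /negPf d1]; by rewrite ffunE ?eqxx ?d1.
transitivity (\sum_c \sum_d x d * y (d^-1 * c)%g).
  by apply: eq_bigr => c _; rewrite ffunE.
rewrite exchange_big mulr_suml; apply: eq_bigr => d _ /=.
by rewrite mulr_sumr (reindex_inj (mulgI d)) /=; apply: eq_bigr => c _; rewrite mulKg.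
Qed.
HB.instance Definition _ := GRing.isMonoidMorphism.Build _ _ aug aug_monoid.

Let ceps (x : U) : K^o := counit hs x.
Let ceps_linear : linear ceps. Proof. exact: linearP. Qed.
HB.instance Definition _ := GRing.isLinear.Build K _ _ *:%R ceps ceps_linear.
Let ceps_monoid : monoid_morphism ceps.
Proof. by split=> [|x y]; [apply: counit1 | apply: counitM]. Qed.
HB.instance Definition _ := GRing.isMonoidMorphism.Build _ _ ceps ceps_monoid.

Lemma DK_proj_coalgebra : coalgebra_map hs p.
Proof.
have [pF pw] := hp.
have lp c : linear (fun x => p x c : K^o) by apply: proj_coef_lin.
split=> [h x y|h].
  have E : dg (p h) = rmix hs p p h.
    apply: (DK_ext (g := dg \o p) (g' := rmix hs p p)) => [i|z] /=.
      apply/ffunP => c; rewrite !ffunE sw2_F; try by lin.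
      by rewrite pF rmorph1 !ffunE scaler0 !scale0r addr0.
    apply/ffunP => c; rewrite !ffunE sw2_w; try by lin.
    by rewrite pw !ffunE; case: eqP => [->|_]; rewrite ?scale0r.
  have /ffunP/(_ y)/ffunP/(_ x) := E; rewrite !ffunE.
  have lx : linear (fun z : grpalg K Gv => z x : K^o) by move=> ? ? ?; rewrite !ffunE.
  rewrite (sw2_fun _ _ _ lx) => e.
  transitivity (p h y * (x == y)%:R).
    rewrite -[RHS]/(p h y *: ((x == y)%:R : K^o)) e; apply: eq_sw2 => u v.
    by rewrite ffunE mulrC.
  by case: eqP => [->|_]; rewrite ?mulr1 ?mulr0.
have -> : counit hs h = ceps h by [].
rewrite -[LHS]/(aug (p h)).
apply: (DK_ext (g := aug \o p) (g' := ceps)) => [i|z] /=.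
  by rewrite pF /ceps counit_F; apply: raddf0.
rewrite pw /ceps counit_w /aug (bigD1 z) //= big1 ?addr0 => [|c /negPf cz].
  by rewrite ffunE eqxx.
by rewrite ffunE cz.
Qed.

Lemma restrict_form_w B x y : restrict_form p B (w x) (w y) = B x y.
Proof.
have [_ pw] := hp; rewrite rfE !pw (bigD1 x) //= [X in _ + X]big1 => [|c /negPf cx].
  rewrite (bigD1 y) //= big1 => [|d /negPf dy].
    by rewrite !ffunE !eqxx !mul1r !addr0.
  by rewrite !ffunE dy mulr0 mul0r.
by apply: big1 => d _; rewrite !ffunE cx !mul0r.
Qed.

End DKAlgebra.

Lemma qad_morph (K : fieldType) (A A' : algType K) (g : {lrmorphism A -> A'})
    c T x y m : g (qad c T x y m) = qad c T (g x) (g y) m.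
Proof.
elim: m => //= m IH.
by rewrite linearB linearZ /= !rmorphM /= IH.
Qed.

Lemma Mem1 (K : fieldType) (gT : finGroupType) (A : algType K)
    (B : gT -> gT -> K) (hB : bicharacter B) x (e : tga A hB) c :
  (e * em hB 1%g x) c = e c * x.
Proof.
rewrite tgME (bigD1 c) //= big1 => [|a /negPf ac].
  by rewrite ffunE mulVg eqxx addr0 (bichar1r hB) scale1r.
by rewrite ffunE -eq_mulVg1 ac mulr0 scaler0.
Qed.

Lemma em_exp (K : fieldType) (gT : finGroupType) (A : algType K)
    (B : gT -> gT -> K) (hB : bicharacter B) a (x : A) k :
  exists z, em hB a x ^+ k = em hB (a ^+ k)%g z.
Proof.
elim: k => [|k [z E]]; first by exists 1.
by rewrite exprS E emM; eexists; rewrite expgS.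
Qed.

(** * Lifting the generators and relations to the twisted algebra *)

Section LiftConstruction.
Variables (K : closedFieldType) (n l : nat) (ip : 'I_n -> 'I_n -> int) (q : K).
Local Notation Gv := (chargrp (torus n l) K).
Variables (U : algType K) (F : 'I_n -> U) (w : Gv -> U).
Hypothesis hU : DK_algebra ip q F w.
Variables (hs : hopf_structure U) (a : 'I_n -> Gv).
Hypothesis hhs : DK_hopf a F w hs.
Hypothesis ha : root_character ip q a.
(** The root data in numerical form: [len i] is half the norm of alpha_i and [r i j] is -<alpha_i,
    alpha_j>. Condition [qd] serves to choose the shifts of the generators, [qi] to divide by
    quantum integers, and [qs] to kill the scalars in the lifted Serre relations. *)
Variables (len : 'I_n -> nat) (r : 'I_n -> 'I_n -> nat).
Hypotheses (ipC : forall i j, ip i j = ip j i)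
  (ipd : forall i, ip i i = (2 * len i)%N)
  (ipo : forall i j, i != j -> ip i j = - (r i j * len i)%N%:Z)
  (pairE : forall i j, i != j -> pairing ip i j = - (r i j)%:Z)
  (r3 : forall i j, (r i j <= 3)%N)
  (q0 : q != 0)
  (qd : forall i, q ^+ (2 * len i) != 1)
  (qi : forall i j k, (0 < k <= (r i j).+1)%N -> q ^+ (k.*2 * len i) != 1)
  (qs : forall i j, q ^+ ((r i j).+1 * (2 * len i) + 2 * len j) != 1).
Variables (s : U -> U -> K) (cs : cocycle_twist hs s).
Variables (B : Gv -> Gv -> K) (c : Gv -> K) (hB : Alt B).
Hypotheses (c0 : forall x, c x != 0) (c1 : c 1%g = 1)
  (cB : forall x y, s (w x) (w y) * c x * c y = B x y * c (x * y)%g).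

Local Notation T := (twalg cs).
Local Notation kap i x := ((x : Gv) (Kgen l i)).
Local Notation wM := (wM hU).
Let b0 x y : B x y != 0. Proof. by case: hB => -[]. Qed.
Let BV x y : B x y = (B y x)^-1. Proof. by case: hB. Qed.
Let s1 := (cocycle_biform cs).1.
Let s2 := (cocycle_biform cs).2.

Let sw0 x y : s (w x) (w y) != 0.
Proof.
have := cB x y => E; apply/eqP => s0; move: E; rewrite s0 !mul0r => /eqP.
by rewrite eq_sym mulf_eq0 (negPf (b0 _ _)) (negPf (c0 _)).
Qed.

Let sB x y : s (w x) (w y) * B y x = s (w y) (w x) * B x y.
Proof.
have e1 := cB x y; have e2 := cB y x; rewrite chargrp_mulC in e2.
apply: (mulIf (c0 x)); apply: (mulIf (c0 y)); apply: (mulIf (c0 (x * y)%g)).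
transitivity ((s (w x) (w y) * c x * c y) * (B y x * c (x * y)%g)); first by ring.
by rewrite e1 -e2; ring.
Qed.

Let Wm (x : Gv) : T := w x.
Let X i : T := F i.

Let WW x y : Wm x * Wm y = s (w x) (w y) *: Wm (x * y)%g.
Proof.
rewrite [LHS]/(twmul hs s (w x) (w y)) /twmul (sw2_w hhs); first last.
- by move=> *; lin; exact: s1.
- by move=> *; lin.
rewrite (sw2_w hhs); first last.
- by move=> *; lin; exact: s2.
- by move=> *; lin.
by rewrite -wM.
Qed.

Let XW i x : X i * Wm x
  = s (w (a i)^-1%g) (w x) *: (F i * w x : U) + s (F i) (w x) *: (w x : U).
Proof.
rewrite [LHS]/(twmul hs s (F i) (w x)) /twmul (sw2_F hhs); first last.
- by move=> *; lin; exact: s1.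
- by move=> *; lin.
rewrite !(sw2_w hhs); try by move=> *; lin; try exact: s2.
by rewrite mul1r.
Qed.

Let WX i x : Wm x * X i
  = s (w x) (w (a i)^-1%g) *: (w x * F i : U) + s (w x) (F i) *: (w x : U).
Proof.
rewrite [LHS]/(twmul hs s (w x) (F i)) /twmul (sw2_w hhs); first last.
- by move=> *; lin; exact: s1.
- by move=> *; lin.
rewrite (sw2_F hhs); try by move=> *; lin; try exact: s2.
by rewrite mulr1.
Qed.

(** [chi] is the commutation factor of [w x] with [F i], corrected by the alternation of [s]; [mu]
    is the inhomogeneous term created by the twist, which a shift of [X i] is to remove. *)
Let chi i x := kap i x * s (w x) (w (a i)^-1%g) / s (w (a i)^-1%g) (w x).
Let mu i x := s (w x) (F i) - chi i x * s (F i) (w x).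

Let WX_comm i x : Wm x * X i = chi i x *: (X i * Wm x) + mu i x *: Wm x.
Proof.
rewrite WX XW (wF hU) scalerDr !scalerA scalerBl -addrA; congr (_ + _).
  by congr (_ *: _); rewrite /chi divfK // mulrC.
by rewrite addrC subrK.
Qed.

(** At [(a i)^-1] the two values of [s] in [chi] coincide, which leaves the inverse of q^(alpha_i,
    alpha_i). *)
Let chi_neq1 i : chi i (a i)^-1%g != 1.
Proof.
rewrite /chi mulfK ?sw0 // chargrpV ha ipd invr_eq1; exact: qd.
Qed.

(* Computed by moving F_i through w x w y, which is w y w x up to a scalar. *)
Let mu_cocycle i x y : mu i x * (1 - chi i y) = mu i y * (1 - chi i x).
Proof.
have E u v : Wm u * Wm v * X i = (chi i u * chi i v) *: (X i * (Wm u * Wm v))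
    + (chi i v * mu i u + mu i v) *: (Wm u * Wm v).
  have h := WX_comm i u; have h' := WX_comm i v.
  move: (chi i u) (chi i v) (mu i u) (mu i v) h h' => cu cv mu_ mv h h'.
  rewrite -mulrA h' mulrDr -!scalerAr [Wm u * (X i * _)]mulrA h mulrDl -!scalerAl.
  rewrite -[X i * _ * _]mulrA scalerDr !scalerA -addrA -scalerDl.
  by rewrite [cv * cu]mulrC.
pose k := s (w x) (w y) / s (w y) (w x).
have xy : Wm x * Wm y = k *: (Wm y * Wm x).
  by rewrite !WW scalerA /k divfK // chargrp_mulC.
have k0 : k != 0 by rewrite mulf_neq0 ?invr_eq0.
have yx0 : Wm y * Wm x != 0.
  by rewrite WW scaler_eq0 (negPf (sw0 _ _)) (w_neq0 hU).
have := E x y; rewrite xy -scalerAl E.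
move: (chi i x) (chi i y) (mu i x) (mu i y) => cx cy mx my.
rewrite -scalerAr scalerDr !scalerA mulrC [cy * cx]mulrC => /addrI /eqP.
rewrite -subr_eq0 -scalerBl scaler_eq0 (negPf yx0) orbF.
have -> : k * (cx * my + mx) - (cy * mx + my) * k
  = k * (my * (cx - 1) - mx * (cy - 1)) by ring.
by rewrite mulf_eq0 (negPf k0) subr_eq0 => /eqP E2; rewrite -opprB mulrN -E2; ring.
Qed.

(** The shifted generator is an eigenvector for [Wm y] when [lam i * (1 - chi i y) = - mu i y]. This
    is solved at [y = (a i)^-1], and [mu_cocycle] extends it to every [y]. *)
Let lam i := - mu i (a i)^-1%g / (1 - chi i (a i)^-1%g).
Let x_ i : T := X i + lam i *: 1.

Let Wx i y : Wm y * x_ i = chi i y *: (x_ i * Wm y).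
Proof.
have d0 : 1 - chi i (a i)^-1%g != 0 by rewrite subr_eq0 eq_sym chi_neq1.
rewrite /x_ mulrDr mulrDl WX_comm -scalerAr mulr1 -scalerAl mul1r scalerDr scalerA.
rewrite -addrA -scalerDl; congr (_ + _ *: _).
rewrite /lam; have := mu_cocycle i y (a i)^-1%g => E.
apply: (mulIf d0); rewrite mulrDl E.
by field; rewrite d0.
Qed.

Let Bi x y := (B x y)^-1.
Lemma Alt_bicharV : bicharacter (fun x y => (B x y)^-1).
Proof.
have [[n0 Bl Br] _] := hB; split=> [x y|x y z|x y z]; rewrite ?invr_eq0 ?n0 //.
  by rewrite Bl invfM.
by rewrite Br invfM.
Qed.
Let hBi : bicharacter Bi := Alt_bicharV.

Local Notation E := (tga (twalg cs) hBi).
Local Notation D := (tga (htens hs (twalg cs)) hBi).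
Local Notation ema := (@em K _ T Bi hBi).

Let W' (x : Gv) : E := ema x (c x *: Wm x).
(** The degree is that of the group-like in the coproduct of [F i], and the factor [c] makes that
    group-like appear as [W' (a i)^-1] in the coaction. *)
Let F' i : E := ema (a i)^-1%g (c (a i)^-1%g *: x_ i).

Let W'M x y : W' (x * y)%g = W' x * W' y.
Proof.
rewrite /W' emM -scalerAl -scalerAr WW !scalerA; congr (em _ _ (_ *: _)).
have := cB x y => e; apply: (mulfI (b0 x y)); rewrite -e /Bi; field.
exact: b0.
Qed.

Let W'1 : W' 1%g = 1.
Proof. by rewrite /W' c1 scale1r /Wm (w1 hU). Qed.

(** By [sB], [s] and [B] have the same alternation; the twist of [E] by the inverse of [B] therefore
    removes the correction contained in [chi], leaving the original commutation factor. *)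
Let W'F i x : W' x * F' i = kap i x *: (F' i * W' x).
Proof.
rewrite /W' /F' !emM -emZ chargrp_mulC; congr (em _ _ _).
rewrite -!scalerAl -!scalerAr Wx !scalerA; congr (_ *: _).
have := sB x (a i)^-1%g; have := b0 x (a i)^-1%g; have := b0 (a i)^-1%g x.
have := sw0 (a i)^-1%g x; rewrite /Bi /chi.
set y := (a i)^-1%g => sy0 yx0 xy0 e.
have -> : s (w x) (w y) = s (w y) (w x) * B x y / B y x by rewrite -e mulfK.
by field; rewrite sy0 yx0 xy0.
Qed.

(** [D] plays the role of the tensor product of [U] and [E]: [phi] and [iota] include the two
    factors, whose images commute, and [rho] is the coaction. *)
Let iota : {lrmorphism E -> D} := tga_map (tens_in2 hs).
Let phi : {lrmorphism U -> D} := em1 hBi \o tens_in1 hs T.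
Let rho : {lrmorphism E -> D} := tga_map (tw_coact cs).

Let phi_iota x e : phi x * iota e = iota e * phi x.
Proof.
apply/ffunP => d; rewrite /phi /= /em1 em1M Mem1 !ffunE !htensM.
by rewrite !mulr1 !mul1r.
Qed.

Let pi_M x y e e' : phi x * iota e * (phi y * iota e') = phi (x * y) * iota (e * e').
Proof.
rewrite -mulrA [iota e * _]mulrA -phi_iota -!mulrA mulrA.
by rewrite !rmorphM -!mulrA.
Qed.

Let pi_X x e k : (phi x * iota e) ^+ k = phi (x ^+ k) * iota (e ^+ k).
Proof.
elim: k => [|k IH]; last by rewrite !exprS IH pi_M.
by rewrite !expr0 !rmorph1 mulr1.
Qed.

Let k_ i := W' (a i)^-1%g.

Let rho_em x z : rho (ema x z) = em hBi x (tw_coact cs z).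
Proof. exact: tga_map_em. Qed.

Let iota_em x z : iota (ema x z) = em hBi x (tens_in2 hs z).
Proof. exact: tga_map_em. Qed.

Let phiE x : phi x = em hBi 1%g (tens_in1 hs T x). Proof. by []. Qed.

(** The scalar [lam i] is coinvariant and goes into the second summand, so the coaction on [F' i]
    keeps the shape of the coproduct of [F i]. The two summands are those to which [qad_primitive]
    is applied. *)
Let rhoF i : rho (F' i) = phi (F i) * iota (k_ i) + iota (F' i).
Proof.
rewrite /k_ /W' /F' rho_em !iota_em phiE emM mul1g (bichar1l hBi).
rewrite scale1r -(linD _ _ (em_linear hBi _)); congr (em _ _ _).
rewrite /x_ !linearZ /= !linearD !linearZ /= rmorph1.
have -> : tw_coact cs (X i) = tens_in1 hs T (F i) * tens_in2 hs (Wm (a i)^-1%g) + tens_in2 hs (X i).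
  by rewrite [LHS](comul_F hhs) /tens_in1 /tens_in2 htensM mulr1 mul1r.
by rewrite rmorph1 -scalerAr !scalerDr addrA.
Qed.

Section SerreRelation.
Variables (i j : 'I_n).
Hypothesis ij : i != j.
Let m := (r i j).+1.
Let u := (q ^+ len i)^-1.

Let u0 : u != 0. Proof. by rewrite invr_eq0 expf_neq0. Qed.
Let m4 : (0 < m <= 4)%N. Proof. by rewrite /m /= ltnS r3. Qed.
Let un k : (0 < k <= m)%N -> u ^+ k.*2 != 1.
Proof.
move=> km; rewrite /u exprVn invr_eq1 -exprM mulnC; exact: qi km.
Qed.

Let serreE (A : algType K) (G : 'I_n -> A) :
  serre ip q G i j = qad (u ^+ m.-1) (u ^- 2) (G i) (G j) m.
Proof.
have em : `|1 - pairing ip i j|%N = m.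
  rewrite pairE // opprK /m; lia.
have eq : qroot ip q i = q ^+ len i.
  rewrite /qroot ipd (_ : ((2 * len i)%N %/ 2)%Z = len i) //.
  by rewrite PoszM mulrC mulzK.
by rewrite qad_serre // /serre em eq.
Qed.

Let cE : u ^+ m.-1 = q ^ ip i j.
Proof. by rewrite ipo // /u exprVn -exprM -exprnN mulnC exprnN. Qed.

Let TE : u ^- 2 = q ^ ip i i.
Proof. by rewrite ipd /u exprVn invrK -exprM mulnC. Qed.

Let aF d e : iota (F' d) * (phi (F e) * iota (k_ e))
  = (q ^ ip d e) *: (phi (F e) * iota (k_ e) * iota (F' d)).
Proof.
have E : iota (k_ e) * iota (F' d) = (q ^ ip d e)^-1 *: (iota (F' d) * iota (k_ e)).
  transitivity (iota (k_ e * F' d)); first by rewrite rmorphM.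
  by rewrite /k_ W'F chargrpV ha ipC linearZ rmorphM.
rewrite mulrA -phi_iota -!mulrA E -scalerAr scalerA divff ?scale1r //.
by rewrite expfz_neq0.
Qed.

(** The elements [k_] commute with each other and with the image of [phi], so every term has the
    same factor [k_ i ^+ m * k_ j] on the right; what remains is the image of a Serre relation of
    [U]. *)
Let serre_a : qad (u ^+ m.-1) (u ^- 2) (phi (F i) * iota (k_ i))
  (phi (F j) * iota (k_ j)) m = 0.
Proof.
rewrite qad_serre //.
have kk x y : W' x * W' y = W' y * W' x by rewrite -!W'M chargrp_mulC.
transitivity (\sum_(k < m.+1) phi (((-1) ^+ k * qbinom u m k) *:
    (F i ^+ (m - k) * F j * F i ^+ k)) * iota (k_ i ^+ m * k_ j)).
  apply: eq_bigr => k _; rewrite !pi_X !pi_M linearZ -scalerAl; congr (_ *: (_ * iota _)).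
  have cki : GRing.comm (k_ j) (k_ i ^+ k) by apply: commrX; apply: kk.
  by rewrite -mulrA cki mulrA -exprD subnK // -ltnS.
rewrite -mulr_suml -linear_sum -qad_serre // -serreE.
have [[-> // _ _ _] _] := hU.
by rewrite linear0 mul0r.
Qed.

Let y := qad (u ^+ m.-1) (u ^- 2) (F' i) (F' j) m.

Let rho_y : rho y = iota y.
Proof.
rewrite /rho /y qad_morph -/rho !rhoF qad_primitive //.
- by rewrite serre_a add0r /iota qad_morph.
- by rewrite aF TE.
- by rewrite aF cE.
- by rewrite aF ipC cE.
Qed.

(** Coinvariance says that the coproduct of [y d] is [1 (x) y d]; the counit applied to the second
    leg leaves a multiple of 1. *)
Let y_scalar d : exists k : K, y d = k *: 1.
Proof.
exists (counit hs (y d)).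
have /ffunP/(_ d) := rho_y; rewrite !ffunE.
have bb : bilinear_map (fun (a b : U) => (counit hs b : K) *: a).
  by apply: bilinP; lin; exact: linearP.
move=> /(congr1 (tlift (fun (a b : U) => (counit hs b : K) *: a))).
rewrite tliftE // => <-; symmetry.
exact: (sw2_counitr hs (f := id) _ (@lin_id _ _)).
Qed.

Let g := ((a i)^-1 ^+ m * (a j)^-1)%g.

Let y_supp : exists z, y = ema g z.
Proof.
rewrite /y qad_serre //.
apply: (big_ind (fun e => exists z, e = ema g z)).
- by exists 0; rewrite (lin0 (em_linear hBi _)).
- by move=> _ _ [z1 ->] [z2 ->]; exists (z1 + z2); rewrite (linD _ _ (em_linear hBi _)).
move=> k _; have [z1 E1] := em_exp hBi (a i)^-1%g (c (a i)^-1%g *: x_ i) (m - k).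
have [z2 E2] := em_exp hBi (a i)^-1%g (c (a i)^-1%g *: x_ i) k.
rewrite /F' E1 E2 !emM -emZ; eexists; congr (em _ _ _); rewrite /g.
by rewrite -mulgA [(_ * (_ ^+ k))%g]chargrp_mulC mulgA -expgD subnK // -ltnS.
Qed.

Let W'y x : W' x * y = (kap i x ^+ m * kap j x) *: (y * W' x).
Proof.
have WFX k : W' x * F' i ^+ k = kap i x ^+ k *: (F' i ^+ k * W' x).
  elim: k => [|k IH]; first by rewrite mulr1 mul1r scale1r.
  rewrite [F' i ^+ k.+1]exprS [LHS]mulrA W'F -scalerAl -[F' i * W' x * _]mulrA IH.
  by rewrite -scalerAr scalerA mulrA -!exprS.
rewrite /y qad_serre // mulr_sumr mulr_suml scaler_sumr; apply: eq_bigr => k _.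
rewrite -scalerAr -scalerAl !mulrA WFX -!scalerAl -[F' i ^+ (m - k) * W' x * F' j]mulrA.
rewrite W'F -scalerAr -scalerAl -[F' i ^+ (m - k) * (F' j * W' x) * _]mulrA.
rewrite -[F' j * W' x * _]mulrA WFX -!scalerAr !scalerA !mulrA; congr (_ *: _).
have -> : kap i x ^+ m = kap i x ^+ (m - k) * kap i x ^+ k.
  by rewrite -exprD subnK // -ltnS.
by ring.
Qed.

Lemma lift_serre : serre ip q F' i j = 0.
Proof.
rewrite serreE -/y; have [z yz] := y_supp; have [k yk] := y_scalar g.
have zk : z = k *: 1 by rewrite -yk yz ffunE eqxx.
(* Both factors lie in the same degree [g], so either order yields the same value of the
   bicharacter, and the coefficient of [y] is a scalar. *)
have comm : W' g * y = y * W' g.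
  rewrite yz zk /W' !emM -!scalerAl -!scalerAr mulr1 mul1r.
  by rewrite [c g *: _]scalerA [k *: _]scalerA [k * _]mulrC.
have := W'y g; rewrite comm => /eqP; rewrite -{1}[y * W' g]scale1r -subr_eq0 -scalerBl.
rewrite scaler_eq0 subr_eq0 eq_sym => /orP[/eqP e|/eqP e].
  have := qs i j; rewrite -/m; case/eqP.
  (* The eigenvalue is q to the power -(m^2 (alpha_i, alpha_i) + 2 m (alpha_i, alpha_j) + (alpha_j,
     alpha_j)). Since [m = r i j + 1], the sum is [m * (2 * len i) + 2 * len j], the exponent in
     [qs]. *)
  have kg d : kap d g = ((q ^ ip i d) ^+ m * q ^ ip j d)^-1.
    by rewrite /g chargrpM chargrpX !chargrpV !ha invfM exprVn.
  have qii : q ^ ip i i = q ^+ (2 * len i) by rewrite ipd.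
  have qij : q ^ ip i j = (q ^+ (r i j * len i))^-1 by rewrite ipo // exprnN.
  move: e; rewrite !kg [ip j i]ipC qii qij [ip j j]ipd => e0.
  have e : ((q ^+ (2 * len i)) ^+ m * (q ^+ (r i j * len i))^-1) ^+ m
      * ((q ^+ (r i j * len i))^-1 ^+ m * q ^+ (2 * len j)) = 1.
    by apply: invr_inj; rewrite invr1 invfM -exprVn.
  have G0 : q ^+ (r i j * len i) != 0 by rewrite expf_neq0.
  have Em : (q ^+ (2 * len i)) ^+ m = q ^+ (r i j * len i) ^+ 2 * q ^+ (2 * len i).
    by rewrite -!exprM -exprD; congr (_ ^+ _); rewrite /m; lia.
  have simp (A G C : K) : G != 0 -> A ^+ m = G ^+ 2 * A ->
      (A ^+ m * G^-1) ^+ m * (G^-1 ^+ m * C) = A ^+ m * C.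
    move=> nG E; have -> : A ^+ m * G^-1 = G * A by rewrite E; field.
    by rewrite exprMn mulrACA exprVn mulfV ?mul1r // expf_neq0.
  by rewrite -e simp // exprD mulnC exprM.
have -> : y = y * W' g * W' g^-1%g by rewrite -mulrA -W'M mulgV W'1 mulr1.
by rewrite e mul0r.
Qed.
End SerreRelation.

Let DKrel : DK_relations ip q F' W'.
Proof.
split; [exact: lift_serre | exact: W'1 | exact: W'M |] => x i.
by rewrite W'F -scalerAl -mulrA -W'M mulgV W'1 mulr1.
Qed.

Variable p : {lrmorphism U -> grpalg K Gv}.
Hypothesis hp : DK_projection F w p.

Lemma lift_exists : exists f : {lrmorphism U -> E},
  (forall h, tga_map (tw_coact cs) (f h) = lmix hs f h) /\
  (forall h, tga_coact (f h) = rmix hs f p h).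
Proof.
have [_ /(_ _ _ _ DKrel)[f [fF fw] _]] := hU; have [pF pw] := hp.
have lf d : linear (fun x => f x d) by apply: lin_ffun; exact: linearP.
have lp d : linear (fun x => p x d : K^o) by apply: proj_coef_lin.
have lt (x : U) d : linear (fun b => x (x) (f b d)) by apply: (lin_pr x (lf d)).
exists f; split=> h.
  apply: (DK_ext hU (g := rho \o f) (g' := lmix hs f)) => [i|x] /=.
    rewrite fF rhoF; apply/ffunP => d; rewrite [RHS]ffunE (sw2_F hhs); try (by lin); try (by move=> ?; exact: lt).
    by rewrite ffunE em1M !ffunE htensM mul1r mulr1 fF fw /F' /W' !ffunE.
  rewrite fw /W' rho_em; apply/ffunP => d; rewrite ![in RHS]ffunE (sw2_w hhs); try (by lin); try (by move=> ?; exact: lt).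
  rewrite fw !ffunE; case: eqP => _; last by rewrite (lin0 ((pure_bilin _ _).2 _)).
  by rewrite linearZ /= (linZ _ _ ((pure_bilin _ _).2 _)) [X in _ *: X](comul_w hhs).
apply: (DK_ext hU (g := @tga_coact _ _ _ hBi T \o f) (g' := rmix hs f p)) => [i|x] /=.
  apply/ffunP => d; rewrite !ffunE (sw2_F hhs); try by lin.
  rewrite pF pw fF /F' !ffunE scale0r addr0; case: eqP => [->|_].
    by rewrite scale1r.
  by rewrite scale0r (lin0 (em_linear hBi _)).
apply/ffunP => d; rewrite !ffunE (sw2_w hhs); try by lin.
rewrite pw fw /W' !ffunE; case: eqP => [->|_]; first by rewrite scale1r.
by rewrite scale0r (lin0 (em_linear hBi _)).
Qed.

Lemma DK_gauge_equiv (Baa : forall x, B x x = 1) :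
  gauge_equiv hs (restrict_form p B) s.
Proof.
have [f [col deg]] := lift_exists.
apply: (lift_gauge (DK_proj_coalgebra hU hhs hp) col deg) => [x|x y]; last first.
  by rewrite /Bi invrK.
by rewrite /Bi (bicharVr (B := B)) ?invrK; case: hB.
Qed.

End LiftConstruction.

Lemma odd_unity (K : fieldType) (x : K) l :
  odd l -> x ^+ l = 1 -> x ^+ 2 = 1 -> x = 1.
Proof.
move=> ol xl x2; rewrite -xl -[in RHS](odd_double_half l) ol add1n -mul2n.
by rewrite exprS exprM x2 expr1n mulr1.
Qed.

(** * Alternating forms on a group of odd exponent *)

Section AlternatingForms.
Variables (K : closedFieldType) (n l : nat).
Local Notation Gv := (chargrp (torus n l) K).
Hypotheses (l1 : (1 < l)%N) (ol : odd l).
Implicit Types B : Gv -> Gv -> K.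

Lemma bichar_exp B x y : bicharacter B -> B x y ^+ l = 1.
Proof.
move=> hB; have [_ Bl _] := hB.
have E k : B (x ^+ k)%g y = B x y ^+ k.
  by elim: k => [|k IH]; rewrite ?(bichar1l hB) // expgS Bl IH exprS.
by rewrite -E chargrp_torus_exp // (bichar1l hB).
Qed.

(** [B x x] is its own inverse and has odd order. *)
Lemma Alt_diag B x : Alt B -> B x x = 1.
Proof.
case=> hB BV; apply: (odd_unity ol); first exact: bichar_exp.
by rewrite expr2 {1}BV mulVf //; case: hB.
Qed.

Lemma Alt_inj B B' : Alt B -> Alt B' ->
  (forall x y, B x y ^+ 2 = B' x y ^+ 2) -> B = B'.
Proof.
move=> [hB BV] [hB' BV'] E; apply/funext => x; apply/funext => y.
have b0 : B' x y != 0 by case: hB'.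
apply: (mulIf (invr_neq0 b0)); rewrite divff //.
apply: (odd_unity ol); rewrite exprMn exprVn.
  by rewrite !bichar_exp // invr1 mulr1.
by rewrite E divff // expf_neq0.
Qed.

End AlternatingForms.

(** * Injectivity and surjectivity on gauge classes *)

Section CoTwDK.
Variables (K : numClosedFieldType) (n l : nat) (ip : 'I_n -> 'I_n -> int) (q : K).
Local Notation Gv := (chargrp (torus n l) K).
Variables (U : algType K) (F : 'I_n -> U) (w : Gv -> U).
Hypothesis hU : DK_algebra ip q F w.
Variables (hs : hopf_structure U) (a : 'I_n -> Gv).
Hypothesis hhs : DK_hopf a F w hs.
Variable p : {lrmorphism U -> grpalg K Gv}.
Hypothesis hp : DK_projection F w p.
Hypotheses (l1 : (1 < l)%N) (ol : odd l).

Lemma sw2_w_scalar x (b : U -> U -> K) : biform b ->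
  sw2 hs (w x) b = b (w x) (w x).
Proof. by case=> bl br; apply: (@sw2_pure _ _ _ _ _ _ K^o _ (comul_w hhs x)). Qed.

Lemma conv2_w s t x y : biform s -> biform t ->
  conv2 hs s t (w x) (w y) = s (w x) (w y) * t (w x) (w y).
Proof.
move=> [s1 s2] [t1 t2]; rewrite /conv2 sw2_w_scalar.
  by rewrite sw2_w_scalar //; split=> u; lin; [exact: s2 | exact: t2].
by split=> u; lin; [exact: s1 | exact: t1].
Qed.

Lemma cocycle_grouplike s : cocycle_twist hs s ->
  [/\ forall x y, s (w x) (w y) != 0, forall x, s (w x) (w 1%g) = 1
    & forall x y z, s (w (x * y)%g) (w z) * s (w x) (w y)
                  = s (w x) (w (y * z)%g) * s (w y) (w z)].
Proof.
move=> cs; have [s1 s2] := cocycle_biform cs.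
case: cs => _ [t [t1 t2] st] sC su; split=> [x y|x|x y z].
- have [/(congr1 (fun f => f (w x) (w y))) E _] := conv2_inverse st.
  (* At group-likes convolution is the pointwise product, so the inverse form [t] takes inverse
     values there. *)
  apply: contra_eq_neq E => sxy; rewrite conv2_w // sxy mul0r.
  by rewrite /counit2 !(counit_w hU hhs) mulr1 eq_sym oner_neq0.
- by rewrite (w1 hU) (su (w x)).2 (counit_w hU hhs).
have bz u : biform (fun a b => s (a * b) u).
  by apply: (biform_mul_form (v := s^~ u)); apply: s1.
have bx u : biform (fun a b => s u (a * b)).
  by apply: (biform_mul_form (v := s u)); apply: s2.
rewrite !(wM hU) -(conv2_w (s := fun a b => s (a * b) (w z))) //.
rewrite -(conv2_w (s := fun a b => s (w x) (a * b))) //.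
exact: sC.
Qed.

Lemma gauge_class_inj : set_inj (@Alt K Gv) (fun B => gauge_class hs (restrict_form p B)).
Proof.
move=> B B' /set_mem hB /set_mem hB' E; apply: (Alt_inj l1 ol hB hB') => x y.
have pco := DK_proj_coalgebra hU hhs hp.
have [b0 _ _] := hB.1; have [b0' _ _] := hB'.1.
have : gauge_class hs (restrict_form p B) (restrict_form p B').
  by rewrite E; split; [apply: rf_cocycle hB'.1 | apply/gauge_equiv_refl/rf_biform].
case=> _ /(gauge_equivE _ _ (rf_biform p B))[v [u [lv lu _ e]]].
have H z t : B' z t = v (w (z * t)%g) * (B z t * (u (w z) * u (w t))).
  rewrite -(restrict_form_w hp B') e conv2_w; first last.
  - by apply: biform_conv2; [apply: rf_biform | apply: biform_tens2].
  - exact: biform_mul_form.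
  rewrite conv2_w; [|exact: rf_biform|exact: biform_tens2].
  by rewrite (restrict_form_w hp) /mul_form -(wM hU).
have e1 := H x y; have e2 := H y x; rewrite chargrp_mulC in e2.
(* The factor coming from [v] and [u] is symmetric in the two arguments, so it cancels between
   [H x y] and [H y x]; alternation then turns the quotients into squares. *)
have e3 : B' x y * B y x = B' y x * B x y by rewrite e1 e2; ring.
rewrite (hB.2 y x) (hB'.2 y x) in e3.
have := congr1 (fun z => z * (B x y * B' x y)) e3 => e4.
transitivity ((B' x y)^-1 * B x y * (B x y * B' x y)).
  by field; rewrite b0'.
by rewrite -e4; field; rewrite b0.
Qed.

Hypothesis ha : root_character ip q a.
Variables (len : 'I_n -> nat) (r : 'I_n -> 'I_n -> nat).
Hypotheses (ipC : forall i j, ip i j = ip j i)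
  (ipd : forall i, ip i i = (2 * len i)%N)
  (ipo : forall i j, i != j -> ip i j = - (r i j * len i)%N%:Z)
  (pairE : forall i j, i != j -> pairing ip i j = - (r i j)%:Z)
  (r3 : forall i j, (r i j <= 3)%N)
  (q0 : q != 0)
  (qd : forall i, q ^+ (2 * len i) != 1)
  (qi : forall i j k, (0 < k <= (r i j).+1)%N -> q ^+ (k.*2 * len i) != 1)
  (qs : forall i j, q ^+ ((r i j).+1 * (2 * len i) + 2 * len j) != 1).

Lemma DK_cotwist_bij :
  set_bij (@Alt K Gv) (CoTw hs) (fun B => gauge_class hs (restrict_form p B)).
Proof.
have pco := DK_proj_coalgebra hU hhs hp.
split; [|exact: gauge_class_inj|].
  move=> B hB; exists (restrict_form p B) => //; exact: rf_cocycle hB.1.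
move=> _ [s cs <-]; have [s0 s1 sC] := cocycle_grouplike cs.
have [B [c [hB c0 c1 cB]]] := abelian_cocycle (@chargrp_mulC K (torus n l))
  (fun x => chargrp_torus_exp x l1) ol s0 s1 sC.
exists B => //.
have bB : biform (restrict_form p B) by apply: rf_biform.
have bs := cocycle_biform cs.
have Bs : gauge_equiv hs (restrict_form p B) s.
  apply: (DK_gauge_equiv hU hhs ha ipC ipd ipo pairE r3 q0 qd qi qs cs hB c0 c1 cB hp).
  by move=> x; apply: Alt_diag.
have sB := gauge_equiv_sym bB Bs.
apply/seteqP; split=> t [ct gt]; split=> //.
  exact: gauge_equiv_trans bs sB gt.
exact: gauge_equiv_trans bB Bs gt.
Qed.
End CoTwDK.

Theorem proposition6p3 (R : realType)
    (* the simple Lie algebra, its Cartan subalgebra, simple roots and form *)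
    (X : dynkin) (L : vectType R[i]) (br : lie_structure L) (h : {vspace L})
    (alpha : 'I_(dynkin_rank X) -> 'Hom(subvs_of h, R[i]^o))
    (ip : 'I_(dynkin_rank X) -> 'I_(dynkin_rank X) -> int)
    (hL : simple_lie br) (hh : cartan_subalgebra br h)
    (halpha : simple_roots br alpha) (hip : normalized_killing br alpha ip)
    (hX : of_type ip)
    (* the root of unity, and the simple roots as characters of G *)
    (l : nat) (q : R[i]) (hl : admissible_order X l)
    (hq : l.-primitive_root q)
    (a : 'I_(dynkin_rank X) -> chargrp (torus (dynkin_rank X) l) R[i])
    (ha : root_character ip q a)
    (* the modified De Concini-Kac algebra and its Hopf projection *)
    (U : algType R[i]) (F : 'I_(dynkin_rank X) -> U)
    (w : chargrp (torus (dynkin_rank X) l) R[i] -> U)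
    (hU : DK_algebra ip q F w)
    (hs : hopf_structure U) (hhs : DK_hopf a F w hs)
    (p : {lrmorphism U -> grpalg R[i] (chargrp (torus (dynkin_rank X) l) R[i])})
    (hp : DK_projection F w p) :
  set_bij (@Alt R[i] (chargrp (torus (dynkin_rank X) l) R[i])) (CoTw hs)
    (fun B => gauge_class hs (restrict_form p B)).
Proof.
have ipC := normalized_killing_sym hip; have [_ ip2] := hip.
have qN k : (q ^+ k != 1) = ~~ (l %| k)%N by rewrite (prim_order_dvd hq).
have [ol l1 _] := and3P hl.
(* The case [k = 1] of the divisibility bound is the condition on [q ^+ (2 * len i)]. *)
have d1 i : (0 < 1 <= (dynkin_mult X i i).+1)%N by [].
apply: (DK_cotwist_bij hU hhs hp l1 ol ha (len := fun i => dynkin_len X i)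
  (r := fun i j => dynkin_mult X i j)) => //.
- exact: ip_diag hX ipC ip2.
- by move=> i j ij; apply: (ip_offdiag hX ipC ip2).
- by move=> i j ij; apply: (pairingE hX ipC ip2).
- by move=> i j; apply: dynkin_mult_le.
- apply/eqP => qz; have /eqP := prim_expr_order hq.
  by rewrite qz expr0n gtn_eqF ?(ltnW l1) // eq_sym oner_eq0.
- by move=> i; rewrite qN; apply: (order_ndvd_qint hl (d1 i)).
- by move=> i j k kr; rewrite qN; apply: (order_ndvd_qint hl kr).
- by move=> i j; rewrite qN; apply: (order_ndvd_serre hl).
Qed.
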